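(* Let $n\ge 1$ and $k\ge 2$ be integers. If $C$ is a compact, Jordan-measurable subset of $\mathbb{R}^n$ with nonzero volume, then $$\Delta_{k,\mathbb{R}^n}\le\frac{\operatorname{vol}(B_1^n)}{\operatorname{vol}(C)}\,\Delta_k(C)$$ and $$\Delta_{k,\mathbb{R}^n}=\lim_{r\to\infty}\frac{\operatorname{vol}(B_1^n)}{\operatorname{vol}(rC)}\,\Delta_k(rC),$$ where $rC=\{rx : x\in C\}$.
   Context: $B_1^n$ is the closed unit ball in $\mathbb{R}^n$. A real kernel is positive definite if it is symmetric and $\sum_{x,y\in F}c_xc_yK(x,y)\ge 0$ for all finite sets $F$ of points and real weights $c$. Any subset $V\subseteq\mathbb{R}^n$ (including $V=\mathbb{R}^n$) is regarded as a graph in which $(x,y)$ is an edge if and only if $0<|x-y|<2$. For a graph with vertex set $V$, $I_k=I_k(V)$ is the topological space of independent sets of at most $k$ vertices (including the empty set), where the nonempty sets carry the quotient topology from $V^k$ and $\emptyset$ is an isolated point. For a topological space $X$, $\mathcal{C}(X)$ is the space of continuous functions $X\to\mathbb{R}$. For $T\colon V^2\times I_{k-2}\to\mathbb{R}$ and $S\in I_k\setminus\{\emptyset\}$ define $$B_kT(S)=\sum_{\substack{J\subseteq S\\|J|\le k-2}}\ \sum_{\substack{x,y\in S\\\{x,y\}\cup J=S}}T(x,y,J),$$ where the inner sum is over ordered pairs $(x,y)$. For compact $V\subset\mathbb{R}^n$, the $k$-point bound $\Delta_k(V)$ is the infimum of $M$ over all kernels $K\in\mathcal{C}(V^2\times I_{k-2})$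 and real numbers $M$ such that (1) $(x,y)\mapsto K(x,y,J)$ is positive definite for each fixed $J\in I_{k-2}$; (2) $B_kK(\{x\})\le M-1$ for all $x \in V$ and $B_kK(\{x,y\})\le-2$ for all $\{x,y\}\in I_2$ with $x\ne y$; (3) $B_kK(S)\le 0$ for all $S\in I_k$ with $|S|\ge 3$. The $k$-point sphere packing density bound $\Delta_{k,\mathbb{R}^n}$ is the infimum of $\operatorname{vol}(B_1^n)\,B_kf(\{0\})$ over all continuous functions $f\colon\mathbb{R}^n\times\mathbb{R}^n\times I_{k-2}(\mathbb{R}^n)\to\mathbb{R}$ satisfying (1) $f(x,y,J)=f(x+z,y+z,J+z)$ for all $x,y,z\in\mathbb{R}^n$ and $J\in I_{k-2}$, where $J+z=\{j+z:j\in J\}$; (2) $(x,y)\mapsto f(x,y,J)$ is positive definite for each fixed $J\in I_{k-2}$; (3) $B_kf(S)\le 0$ for all $S\in I_k$ with $|S|\ge 2$; (4) $x\mapsto f(x,0,\emptyset)$ is integrable on $\mathbb{R}^n$ and $\int_{\mathbb{R}^n}f(x,0,\emptyset)\,dx=1$. *)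

(* Defs.v *)
From HB Require Import structures.
From mathcomp Require Import all_boot all_order all_algebra finmap.
From mathcomp Require Import all_classical all_reals all_analysis.

Set Implicit Arguments.
Unset Strict Implicit.
Unset Printing Implicit Defensive.

Import Order.TTheory GRing.Theory Num.Theory.
Import numFieldNormedType.Exports numFieldTopology.Exports.

Local Open Scope classical_set_scope.
Local Open Scope ring_scope.

(* Lebesgue measure on R^n.  'rV[R]_n carries the sigma-algebra generated by
   the coordinate functions, i.e. the Borel sigma-algebra of R^n. *)

Definition rV_display (R : realType) : measure_display.
Proof. by []. Qed.

Section rV_measurable.
Variables (R : realType) (n : nat).

Definition rV_coord (i : 'I_n) (v : 'rV[R]_n) : measurableTypeR R := v 0 i.

Let rV_set0 : g_sigma_preimage rV_coord set0.
Proof. exact: sigma_algebra0. Qed.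

Let rV_setC A : g_sigma_preimage rV_coord A -> g_sigma_preimage rV_coord (~` A).
Proof. exact: sigma_algebraC. Qed.

Let rV_bigcup (F : (set 'rV[R]_n)^nat) :
  (forall i, g_sigma_preimage rV_coord (F i)) ->
  g_sigma_preimage rV_coord (\bigcup_i (F i)).
Proof. exact: sigma_algebra_bigcup. Qed.

HB.instance Definition _ := @isMeasurable.Build (rV_display R)
  'rV[R]_n (g_sigma_preimage rV_coord) rV_set0 rV_setC rV_bigcup.

End rV_measurable.

Section rV_measurable_lemmas.
Context d (T : measurableType d) (R : realType) (n : nat).

Lemma measurable_rV_coord (i : 'I_n) : measurable_fun setT (@rV_coord R n i).
Proof.
move=> _ Y mY; rewrite setTI; apply: sub_sigma_algebra => /=.
rewrite -bigcup_seq/=; exists i => /=; first by rewrite mem_index_enum.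
by exists Y => //; rewrite setTI.
Qed.

Lemma measurable_fun_rVP (f : T -> 'rV[R]_n) :
  (forall i, measurable_fun setT (@rV_coord R n i \o f)) ->
  measurable_fun setT f.
Proof.
move=> mf _ A mA; rewrite setTI.
have : g_sigma_preimage (fun i => @rV_coord R n i \o f) `<=` measurable.
  apply: smallest_sub; first exact: sigma_algebra_measurable.
  rewrite -bigcup_seq; apply: bigcup_sub => i _ B [C mC <-].
  exact: mf.
apply; rewrite g_sigma_preimage_comp; exists A => //.
by rewrite setTI.
Qed.

End rV_measurable_lemmas.

Section rV_cons.
Context (R : realType) (n : nat).

Definition rV_cons (p : measurableTypeR R * 'rV[R]_n) : 'rV[R]_n.+1 :=
  row_mx (const_mx p.1 : 'M[R]_1) p.2.

Definition rV_uncons (v : 'rV[R]_n.+1) : measurableTypeR R * 'rV[R]_n :=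
  (v 0 0, \row_j v 0 (lift ord0 j)).

Lemma rV_cons0 p : rV_cons p 0 0 = p.1.
Proof.
have -> : (0 : 'I_n.+1) = lshift n (0 : 'I_1) by exact: val_inj.
by rewrite /rV_cons (@row_mxEl _ _ 1) mxE.
Qed.

Lemma rV_consS p j : rV_cons p 0 (lift ord0 j) = p.2 0 j.
Proof.
have -> : lift ord0 j = rshift 1 j by exact: val_inj.
by rewrite /rV_cons (@row_mxEr _ _ 1).
Qed.

Lemma rV_consK : cancel rV_cons rV_uncons.
Proof.
move=> [x v]; congr pair; first by rewrite rV_cons0.
by apply/rowP => j; rewrite mxE rV_consS.
Qed.

Lemma measurable_rV_cons : measurable_fun setT rV_cons.
Proof.
apply: measurable_fun_rVP => i; case: (unliftP ord0 i) => [j ->|->].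
  rewrite (_ : _ \o _ = @rV_coord R n j \o snd); last first.
    by apply/funext => p /=; rewrite /rV_coord rV_consS.
  by apply: measurableT_comp => //; exact: measurable_rV_coord.
rewrite (_ : _ \o _ = fst); first exact: measurable_fst.
by apply/funext => p /=; rewrite /rV_coord rV_cons0.
Qed.

Lemma measurable_rV_uncons : measurable_fun setT rV_uncons.
Proof.
apply/measurable_fun_pairP; split.
  exact: (@measurable_rV_coord R n.+1 0).
apply: measurable_fun_rVP => j.
rewrite (_ : _ \o _ = @rV_coord R n.+1 (lift ord0 j)).
  exact: measurable_rV_coord.
by apply/funext => v /=; rewrite /rV_coord mxE.
Qed.

End rV_cons.

Section lebesgue_rVS.
Context (R : realType) (n : nat).
Variable mu : {sigma_finite_measure set 'rV[R]_n -> \bar R}.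
Local Open Scope ereal_scope.

Definition lebesgue_rVS : set 'rV[R]_n.+1 -> \bar R :=
  pushforward (@lebesgue_measure R \x mu) (@rV_cons R n).

Let mpre A : measurable A -> measurable (@rV_cons R n @^-1` A).
Proof.
by move=> mA; rewrite -[X in measurable X]setTI; exact: measurable_rV_cons.
Qed.

Let lebesgue_rVS0 : lebesgue_rVS set0 = 0.
Proof. by rewrite /lebesgue_rVS /pushforward preimage_set0 measure0. Qed.

Let lebesgue_rVS_ge0 A : 0 <= lebesgue_rVS A.
Proof. by rewrite /lebesgue_rVS /pushforward. Qed.

Let lebesgue_rVS_sigma_additive : semi_sigma_additive lebesgue_rVS.
Proof.
move=> F mF tF mUF; rewrite /lebesgue_rVS /pushforward preimage_bigcup.
apply: measure_semi_sigma_additive.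
- by move=> k; exact: mpre.
- apply/trivIsetP => /= i j _ _ ij; rewrite -preimage_setI.
  by move/trivIsetP : tF => /(_ _ _ _ _ ij) ->//; rewrite preimage_set0.
- by rewrite -preimage_bigcup; exact: mpre.
Qed.

HB.instance Definition _ := isMeasure.Build _ _ _ lebesgue_rVS
  lebesgue_rVS0 lebesgue_rVS_ge0 lebesgue_rVS_sigma_additive.

Let lebesgue_rVS_sigma_finite : sigma_finite setT lebesgue_rVS.
Proof.
have /sigma_finiteP[F [TF ndF Foo]] := sigma_finiteT (@lebesgue_measure R).
have /sigma_finiteP[G [TG ndG Goo]] := sigma_finiteT mu.
exists (fun k => @rV_uncons R n @^-1` (F k `*` G k)).
  rewrite -preimage_bigcup (_ : \bigcup_i _ = setT) ?preimage_setT//.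
  rewrite -subTset => -[x y] _.
  have [k _ Fkx] : (\bigcup_i F i) x by rewrite -TF.
  have [l _ Gly] : (\bigcup_i G i) y by rewrite -TG.
  exists (maxn k l) => //; split => /=.
  - by move: x Fkx; exact/subsetPset/ndF/leq_maxl.
  - by move: y Gly; exact/subsetPset/ndG/leq_maxr.
move=> k; have [mF Fk] := Foo k; have [mG Gk] := Goo k; split.
  rewrite -[X in measurable X]setTI; apply: measurable_rV_uncons => //.
  exact: measurableX.
rewrite /lebesgue_rVS /pushforward -comp_preimage.
rewrite (_ : _ \o _ = id); last by apply/funext => p; exact: rV_consK.
by rewrite product_measure1E// lte_mul_pinfty// ge0_fin_numE.
Qed.

HB.instance Definition _ := @Measure_isSigmaFinite.Build _ _ _ lebesgue_rVS
  lebesgue_rVS_sigma_finite.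

End lebesgue_rVS.

Fixpoint lebesgue_rV (R : realType) (n : nat) :
    {sigma_finite_measure set 'rV[R]_n -> \bar R} :=
  match n with
  | 0 => \d_(0 : 'rV[R]_0)
  | m.+1 => lebesgue_rVS (lebesgue_rV R m)
  end.

Section euclidean_space.
Context {R : realType} {n : nat}.
Implicit Types (x y : 'rV[R]_n) (A : set 'rV[R]_n).

(* The library norm on 'rV[R]_n is the maximum norm; it induces the same
   topology as the Euclidean norm. *)
Definition enorm x : R := Num.sqrt (\sum_i x 0 i ^+ 2).

Definition unit_ball : set 'rV[R]_n := [set x | enorm x <= 1].

Definition vol A : \bar R := lebesgue_rV R n A.

Definition dilate (r : R) A : set 'rV[R]_n := [set r *: x | x in A].

(* Jordan measurability: bounded, with equal inner and outer Jordan content,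
   both computed with finite unions of axis-parallel boxes. *)
Definition box (p : 'rV[R]_n * 'rV[R]_n) : set 'rV[R]_n :=
  [set x | forall i, p.1 0 i <= x 0 i <= p.2 0 i].

Definition elementary A :=
  exists s : seq ('rV[R]_n * 'rV[R]_n), A = \bigcup_(p in [set` s]) box p.

Definition inner_content A : \bar R :=
  ereal_sup [set vol E | E in [set E | elementary E /\ E `<=` A]].

Definition outer_content A : \bar R :=
  ereal_inf [set vol E | E in [set E | elementary E /\ A `<=` E]].

Definition Jordan_measurable A :=
  (exists p, A `<=` box p) /\ inner_content A = outer_content A.

End euclidean_space.

Section independent_sets.
Context {R : realType} {n : nat}.
Local Notation E := 'rV[R]_n.

Definition edge (x y : E) : bool := 0 < enorm (x - y) < 2.

(* S \in I_k(V) *)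
Definition indep (V : set E) (k : nat) (S : {fset E}) : Prop :=
  [/\ [set` S] `<=` V, (#|` S| <= k)%N & {in S &, forall x y, ~~ edge x y}].

(* The topological space I_k(V).  As functions on I_k(V) are represented by
   total functions on {fset E}, the topology is put on (a copy of) {fset E}:
   U is open iff its preimage under (v_1, ..., v_k) |-> {v_1, ..., v_k} is
   relatively open in the set of the tuples of V^k whose image is independent.
   On the nonempty elements of I_k(V) this is the quotient topology.  The empty
   set is isolated (it is not an image when 0 < k, and it is the only element of
   I_0(V)), and so are the finite sets that are not in I_k(V). *)
Definition indep_space (V : set E) (k : nat) : Type := {fset E}.

Section indep_topology.
Variables (V : set E) (k : nat).

Definition tuple_fset (v : {ptws 'I_k -> E}) : {fset E} :=
  [fset v i | i : 'I_k]%fset.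

Definition indep_tuples : set {ptws 'I_k -> E} :=
  [set v | indep V k (tuple_fset v)].

Definition indep_open (U : set (indep_space V k)) : Prop :=
  open ([set v | U (tuple_fset v)] : set (subspace indep_tuples)).

Let indep_openT : indep_open setT.
Proof. exact: openT. Qed.

Let indep_openI : setI_closed indep_open.
Proof. by move=> A B oA oB; exact: (openI oA oB). Qed.

Let indep_open_bigU (I : Type) (f : I -> set (indep_space V k)) :
  (forall i, indep_open (f i)) -> indep_open (\bigcup_i f i).
Proof. by move=> fo; apply: bigcup_open => i _; exact: fo. Qed.

HB.instance Definition _ := Choice.copy (indep_space V k) {fset E}.
HB.instance Definition _ := isOpenTopological.Build (indep_space V k)
  indep_openT indep_openI indep_open_bigU.

End indep_topology.

Definition Bop (k : nat) (T : E -> E -> {fset E} -> R) (S : {fset E}) : R :=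
  \sum_(J <- fpowerset S | (#|` J| <= k - 2)%N)
    \sum_(x <- S) \sum_(y <- S | ([fset x; y] `|` J)%fset == S) T x y J.

(* K \in C(V^2 x I_(k-2)(V)), for V^2 x I_(k-2)(V) as a subspace of E^2 x
   {fset E}; the values of K outside of it are irrelevant. *)
Definition continuous_kernel (V : set E) (k : nat)
    (K : E -> E -> {fset E} -> R) : Prop :=
  {within [set p : E * E * indep_space V (k - 2) |
            [/\ V p.1.1, V p.1.2 & indep V (k - 2) p.2]],
    continuous (fun p : E * E * indep_space V (k - 2) => K p.1.1 p.1.2 p.2)}.

Definition positive_definite (V : set E) (K : E -> E -> R) : Prop :=
  (forall x y, V x -> V y -> K x y = K y x) /\
  (forall (F : {fset E}) (c : E -> R), [set` F] `<=` V ->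
    0 <= \sum_(x <- F) \sum_(y <- F) c x * c y * K x y).

Definition Delta_feasible (k : nat) (V : set E)
    (K : E -> E -> {fset E} -> R) (M : R) : Prop :=
  [/\ continuous_kernel V k K,
      forall J, indep V (k - 2) J -> positive_definite V (fun x y => K x y J),
      forall x, V x -> Bop k K [fset x]%fset <= M - 1,
      forall x y, x != y -> indep V 2 [fset x; y]%fset ->
        Bop k K [fset x; y]%fset <= -2
    & forall S, indep V k S -> (3 <= #|` S|)%N -> Bop k K S <= 0].

(* Delta_k(V) *)
Definition Delta (k : nat) (V : set E) : \bar R :=
  ereal_inf [set M%:E | M in [set M | exists K, Delta_feasible k V K M]].

Definition translate (z : E) (J : {fset E}) : {fset E} :=
  [fset (j + z)%R | j in J]%fset.

Definition packing_feasible (k : nat) (f : E -> E -> {fset E} -> R) : Prop :=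
  [/\ continuous_kernel setT k f,
      forall x y z J, indep setT (k - 2) J ->
        f x y J = f (x + z) (y + z) (translate z J),
      forall J, indep setT (k - 2) J ->
        positive_definite setT (fun x y => f x y J),
      forall S, indep setT k S -> (2 <= #|` S|)%N -> Bop k f S <= 0
    & (lebesgue_rV R n).-integrable setT (fun x => (f x 0 fset0)%:E) /\
      (\int[lebesgue_rV R n]_x (f x 0 fset0)%:E = 1)%E].

End independent_sets.

(* Delta_(k, R^n) *)
Definition Delta_packing (R : realType) (n k : nat) : \bar R :=
  ereal_inf [set (vol (@unit_ball R n) * (Bop k f [fset 0]%fset)%:E)%E |
    f in [set f : 'rV[R]_n -> 'rV[R]_n -> {fset 'rV[R]_n} -> R |
           packing_feasible k f]].

(* Main.v *)
Require Import Defs.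
From HB Require Import structures.
From mathcomp Require Import all_boot all_order all_algebra finmap.
From mathcomp Require Import all_classical all_reals all_analysis measurable_realfun.
From mathcomp Require Import ring lra.
Import Order.TTheory GRing.Theory Num.Theory.
Import numFieldNormedType.Exports numFieldTopology.Exports.
Set Implicit Arguments.
Unset Strict Implicit.
Unset Printing Implicit Defensive.
Local Open Scope classical_set_scope.
Local Open Scope ring_scope.

(* Upper bound: given K, M feasible for Delta_k(C), add 1 to K at J = {} and
   average over all translates of C.  The resulting invariant function f
   satisfies B_k f({0}) <= M vol(C), while integrating f(x, 0, {}) amounts to
   integrating K + 1 over C x C, which gives at least vol(C)^2 by positive
   definiteness of K.  The nullity of the boundary of C makes f continuous.

   Lower bound: given a feasible f, put phi(x) = f(x, 0, {}) and A = rC.  If the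
   constant function 1 were (up to a factor close to 1) bounded by vol(A) phi in
   the positive definite order, then vol(A) f - [J = {}] would be feasible on A.
   With a positive definite bump g supported in a small ball, write 1 = h + u on
   A, where h = chi * phi for a mollified indicator function chi of a
   neighborhood of A, and where u = p * g with p uniformly small (u accounts for
   the mass of phi far from the origin).  Cauchy-Schwarz for the forms defined by
   phi and g shows that 1 <= l1 phi + l2 g in the positive definite order, with
   l1 / vol(A) -> 1 and l2 / vol(A) -> 0 as r -> oo.  The kernel l1 f + [J = {}]
   (l2 g - 1) is then feasible, as g vanishes at all pairs of distinct
   non-adjacent points. *)

(** * Measurability and volume in R^n *)

(** Upper bound: extending K by zero outside of C preserves the sign conditions, since each term of
    [Bop] at S involves all points of S, and it preserves positive definiteness, but it destroys
    continuity along the boundary of C. This is what averaging has to repair. Positive definiteness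
    speaks of finite sums only. It passes to integrals by sampling random points and taking
    expectations, which needs integrability alone: no Riemann sums, no continuity of the kernel or
    of the weight. Lower bound: the function 1 - h is uniformly small on A, but this does not
    control it in the positive definite order. It has to be a convolution with a positive definite
    kernel. This is why chi is mollified by g itself: with chi = g * 1_B for a neighborhood B of A,
    associativity of convolution gives 1 - h = g * (1 - 1_B * phi) on A, and the uniformly small
    factor then enters through its energy only. *)

Section open_sets.
Context {R : realType} {n : nat}.
Local Notation E := 'rV[R]_n.

Lemma rV_normP (x : E) (e : R) : 0 < e ->
  (`|x| < e) <-> (forall i, `|x 0 i| < e).
Proof.
move=> e0; have := @mx_norm_ball R 1 n => /(congr1 (fun f => f 0 e x)) H.
have -> : (`|x| < e : Prop) = (ball (0 : E) e x).
  by rewrite H /ball_ /= sub0r normrN.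
split; first by move=> [_ h] i; have := h 0 i; rewrite /ball /= mxE sub0r normrN.
by move=> h; split=> // i j; rewrite ord1 /ball /= mxE sub0r normrN.
Qed.

Lemma coord_le_norm (x : E) i : `|x 0 i| <= `|x|.
Proof.
rewrite leNgt; apply/negP => h.
have h0 : 0 < `|x 0 i| by apply: le_lt_trans h.
by move/(rV_normP _ h0): h => /(_ i); rewrite ltxx.
Qed.

Lemma measurable_rV_set (A : 'I_n -> set (measurableTypeR R)) :
  (forall i, measurable (A i)) ->
  measurable [set x : E | forall i, A i (x 0 i)].
Proof.
move=> mA; rewrite (_ : mkset _ = \bigcap_(i in [set: 'I_n])
   (@rV_coord R n i @^-1` A i)).
  apply: fin_bigcap_measurable => // i _.
  rewrite -[X in measurable X]setTI.
  exact: (@measurable_rV_coord R n i measurableT).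
by apply/seteqP; split => [x h i _|x h i]; [exact: h|exact: (h i)].
Qed.

Lemma measurable_rV_ball (x : E) (e : R) : 0 < e ->
  measurable [set y : E | `|y - x| < e].
Proof.
move=> e0; rewrite (_ : mkset _ =
    [set y : E | forall i, ball (x 0 i) e (y 0 i)]).
  apply: (@measurable_rV_set (fun i => ball (x 0 i) e)) => i.
  by apply: open_measurable; apply: ball_open.
apply/seteqP; split => y /=.
  by move/(rV_normP _ e0) => h i; rewrite /ball /= distrC; have := h i; rewrite !mxE.
by move=> h; apply/(rV_normP _ e0) => i; rewrite !mxE distrC; exact: h.
Qed.

Lemma rV_rat_dense (x : E) (e : R) : 0 < e ->
  exists q : 'rV[rat]_n, `|x - map_mx ratr q| < e.
Proof.
move=> e0.
have H i : exists q : rat, `|x 0 i - ratr q| < e.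
  have /rat_in_itvoo[q] : x 0 i - e < x 0 i + e by rewrite ltrBlDr -addrA ltrDl addr_gt0.
  by rewrite in_itv/= => /andP[h1 h2]; exists q; rewrite distrC ltr_distl h1.
exists (\row_i projT1 (cid (H i))).
by apply/(rV_normP _ e0) => i; rewrite !mxE; case: (cid (H i)).
Qed.

Lemma open_pairP (U : set (E * E)) : open U -> forall p, U p ->
  exists2 e : R, 0 < e & forall q, `|q.1 - p.1| < e -> `|q.2 - p.2| < e -> U q.
Proof.
move=> oU p Up; have := open_nbhs_nbhs (conj oU Up).
case/nbhs_ballP => e e0 h; exists e => // q h1 h2; apply: h.
by split; rewrite -ball_normE /= distrC.
Qed.

(** The sigma-algebra of [E * E] is the product one, so second countability is essential: U is the
    union of the countably many products of rational balls that it contains. Openness is phrased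
    with balls to suit sets that are given as unions of balls. *)
Lemma measurable_pair_of_balls (U : set (E * E)) :
  (forall p, U p -> exists2 e : R, 0 < e &
     forall q, `|q.1 - p.1| < e -> `|q.2 - p.2| < e -> U q) ->
  measurable U.
Proof.
move=> oU.
pose B (t : 'rV[rat]_n * 'rV[rat]_n * nat) : set (E * E) :=
  [set y : E | `|y - map_mx ratr t.1.1| < t.2.+1%:R^-1] `*`
  [set y : E | `|y - map_mx ratr t.1.2| < t.2.+1%:R^-1].
have mB t : measurable (B t).
  by apply: measurableX; apply: measurable_rV_ball; rewrite invr_gt0.
have -> : U = \bigcup_(t in [set t | B t `<=` U]) B t.
  apply/seteqP; split => [p Up|p [t tU]]; last exact: tU.
  have [e e0 h] := oU p Up.
  have /ltr_add_invr[m] : 0 < e / 2 by rewrite divr_gt0.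
  rewrite add0r => me.
  have m0 : 0 < m.+1%:R^-1 :> R by rewrite invr_gt0.
  have [q1 hq1] := rV_rat_dense p.1 m0.
  have [q2 hq2] := rV_rat_dense p.2 m0.
  exists (q1, q2, m); last by split.
  move=> /= y [/= h1 h2]; apply: h.
  - rewrite (_ : _ - _ = (y.1 - map_mx ratr q1) - (p.1 - map_mx ratr q1)).
      by rewrite (le_lt_trans (ler_normB _ _))// (splitr e) ltrD// (lt_trans _ me).
    by rewrite opprB addrA subrK.
  - rewrite (_ : _ - _ = (y.2 - map_mx ratr q2) - (p.2 - map_mx ratr q2)).
      by rewrite (le_lt_trans (ler_normB _ _))// (splitr e) ltrD// (lt_trans _ me).
    by rewrite opprB addrA subrK.
rewrite bigcup_mkcond; apply: countable_bigcupT_measurable => [|t].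
  exact: countableP.
by case: ifP.
Qed.

Lemma open_pair_measurable (U : set (E * E)) : open U -> measurable U.
Proof. by move=> /open_pairP; exact: measurable_pair_of_balls. Qed.

Lemma measurable_diag : measurable_fun [set: E] (fun x : E => (x, x)).
Proof. exact: measurable_fun_pair. Qed.

Lemma open_rV_measurable (U : set E) : open U -> measurable U.
Proof.
move=> oU; rewrite (_ : U = (fun x : E => (x, x)) @^-1` (fst @^-1` U)) //.
rewrite -[X in measurable X]setTI; apply: measurable_diag => //.
apply: open_pair_measurable; apply: open_comp => // x _; exact: cvg_fst.
Qed.

Lemma closed_rV_measurable (A : set E) : closed A -> measurable A.
Proof.
by move=> /closed_openC /open_rV_measurable /measurableC; rewrite setCK.
Qed.

Lemma compact_rV_measurable (A : set E) : compact A -> measurable A.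
Proof.
move=> /compact_closed cA; apply: closed_rV_measurable; apply: cA.
exact: norm_hausdorff.
Qed.

Definition continuous_on_pairs (A : set (E * E)) (G : E * E -> R) :=
  forall p, A p -> forall e : R, 0 < e -> exists2 d : R, 0 < d &
    forall q, A q -> `|q.1 - p.1| < d -> `|q.2 - p.2| < d -> `|G q - G p| < e.

Lemma measurable_fun_continuous_on (A : set (E * E)) (G : E * E -> R) :
  measurable A -> continuous_on_pairs A G -> measurable_fun setT (G \_ A).
Proof.
move=> mA cG; apply/(measurable_restrictT _ mA).
apply: (measurability _ (RGenOInfty.measurableE R)) => //.
move=> _ [_ [a ->] <-].
(* U is the union of the product balls, centered in A, on whose trace on A the function exceeds a;
   it is measurable even if A is not open. *)
pose U := [set p : E * E | exists r d, [/\ A r, 0 < d, `|p.1 - r.1| < d, `|p.2 - r.2| < d &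
   forall q, A q -> `|q.1 - r.1| < d -> `|q.2 - r.2| < d -> a < G q]].
have -> : A `&` G @^-1` `]a, +oo[ = A `&` U.
  apply/seteqP; split => p /=; rewrite in_itv/= andbT => -[Ap].
    move=> aG; split=> //.
    have [|d d0 h] := cG p Ap (G p - a); first by rewrite subr_gt0.
    exists p, d; split => //; rewrite ?subrr ?normr0// => q Aq h1 h2.
    by have := h q Aq h1 h2; rewrite ltr_distl => /andP[]; rewrite opprB addrC subrK.
  by move=> [r [d [Ar d0 h1 h2 h]]]; split=> //; exact: h.
apply: measurableI => //; apply: measurable_pair_of_balls => p [r [d [Ar d0 h1 h2 h]]].
exists (Num.min (d - `|p.1 - r.1|) (d - `|p.2 - r.2|)).
  by rewrite lt_min !subr_gt0 h1 h2.
move=> q; rewrite !lt_min => /andP[q1 _] /andP[_ q2]; exists r, d; split => //.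
- rewrite -(subrKA p.1) (le_lt_trans (ler_normD _ _))//.
  by move: q1; rewrite ltrBrDr.
- rewrite -(subrKA p.2) (le_lt_trans (ler_normD _ _))//.
  by move: q2; rewrite ltrBrDr.
Qed.

Lemma measurable_rV_affine (r : R) (z : E) :
  measurable_fun [set: E] (fun x : E => r *: x + z).
Proof.
apply: measurable_fun_rVP => i.
rewrite (_ : _ \o _ = fun x : E => r * (rV_coord i x : R) + z 0 i); last first.
  by apply/funext => x; rewrite /= /rV_coord !mxE.
apply: measurable_funD => //; apply: measurable_funM => //.
exact: (@measurable_rV_coord R n i).
Qed.

Lemma measurable_rV_sub : measurable_fun [set: E * E] (fun p : E * E => p.1 - p.2).
Proof.
apply: measurable_fun_rVP => i.
rewrite (_ : _ \o _ = fun p : E * E => (rV_coord i p.1 : R) - rV_coord i p.2); last first.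
  by apply/funext => x; rewrite /= /rV_coord !mxE.
apply: measurable_funB.
  exact: (measurableT_comp (@measurable_rV_coord R n i) measurable_fst).
exact: (measurableT_comp (@measurable_rV_coord R n i) measurable_snd).
Qed.

Lemma measurable_rV_add : measurable_fun [set: E * E] (fun p : E * E => p.1 + p.2).
Proof.
apply: measurable_fun_rVP => i.
rewrite (_ : _ \o _ = fun p : E * E => (rV_coord i p.1 : R) + rV_coord i p.2); last first.
  by apply/funext => x; rewrite /= /rV_coord !mxE.
apply: measurable_funD.
  exact: (measurableT_comp (@measurable_rV_coord R n i) measurable_fst).
exact: (measurableT_comp (@measurable_rV_coord R n i) measurable_snd).
Qed.

End open_sets.

(** * Affine changes of variables *)

Section lebesgue_affine.
Context {R : realType}.
Local Open Scope ereal_scope.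
Local Notation mu := (@lebesgue_measure R).

Lemma measurable_affine (r z : R) :
  measurable_fun [set: measurableTypeR R] (fun x => (r * x + z)%R : measurableTypeR R).
Proof. by apply: measurable_funD => //; exact: measurable_funM. Qed.

(** Up to the factor r, the pushforward agrees with the Lebesgue measure on half-open intervals, and
    these determine the measure. *)
Lemma lebesgue_measure_affine (r z : R) (A : set (measurableTypeR R)) :
  (0 < r)%R -> measurable A ->
  mu ((fun x => r * x + z)%R @^-1` A) = r^-1%:E * mu A.
Proof.
move=> r0 mA; have mT := measurable_affine r z.
have rge0 : (0 <= r)%R by exact: ltW.
pose rnn := NngNum rge0.
pose nu := measure_function_mscale__canonical__measure_function_Measure rnn
  (measure_function_pushforward__canonical__measure_function_Measure mu mT).
suff H : mu A = nu A.
  rewrite H /nu /mscale/= muleA -EFinM mulVf ?gt_eqF// mul1e.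
  by [].
apply: (@lebesgue_measure_unique R nu) mA => X [[a b]] _ <-.
change (mu `]a, b]%classic =
  r%:E * mu ((fun x : measurableTypeR R => (r * x + z)%R) @^-1` `]a, b]%classic)).
have -> : (fun x : measurableTypeR R => r * x + z)%R @^-1` `]a, b]%classic =
    `]((a - z) / r)%R, ((b - z) / r)%R]%classic.
  apply/seteqP; split => x /=; rewrite !in_itv/= => /andP[h1 h2].
    by rewrite ltr_pdivrMr// ler_pdivlMr// ltrBlDr lerBrDr mulrC h1 h2.
  by move: h1 h2; rewrite ltr_pdivrMr// ler_pdivlMr// ltrBlDr lerBrDr mulrC => -> ->.
rewrite !lebesgue_measure_itv/= !lte_fin.
rewrite ltr_pM2r ?invr_gt0// ltrD2r; case: ifPn => _; last by rewrite mule0.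
rewrite -EFinM; congr EFin; field.
by rewrite gt_eqF.
Qed.
End lebesgue_affine.

Section vol_affine.
Context {R : realType}.
Local Open Scope ereal_scope.

Lemma lebesgue_rVSE n (A : set 'rV[R]_n.+1) :
  lebesgue_rV R n.+1 A =
  \int[@lebesgue_measure R]_x lebesgue_rV R n [set v | A (rV_cons (x, v))].
Proof.
rewrite /= /lebesgue_rVS /pushforward /product_measure1.
apply: eq_integral => x _ /=; congr (lebesgue_rV R n _).
by apply/seteqP; split => v /=; rewrite /xsection /= inE.
Qed.

Lemma measurable_rV_section n (A : set 'rV[R]_n.+1) x : measurable A ->
  measurable [set v : 'rV[R]_n | A (rV_cons (x, v))].
Proof.
move=> mA; rewrite (_ : mkset _ = xsection (@rV_cons R n @^-1` A) x).
  apply: measurable_xsection; rewrite -[X in measurable X]setTI.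
  exact: measurable_rV_cons.
by apply/seteqP; split => v /=; rewrite /xsection /= inE.
Qed.

Lemma measurable_vol_section n (A : set 'rV[R]_n.+1) : measurable A ->
  measurable_fun [set: measurableTypeR R]
    (fun x => lebesgue_rV R n [set v | A (rV_cons (x, v))]).
Proof.
move=> mA.
have := measurable_fun_xsection (lebesgue_rV R n)
  (_ : measurable (@rV_cons R n @^-1` A)).
rewrite (_ : _ \o _ = fun x => lebesgue_rV R n [set v | A (rV_cons (x, v))]).
  apply; rewrite -[X in measurable X]setTI; exact: measurable_rV_cons.
apply/funext => x /=; congr (lebesgue_rV R n _).
by apply/seteqP; split => v /=; rewrite /xsection /= inE.
Qed.

Lemma affine_rV_cons n (r : R) (z : 'rV[R]_n.+1) x v :
  (r *: rV_cons (x, v) + z = rV_cons (r * x + z 0 0, r *: v + (rV_uncons z).2))%R.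
Proof.
apply/rowP => i; case: (unliftP ord0 i) => [j ->|->].
  by rewrite mxE mxE !rV_consS !mxE.
by rewrite mxE mxE !rV_cons0.
Qed.

(** Induction over slices: the induction hypothesis acts on the slice at a given first coordinate,
    and the substitution in that coordinate supplies one more factor 1/r. *)
Lemma vol_affine n (r : R) (z : 'rV[R]_n) (A : set 'rV[R]_n) :
  (0 < r)%R -> measurable A ->
  vol ((fun x => r *: x + z)%R @^-1` A) = (r ^- n)%:E * vol A.
Proof.
move=> r0; rewrite /vol; elim: n z A => [|n IH] z A mA.
  rewrite /= expr0 invr1 mul1e; congr (dirac _ _).
  apply/seteqP; split => x /=; rewrite (_ : _ + _ = x)%R //; by apply/rowP => -[].
rewrite !lebesgue_rVSE.
pose phi x := lebesgue_rV R n [set v | A (rV_cons (x, v))].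
have mphi : measurable_fun [set: measurableTypeR R] phi by exact: measurable_vol_section.
transitivity (\int[@lebesgue_measure R]_x ((r ^- n)%:E * phi (r * x + z 0 0)%R)).
  apply: eq_integral => x _; rewrite /phi -(IH (rV_uncons z).2); last first.
    exact: measurable_rV_section.
  by congr (lebesgue_rV R n _); apply/seteqP; split => v /=; rewrite affine_rV_cons.
rewrite ge0_integralZl//; last 2 first.
  by apply: (measurableT_comp mphi); exact: measurable_affine.
  by rewrite lee_fin invr_ge0 exprn_ge0// ltW.
have rinv : (0 <= r^-1)%R by rewrite invr_ge0 ltW.
pose rnn := NngNum rinv.
pose T x : measurableTypeR R := (r * x + z 0 0)%R.
have mT : measurable_fun [set: measurableTypeR R] T by exact: measurable_affine.
have <- : \int[pushforward (@lebesgue_measure R) T]_x phi x =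
  \int[@lebesgue_measure R]_x phi (r * x + z 0 0)%R.
  by rewrite ge0_integral_pushforward.
transitivity ((r ^- n)%:E * \int[mscale rnn (@lebesgue_measure R)]_x phi x).
  congr (_ * _).
  apply: (@eq_measure_integral _ _ _ _
    (measure_function_mscale__canonical__measure_function_Measure rnn
       (@lebesgue_measure R))
    (measure_function_pushforward__canonical__measure_function_Measure
       (@lebesgue_measure R) mT)) => B mB _.
  by rewrite /mscale /= /pushforward; exact: lebesgue_measure_affine.
rewrite ge0_integral_mscale// muleA -EFinM; congr (_%:E * _).
by rewrite exprSr invfM.
Qed.

End vol_affine.

(** * Boxes, dilates and Jordan measurable sets *)

Section vol_facts.
Context {R : realType}.

Lemma vol_shift n (z : 'rV[R]_n) (A : set 'rV[R]_n) : measurable A ->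
  vol ((fun x => x + z) @^-1` A) = vol A.
Proof.
move=> mA; have := vol_affine z ltr01 mA; rewrite expr1n invr1 mul1e => <-.
by congr (vol _); apply/funext => x; rewrite /preimage /= scale1r.
Qed.

Lemma dilateE n (r : R) (A : set 'rV[R]_n) : 0 < r ->
  dilate r A = (fun x => r^-1 *: x + 0) @^-1` A.
Proof.
move=> r0; apply/seteqP; split => [_ [x Ax <-]|x] /=.
  by rewrite addr0 scalerA mulVf ?gt_eqF// scale1r.
by rewrite addr0 => Ax; exists (r^-1 *: x) => //; rewrite scalerA divff ?gt_eqF// scale1r.
Qed.

Lemma measurable_dilate n (r : R) (A : set 'rV[R]_n) : 0 < r ->
  measurable A -> measurable (dilate r A).
Proof.
move=> r0 mA; rewrite dilateE// -[X in measurable X]setTI.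
by apply: measurable_rV_affine.
Qed.

Lemma vol_dilate n (r : R) (A : set 'rV[R]_n) : 0 < r -> measurable A ->
  vol (dilate r A) = ((r ^+ n)%:E * vol A)%E.
Proof.
move=> r0 mA; rewrite dilateE// vol_affine ?invr_gt0//.
by rewrite exprVn invrK.
Qed.

Lemma box_rV_cons n (p : 'rV[R]_n.+1 * 'rV[R]_n.+1) x :
  [set v | box p (rV_cons (x, v))] =
  if p.1 0 0 <= x <= p.2 0 0
  then box ((rV_uncons p.1).2, (rV_uncons p.2).2) else set0.
Proof.
case: ifPn => [hx|/negP hx]; apply/seteqP; split => v //=.
- by move=> h i; have := h (lift ord0 i); rewrite rV_consS /= !mxE.
- move=> h i; case: (unliftP ord0 i) => [j ->|->].
    by have := h j; rewrite rV_consS /= !mxE.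
  by rewrite rV_cons0.
- by move=> /(_ ord0); rewrite rV_cons0.
Qed.

Lemma vol_box n (p : 'rV[R]_n * 'rV[R]_n) :
  vol (box p) = (\prod_i Num.max 0 (p.2 0 i - p.1 0 i))%:E.
Proof.
rewrite /vol; elim: n p => [|n IH] p.
  rewrite /= big_ord0 /= diracE mem_set//.
  by case.
rewrite lebesgue_rVSE.
pose q := ((rV_uncons p.1).2, (rV_uncons p.2).2).
pose I := `[p.1 0 0, p.2 0 0]%classic : set R.
transitivity (\int[@lebesgue_measure R]_x
  ((\prod_i Num.max 0 (q.2 0 i - q.1 0 i))%:E * (\1_I x)%:E))%E.
  apply: eq_integral => x _; rewrite box_rV_cons indicE.
  rewrite (_ : (x \in I) = (p.1 0 0 <= x <= p.2 0 0)); last first.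
    by apply/idP/idP; rewrite /I inE /= in_itv.
  by case: ifPn => _; rewrite ?mule1 ?mule0 ?measure0// -IH.
rewrite ge0_integralZl//; last 2 first.
- by apply/measurable_EFinP; apply: measurable_indic; exact: measurable_itv.
- by rewrite lee_fin prodr_ge0// => i _; rewrite le_max lexx.
rewrite integral_indic ?setIT//; last exact: measurable_itv.
rewrite [X in (_ * X)%E]lebesgue_measure_itv/= lte_fin.
rewrite big_ord_recl EFinM muleC; congr (_ * _)%E.
  case: ifPn => h; first by rewrite -EFinB max_r// subr_ge0 ltW.
  by rewrite max_l// subr_le0 leNgt.
by congr EFin; apply: eq_bigr => i _; rewrite /q /= !mxE.
Qed.

Lemma closed_box n (p : 'rV[R]_n * 'rV[R]_n) : closed (box p).
Proof.
rewrite (_ : box p = \bigcap_(i in [set: 'I_n])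
  ((fun x : 'rV[R]_n => x 0 i) @^-1` `[p.1 0 i, p.2 0 i]%classic)).
  apply: closed_bigI => i _; apply: preimage_closed.
    by move=> x _; exact: coord_continuous.
  exact: interval_closed.
apply/seteqP; split => x /=; first by move=> h i _; rewrite /= in_itv /=; exact: h.
by move=> h i; have := h i I; rewrite /= in_itv.
Qed.

Lemma measurable_box n (p : 'rV[R]_n * 'rV[R]_n) : measurable (box p).
Proof. by apply: closed_rV_measurable; exact: closed_box. Qed.

Lemma open_box_interior n (p : 'rV[R]_n * 'rV[R]_n) (x : 'rV[R]_n) :
  (forall i, p.1 0 i < x 0 i < p.2 0 i) -> (box p)° x.
Proof.
move=> h; pose e i := Num.min (x 0 i - p.1 0 i) (p.2 0 i - x 0 i).
have e0 i : 0 < e i by rewrite lt_min !subr_gt0 andbC; have /andP[-> ->] := h i.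
(* The default 1 of the minimum keeps m positive when n = 0. *)
pose m : R := \big[Num.min/1]_i e i.
have m0 : 0 < m.
  by rewrite /m; elim/big_ind : _ => // a b a0 b0; rewrite lt_min a0.
apply/nbhs_ballP; exists m => //= y; rewrite -ball_normE /= => hy i.
have : `|(x - y) 0 i| < e i.
  apply: (le_lt_trans (coord_le_norm _ _)); apply: (lt_le_trans hy).
  by rewrite /m (bigD1 i)//= ge_min lexx.
by rewrite !mxE lt_min !ltr_norml => /andP[/andP[h1 h2] /andP[h3 h4]]; apply/andP; split; lra.
Qed.

Local Notation mu n := (lebesgue_rV R n).

Lemma negligible_bigcup_seq n (T : choiceType) (F : T -> set 'rV[R]_n) (s : seq T) :
  (forall i, (mu n).-negligible (F i)) ->
  (mu n).-negligible (\bigcup_(i in [set` s]) F i).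
Proof.
move=> F0; elim: s => [|a s IH].
  rewrite (_ : \bigcup_(_ in _) _ = set0); first exact: negligible_set0.
  by rewrite -subset0 => x [].
rewrite (_ : \bigcup_(_ in _) _ = F a `|` \bigcup_(i in [set` s]) F i).
  exact: negligibleU.
apply/seteqP; split => x.
  move=> [i /=]; rewrite inE => /orP[/eqP ->|si] Fx; first by left.
  by right; exists i.
move=> [Fx|[i /= si Fx]]; first by exists a => //=; rewrite inE eqxx.
by exists i => //=; rewrite inE si orbT.
Qed.

Lemma box_boundary_negligible n (p : 'rV[R]_n * 'rV[R]_n) :
  (mu n).-negligible (box p `\` (box p)°).
Proof.
pose row_set (v : 'rV[R]_n) i a : 'rV[R]_n := \row_j (if j == i then a else v 0 j).
(* The two faces orthogonal to the i-th axis, written as degenerate boxes. *)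
pose F i := box (p.1, row_set p.2 i (p.1 0 i)) `|` box (row_set p.1 i (p.2 0 i), p.2).
have F0 i : (mu n).-negligible (F i).
  apply: negligibleU; apply/negligibleP; try exact: measurable_box.
    by rewrite [LHS]vol_box (bigD1 i)//= !mxE eqxx subrr maxxx mul0r.
  by rewrite [LHS]vol_box (bigD1 i)//= !mxE eqxx subrr maxxx mul0r.
apply: negligibleS (negligible_bigcup_seq (index_enum 'I_n) F0).
move=> x [bx nbx]; apply: contrapT => nF; apply: nbx.
apply: open_box_interior => i; have /andP[h1 h2] := bx i.
rewrite !lt_neqAle h1 h2 !andbT; apply/andP; split; apply/eqP => hE; apply: nF.
- exists i; first by rewrite /= mem_index_enum.
  left => j /=; rewrite mxE; case: eqP => [->|_]; last exact: bx.
  by rewrite hE lexx.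
- exists i; first by rewrite /= mem_index_enum.
  right => j /=; rewrite mxE; case: eqP => [->|_]; last exact: bx.
  by rewrite -hE lexx.
Qed.

Lemma vol_bounded_lty n (A : set 'rV[R]_n) (M : R) : measurable A ->
  (forall x, A x -> `|x| <= M) -> (vol A < +oo)%E.
Proof.
move=> mA AM; apply: (@le_lt_trans _ _ (vol (box (const_mx (- M), const_mx M) : set 'rV[R]_n))).
  rewrite le_measure ?inE//; first exact: measurable_box.
  move=> x /AM xM i; rewrite !mxE -ler_norml.
  exact: le_trans (coord_le_norm _ _) xM.
by rewrite vol_box ltry.
Qed.

Lemma measurable_boundary n (C : set 'rV[R]_n) : measurable C ->
  measurable (C `\` C°).
Proof.
by move=> mC; apply: measurableD => //; apply: open_rV_measurable; exact: open_interior.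
Qed.

(** The volume of C lies between the inner and the outer content, hence equals both, and some
    elementary A inside C misses less than e of it. The points of C outside of the interior of C lie
    in C minus A or on the boundary of A, which is null. *)
Lemma Jordan_boundary_null n (C : set 'rV[R]_n) : compact C ->
  Jordan_measurable C -> vol (C `\` C°) = 0%E.
Proof.
move=> cC [[p Cp] ioE].
have mC : measurable C by exact: compact_rV_measurable.
have mCi := measurable_boundary mC.
have mE (A : set 'rV[R]_n) : elementary A -> measurable A.
  move=> [s ->]; apply: fin_bigcup_measurable => // q _; exact: measurable_box.
have Cfin : (vol C < +oo)%E.
  apply: (@le_lt_trans _ _ (vol (box p))); last by rewrite vol_box ltry.
  by rewrite le_measure ?inE//; exact: measurable_box.
have iE : inner_content C = vol C.
  apply/eqP; rewrite eq_le; apply/andP; split.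
    apply: ge_ereal_sup => _ [A [eA AC] <-].
    by rewrite le_measure ?inE//; exact: mE.
  rewrite ioE; apply: le_ereal_inf_tmp => _ [A [eA AC] <-].
  by rewrite le_measure ?inE//; exact: mE.
apply/eqP; rewrite eq_le measure_ge0 andbT; apply/lee_addgt0Pr => e e0; rewrite add0e.
have Cfn : vol C \is a fin_num by rewrite ge0_fin_numE.
have ifn : inner_content C \is a fin_num by rewrite iE.
have [_ [A [eA AC] <-]] := ub_ereal_sup_adherent e0 ifn.
rewrite -/(inner_content C) iE => Ae.
have mA := mE _ eA.
have mAi := measurable_boundary mA.
have Ai : vol (A `\` A°) = 0%E.
  apply/(negligibleP _ mAi); case: eA => s AE.
  apply: negligibleS (negligible_bigcup_seq s (@box_boundary_negligible n)).
  move=> x [Ax nAx]; move: (Ax); rewrite AE => -[q /= sq qx]; exists q => //; split => //.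
  move=> qi; apply: nAx; apply: interiorS qi => y qy; rewrite AE; by exists q.
have Afin : (vol A < +oo)%E by apply: le_lt_trans Cfin; rewrite le_measure ?inE.
apply: (@le_trans _ _ (vol ((C `\` A) `|` (A `\` A°)))).
  rewrite le_measure ?inE//; first by apply: measurableU => //; exact: measurableD.
  move=> x [Cx nCx]; have [Ax|nAx] := pselect (A x); last by left.
  by right; split => // /(interiorS AC).
rewrite /vol measureU0//; last exact: measurableD.
rewrite measureD// (setIidr AC) leeBlDr ?ge0_fin_numE//.
by move: Ae; rewrite lteBlDr// addeC => /ltW.
Qed.

End vol_facts.

(** * Integration *)

Section bounded_integrable.
Context d (T : measurableType d) {R : realType}.
Variable nu : {measure set T -> \bar R}.

Lemma integrable_bounded (A : set T) (f : T -> R) (M : R) : measurable A ->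
  (nu A < +oo)%E -> measurable_fun setT f -> (forall x, `|f x| <= M) ->
  (forall x, ~ A x -> f x = 0) -> nu.-integrable setT (EFin \o f).
Proof.
move=> mA Afin mf fM f0.
apply/integrableP; split; first exact/measurable_EFinP.
(* The sign of M is read off at a point of T, so an empty T is treated apart. *)
have [[x0 _]|T0] := pselect (exists x : T, True); last first.
  rewrite (_ : setT = set0) ?integral_set0//.
  by rewrite -subset0 => x _; apply: T0; exists x.
have M0 : 0 <= M by exact: le_trans (normr_ge0 _) (fM x0).
have m1 : measurable_fun [set: T] (fun x => (\1_A x)%:E : \bar R).
  by apply/measurable_EFinP; exact: measurable_indic.
apply: (@le_lt_trans _ _ (\int[nu]_x (M%:E * (\1_A x)%:E))%E).
  apply: ge0_le_integral => //.
  - by apply: measurableT_comp => //; exact/measurable_EFinP.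
  - exact: measurable_funeM.
  move=> x _; rewrite /= indicE; case: (boolP (x \in A)) => xA.
    by rewrite mule1 lee_fin.
  by rewrite f0 ?normr0 ?mule0//; move: xA; rewrite notin_setE.
rewrite ge0_integralZl// integral_indic// setIT.
by rewrite lte_mul_pinfty.
Qed.

Lemma integrable_add (f g : T -> R) : nu.-integrable setT (EFin \o f) ->
  nu.-integrable setT (EFin \o g) -> nu.-integrable setT (EFin \o (fun x => f x + g x)).
Proof. by move=> fi gi; have := integrableD measurableT fi gi. Qed.

Lemma integrable_sub (f g : T -> R) : nu.-integrable setT (EFin \o f) ->
  nu.-integrable setT (EFin \o g) -> nu.-integrable setT (EFin \o (fun x => f x - g x)).
Proof. by move=> fi gi; have := integrableB measurableT fi gi. Qed.

Lemma integrable_scale (c : R) (f : T -> R) : nu.-integrable setT (EFin \o f) ->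
  nu.-integrable setT (EFin \o (fun x => c * f x)).
Proof. by move=> fi; have := integrableZl measurableT c fi. Qed.

Lemma integrable_bigsum (I : Type) (s : seq I) (P : pred I) (f : I -> T -> R) :
  (forall i, P i -> nu.-integrable setT (EFin \o f i)) ->
  nu.-integrable setT (EFin \o (fun x => \sum_(i <- s | P i) f i x)).
Proof.
move=> fi; elim: s => [|a s IH].
  rewrite (_ : _ \o _ = cst 0%E); first exact: integrable0.
  by apply/funext => x /=; rewrite big_nil.
case: (boolP (P a)) => Pa; last first.
  by under [X in EFin \o X]eq_fun do rewrite big_cons (negbTE Pa).
under [X in EFin \o X]eq_fun do rewrite big_cons Pa.
by apply: integrable_add IH; exact: fi.
Qed.

Lemma Rintegral_bigsum (I : Type) (s : seq I) (P : pred I) (f : I -> T -> R) :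
  (forall i, P i -> nu.-integrable setT (EFin \o f i)) ->
  \int[nu]_x (\sum_(i <- s | P i) f i x) = \sum_(i <- s | P i) \int[nu]_x f i x.
Proof.
move=> fi; elim: s => [|a s IH].
  rewrite big_nil; under eq_Rintegral do rewrite big_nil.
  by rewrite Rintegral_cst// mul0r.
rewrite big_cons; case: ifPn => Pa; last first.
  by rewrite -IH; apply: eq_Rintegral => x _; rewrite big_cons (negbTE Pa).
rewrite -IH -RintegralD//; [|exact: fi|exact: integrable_bigsum].
by apply: eq_Rintegral => x _; rewrite big_cons Pa.
Qed.

Lemma Rintegral_indic (A : set T) : measurable A ->
  \int[nu]_x (\1_A x) = fine (nu A).
Proof. by move=> mA; rewrite /Rintegral integral_indic// setIT. Qed.

End bounded_integrable.

(** * Translation invariance, iterated integrals and convergence *)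

Section integral_facts.
Context {R : realType} {n : nat}.
Local Notation E := 'rV[R]_n.
Local Notation mu := (lebesgue_rV R n).

Lemma measurable_shift (z : E) : measurable_fun [set: E] (fun x : E => x + z).
Proof.
rewrite (_ : (fun _ => _) = (fun x : E => 1 *: x + z)).
  exact: measurable_rV_affine.
by apply/funext => x; rewrite scale1r.
Qed.

Lemma ge0_integral_shift (z : E) (f : E -> \bar R) : measurable_fun setT f ->
  (forall x, 0 <= f x)%E -> (\int[mu]_x f (x + z)%R = \int[mu]_x f x)%E.
Proof.
move=> mf f0; have mT := measurable_shift z.
transitivity (\int[pushforward mu (fun x : E => (x + z)%R)]_x f x)%E.
  by rewrite ge0_integral_pushforward.
apply: (@eq_measure_integral _ _ _ _ mu
    (measure_function_pushforward__canonical__measure_function_Measure mu mT)) => B mB _.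
exact: vol_shift.
Qed.

Lemma integrable_shift (z : E) (f : E -> R) : mu.-integrable setT (EFin \o f) ->
  mu.-integrable setT (EFin \o (fun x => f (x + z))).
Proof.
move=> /integrableP[mf fi]; apply/integrableP; split.
  exact: (measurableT_comp mf (measurable_shift z)).
rewrite (@ge0_integral_shift z (fun x => `|(f x)%:E|%E))//.
exact: measurableT_comp.
Qed.

Lemma Rintegral_shift (z : E) (f : E -> R) : mu.-integrable setT (EFin \o f) ->
  \int[mu]_x f (x + z) = \int[mu]_x f x.
Proof.
move=> fi; rewrite /Rintegral; congr fine.
have mT := measurable_shift z.
have := @integral_pushforward _ _ _ _ _ _ mT mu setT (EFin \o f)
   (measurable_int _ fi) (integrable_shift z fi) measurableT.
rewrite preimage_setT => /esym ->.
apply: (@eq_measure_integral _ _ _ _ mu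
    (measure_function_pushforward__canonical__measure_function_Measure mu mT)) => B mB _.
exact: vol_shift.
Qed.

Let Fubini_bounded1 (A B : set E) (F : E * E -> R) (M : R) :
  measurable A -> measurable B -> (vol A < +oo)%E -> (vol B < +oo)%E ->
  measurable_fun setT F -> (forall p, `|F p| <= M) ->
  (forall p, ~ (A p.1 /\ B p.2) -> F p = 0) ->
  [/\ mu.-integrable setT (EFin \o (fun x => \int[mu]_y F (x, y))),
      \int[mu]_x (\int[mu]_y F (x, y)) = \int[mu]_y (\int[mu]_x F (x, y)) & True].
Proof.
move=> mA mB Afin Bfin mF FM F0.
have Fi : (mu \x mu)%E.-integrable setT (EFin \o F).
  apply: (@integrable_bounded _ _ _ _ (A `*` B) _ M) => //; first exact: measurableX.
  by rewrite [ltLHS]product_measure1E// lte_mul_pinfty// ge0_fin_numE.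
have F1 x : mu.-integrable setT (EFin \o (fun y => F (x, y))).
  apply: (@integrable_bounded _ _ _ _ B _ M) => //; last first.
    by move=> y nB; apply: F0 => -[].
  exact: (measurableT_comp mF (pair1_measurable x)).
have F2 y : mu.-integrable setT (EFin \o (fun x => F (x, y))).
  apply: (@integrable_bounded _ _ _ _ A _ M) => //; last first.
    by move=> x nA; apply: F0 => -[].
  exact: (measurableT_comp mF (pair2_measurable y)).
have E1 : EFin \o (fun x => \int[mu]_y F (x, y)) = fubini_F mu (EFin \o F).
  by apply/funext => x /=; rewrite /Rintegral fineK//; exact: integrable_fin_num (F1 x).
have E2 : EFin \o (fun y => \int[mu]_x F (x, y)) = fubini_G mu (EFin \o F).
  by apply/funext => x /=; rewrite /Rintegral fineK//; exact: integrable_fin_num (F2 x).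
split; [by rewrite E1; exact: integrable_fubini_F| |exact: I].
rewrite [LHS]/Rintegral [RHS]/Rintegral; congr fine.
rewrite -/(EFin \o _).
transitivity (\int[mu]_x fubini_F mu (EFin \o F) x)%E.
  by apply: eq_integral => x _; rewrite -E1.
transitivity (\int[mu]_y fubini_G mu (EFin \o F) y)%E.
  exact: Fubini.
by apply: eq_integral => x _; rewrite -E2.
Qed.

Lemma Fubini_bounded (A B : set E) (F : E * E -> R) (M : R) :
  measurable A -> measurable B -> (vol A < +oo)%E -> (vol B < +oo)%E ->
  measurable_fun setT F -> (forall p, `|F p| <= M) ->
  (forall p, ~ (A p.1 /\ B p.2) -> F p = 0) ->
  [/\ mu.-integrable setT (EFin \o (fun x => \int[mu]_y F (x, y))),
      mu.-integrable setT (EFin \o (fun y => \int[mu]_x F (x, y))) &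
      \int[mu]_x (\int[mu]_y F (x, y)) = \int[mu]_y (\int[mu]_x F (x, y))].
Proof.
move=> mA mB Afin Bfin mF FM F0.
have [h1 h2 _] := Fubini_bounded1 mA mB Afin Bfin mF FM F0.
have [|//|p np|h3 _ _] := @Fubini_bounded1 B A (fun p => F (p.2, p.1)) M mB mA Bfin Afin.
- exact: (measurableT_comp mF (measurable_fun_pair measurable_snd measurable_fst)).
- by apply: F0 => /= -[Ap Bp]; apply: np.
by split.
Qed.

(** Dominated convergence with majorant M on A. The null set N will consist of the translations that
    move a given point onto the boundary of C. *)
Lemma Rintegral_continuity (F_ : nat -> E -> R) (F : E -> R) (A : set E) (M : R) (N : set E) :
  measurable A -> (vol A < +oo)%E ->
  (forall m, measurable_fun setT (F_ m)) -> measurable_fun setT F ->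
  (forall m x, `|F_ m x| <= M) -> (forall m x, ~ A x -> F_ m x = 0) ->
  mu.-negligible N -> (forall x, ~ N x -> F_ m x @[m --> \oo] --> F x) ->
  \int[mu]_x F_ m x @[m --> \oo] --> \int[mu]_x F x.
Proof.
move=> mA Afin mF_ mF FM F0 N0 cF.
have M0 : 0 <= M by exact: le_trans (normr_ge0 _) (FM 0 0).
have iM : mu.-integrable setT (EFin \o (fun x => M * \1_A x)).
  apply: (@integrable_bounded _ _ _ _ A _ M) => //.
  - by apply: measurable_funM => //; exact: measurable_indic.
  - move=> x; rewrite normrM (ger0_norm M0) ler_piMr// indicE.
    by case: (x \in A); rewrite ?normr1// normr0.
  - by move=> x Ax; rewrite indicE memNset// mulr0.
have FM' m x : `|F_ m x| <= M * \1_A x.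
  rewrite indicE; case: (boolP (x \in A)) => xA; first by rewrite mulr1.
  by rewrite F0 ?normr0 ?mulr0//; move: xA; rewrite notin_setE.
have [] := @dominated_convergence _ _ _ mu setT measurableT
  (fun m => EFin \o F_ m) (EFin \o F) (EFin \o (fun x => M * \1_A x)).
- by move=> m; exact/measurable_EFinP.
- exact/measurable_EFinP.
- apply: negligibleS N0 => x /= h; apply: contrapT => nN; apply: h => _.
  by apply: cvg_EFin; [exact: nearW|exact: cF].
- exact: iM.
- by apply: aeW => x m _; rewrite /= lee_fin.
move=> iF _ cv; rewrite /Rintegral.
by apply: fine_cvg; rewrite fineK; [exact: cv|exact: integrable_fin_num iF].
Qed.

End integral_facts.

(** * The space of independent sets *)

Section enorm_facts.
Context {R : realType} {n : nat}.
Local Notation E := 'rV[R]_n.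
Implicit Types x y : E.

Lemma enorm_eq0 x : (enorm x == 0) = (x == 0).
Proof.
have s0 (i : 'I_n) : true -> 0 <= x 0 i ^+ 2 by move=> _; exact: sqr_ge0.
rewrite /enorm sqrtr_eq0 le_eqVlt ltNge sumr_ge0// orbF.
apply/idP/eqP => [|->]; last by rewrite big1 ?eqxx// => i _; rewrite mxE expr0n.
rewrite psumr_eq0// => /allP h; apply/rowP => i; rewrite mxE.
by have := h i (mem_index_enum _); rewrite /= sqrf_eq0 => /eqP.
Qed.

Lemma enorm_ge0 x : 0 <= enorm x. Proof. exact: sqrtr_ge0. Qed.

Lemma coord_le_enorm x i : `|x 0 i| <= enorm x.
Proof.
rewrite -sqrtr_sqr /enorm ler_sqrt ?sumr_ge0//; last by move=> j _; exact: sqr_ge0.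
by rewrite (bigD1 i)//= lerDl sumr_ge0// => j _; exact: sqr_ge0.
Qed.

Lemma norm_le_enorm x : `|x| <= enorm x.
Proof.
apply/ler_addgt0Pr => e e0; apply/ltW/rV_normP.
  by rewrite ltr_wpDl// enorm_ge0.
by move=> i; rewrite (le_lt_trans (coord_le_enorm x i))// ltrDl.
Qed.

Lemma enorm_le_norm x : enorm x <= n%:R * `|x|.
Proof.
have h0 : 0 <= n%:R * `|x| by rewrite mulr_ge0.
rewrite -(ger0_norm h0) -sqrtr_sqr /enorm ler_sqrt ?sqr_ge0//.
rewrite (@le_trans _ _ (\sum_(i < n) `|x| ^+ 2))//.
  apply: ler_sum => i _; rewrite -[leLHS]real_normK ?num_real//.
  by rewrite ler_sqr ?nnegrE// coord_le_norm.
rewrite sumr_const card_ord exprMn -[leLHS]mulr_natl ler_wpM2r ?sqr_ge0//.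
by rewrite -natrX ler_nat; case: (n) => // m; rewrite expnS leq_pmulr.
Qed.

Lemma continuous_enorm : continuous (@enorm R n).
Proof.
move=> x; rewrite /enorm.
apply: (@continuous_comp _ _ _ (fun y : E => \sum_i y 0 i ^+ 2) Num.sqrt).
  apply: (@cvg_big R 'I_n +%R 0 xpredT (@add_continuous R^o) E (nbhs (x : E))
    (index_enum 'I_n) (fun i y => y 0 i ^+ 2) (fun i => x 0 i ^+ 2)
    (nbhs_filter (x : E))) => i _.
  apply: (@continuous_comp _ _ _ (fun y : E => y 0 i) (fun r => r ^+ 2)).
    exact: coord_continuous.
  exact: exprn_continuous.
exact: sqrt_continuous.
Qed.

Lemma edge_shift x y z : edge (x + z) (y + z) = edge x y.
Proof. by rewrite /edge opprD addrACA subrr addr0. Qed.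

(** At max-norm distances below 2/(n+1) distinct points are adjacent, so an independent set has at
    most one point in each open ball of radius 1/(n+1). This is the origin of the constant
    [n.+1%:R^-1] below; n+1 instead of n also covers n = 0. *)
Lemma edgeP x y : x != y -> `|x - y| < 2 / n.+1%:R -> edge x y.
Proof.
move=> xy h; rewrite /edge lt_def enorm_ge0 andbT enorm_eq0 subr_eq0 xy /=.
apply: le_lt_trans (enorm_le_norm _) _.
apply: (@le_lt_trans _ _ (n.+1%:R * `|x - y|)).
  by rewrite ler_wpM2r// ler_nat.
by rewrite mulrC -ltr_pdivlMr.
Qed.

End enorm_facts.

(** * The quotient topology described by a distance *)

Section indep_topology.
Context {R : realType} {n : nat}.
Local Notation E := 'rV[R]_n.
Implicit Types (V : set E) (k : nat) (J S : {fset E}).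

(** For positive d this says that the Hausdorff distance is less than d. The empty set is close only
    to itself, in agreement with its being isolated. *)
Definition close_sets (d : R) J J' : Prop :=
  (forall a, a \in J -> exists2 b, b \in J' & `|b - a| < d) /\
  (forall b, b \in J' -> exists2 a, a \in J & `|b - a| < d).

Lemma close_sets_refl d J : 0 < d -> close_sets d J J.
Proof. by move=> d0; split=> a aJ; exists a => //; rewrite subrr normr0. Qed.

Lemma close_setsW d d' J J' : d <= d' -> close_sets d J J' -> close_sets d' J J'.
Proof.
move=> dd' [h1 h2]; split => a aJ.
  by have [b bJ ab] := h1 a aJ; exists b => //; exact: lt_le_trans dd'.
by have [b bJ ab] := h2 a aJ; exists b => //; exact: lt_le_trans dd'.
Qed.

Lemma close_sets0 d J : close_sets d fset0 J -> J = fset0.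
Proof. by move=> [_ h]; apply/fsetP => b; rewrite inE; apply/negbTE/negP => /h[]. Qed.

Lemma indep0 V k : indep V k fset0.
Proof. by split => //; rewrite ?cardfs0// => x. Qed.

Lemma tuple_fsetP k (v : {ptws 'I_k -> E}) b :
  reflect (exists i, b = v i) (b \in tuple_fset v).
Proof.
apply: (iffP (imfsetP _ _ _ _)) => [[i _ ->]|[i ->]]; first by exists i.
by exists i.
Qed.

Lemma ptws_near_ball k (v : {ptws 'I_k -> E}) i a d : `|v i - a| < d ->
  \forall w \near v, `|w i - a| < d.
Proof.
move=> h.
have : nbhs (v i) [set y | `|y - a| < d].
  apply/nbhs_ballP; exists (d - `|v i - a|); first by rewrite /= subr_gt0.
  move=> y; rewrite -ball_normE /= => hy.
  rewrite -(subrKA (v i)) (le_lt_trans (ler_normD _ _))//.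
  by rewrite -ltrBrDr distrC.
exact: (@proj_continuous _ (fun=> E) i v).
Qed.

Lemma ptws_near_forall k (v : {ptws 'I_k -> E}) (I : finType)
    (P : I -> {ptws 'I_k -> E} -> Prop) :
  (forall i, \forall w \near v, P i w) -> \forall w \near v, forall i, P i w.
Proof. exact: (@filter_forall _ I P (nbhs v) (nbhs_filter v)). Qed.

Lemma near_close_sets k (v : {ptws 'I_k -> E}) J0 d :
  close_sets d J0 (tuple_fset v) -> \forall w \near v, close_sets d J0 (tuple_fset w).
Proof.
move=> [h1 h2].
have H1 : \forall w \near v, forall i : 'I_(size (J0 : seq E)),
    exists2 b, b \in tuple_fset w & `|b - nth 0 (J0 : seq E) i| < d.
  apply: ptws_near_forall => i.
  have [b /tuple_fsetP[j ->] hd] := h1 _ (mem_nth 0 (ltn_ord i)).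
  near=> w; exists (w j); first by apply/tuple_fsetP; exists j.
  by near: w; exact: ptws_near_ball.
have H2 : \forall w \near v, forall i, exists2 a, a \in J0 & `|w i - a| < d.
  apply: ptws_near_forall => i.
  have [|a aJ hd] := h2 (v i); first by apply/tuple_fsetP; exists i.
  near=> w; exists a => //.
  by near: w; exact: ptws_near_ball.
near=> w; split => [a aJ|b /tuple_fsetP[i ->]].
  have h : (index a (J0 : seq E) < size (J0 : seq E))%N by rewrite index_mem.
  have : forall i : 'I_(size (J0 : seq E)),
    exists2 b, b \in tuple_fset w & `|b - nth 0 (J0 : seq E) i| < d by near: w.
  by move=> /(_ (Ordinal h)); rewrite /= nth_index.
by move: i; near: w.
Unshelve. all: by end_near. Qed.

Lemma open_close_sets V k J0 d :
  open ([set J | close_sets d J0 J] : set (indep_space V k)).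
Proof.
change (open ([set v | close_sets d J0 (tuple_fset v)] : set (subspace (@indep_tuples R n V k)))).
by apply: open_subspaceW; rewrite openE => v /near_close_sets.
Qed.

Lemma indep_close_inj V k J d a b b' : d <= n.+1%:R^-1 -> indep V k J ->
  b \in J -> b' \in J -> `|b - a| < d -> `|b' - a| < d -> b = b'.
Proof.
move=> dn [_ _ iJ] bJ b'J h1 h2; apply/eqP/negPn/negP => bb'.
have := iJ b b' bJ b'J; rewrite edgeP//.
rewrite -(subrKA a) (le_lt_trans (ler_normD _ _))//.
by rewrite (distrC a b') mulr2n mulrDl mul1r ltrD//; exact: lt_le_trans dn.
Qed.

(** An enumeration of J0 is moved point by point into J. Below the scale 1/(n+1) the points of the
    independent set J near a given point of J0 coincide, so the moved tuple exhausts J; being close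
    to the enumeration of J0, it lies in the open set of tuples defined by U. *)
Lemma open_indep_close V k J0 (U : set (indep_space V k)) : indep V k J0 ->
  open U -> U J0 -> exists2 d : R, 0 < d &
    forall J, indep V k J -> close_sets d J0 J -> U J.
Proof.
move=> iJ0 oU UJ0.
have [J00|/fset0Pn[a0 a0J]] := eqVneq J0 fset0.
  by exists 1 => // J _; rewrite J00 => /close_sets0 ->; rewrite -J00.
have /open_subspaceP[W oW WU] :
  open ([set v | U (tuple_fset v)] : set (subspace (@indep_tuples R n V k))) := oU.
have [_ cJ0 _] := iJ0.
(* Padding with [a0], a point of J0, makes a tuple of length k without changing its image. *)
pose v0 : {ptws 'I_k -> E} := fun i => nth a0 (J0 : seq E) i.
have v0J i : v0 i \in J0.
  rewrite /v0; case: (ltnP i (size (J0 : seq E))) => h; first exact: mem_nth.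
  by rewrite nth_default.
have Jv0 a : a \in J0 -> exists i, a = v0 i.
  move=> aJ; have h : (index a (J0 : seq E) < k)%N.
    by apply: leq_trans cJ0; rewrite index_mem.
  by exists (Ordinal h); rewrite /v0 /= nth_index.
have v0E : tuple_fset v0 = J0.
  apply/fsetP => a; apply/tuple_fsetP/idP => [[i ->]//|]; exact: Jv0.
have Wv0 : W v0.
  have : (W `&` @indep_tuples R n V k) v0 by rewrite WU; split; rewrite /indep_tuples /= v0E.
  by case.
(* Every neighborhood of [v0] in the product topology contains a ball for the maximum of the
   coordinate distances. *)
pose F := filter_from [set d : R | 0 < d]
  (fun d => [set v : {ptws 'I_k -> E} | forall i, `|v i - v0 i| < d]).
have FF : Filter F.
  apply: filter_from_filter; first by exists 1 => /=.
  move=> d1 d2 /= d10 d20; exists (Num.min d1 d2) => /=; first by rewrite lt_min d10.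
  by move=> v h; split => i; have := h i; rewrite lt_min => /andP[].
have Fv0 : {ptws, F --> v0}.
  apply/cvg_sup => i W'; rewrite nbhsE => -[_ [[C oC <-] Cv0] CW].
  have /nbhs_ballP[e e0 eC] : nbhs (v0 i) C by exact: open_nbhs_nbhs.
  by exists e => // v hv; apply: CW; apply: eC; rewrite -ball_normE /= distrC.
have [d d0 dW] : F W by apply: Fv0; exact: open_nbhs_nbhs.
exists (Num.min d n.+1%:R^-1); first by rewrite lt_min invr_gt0 ltr0n andbT; exact: d0.
move=> J iJ [h1 h2].
have ch i : exists b, b \in J /\ `|b - v0 i| < Num.min d n.+1%:R^-1.
  by have [b bJ hb] := h1 _ (v0J i); exists b.
pose v : {ptws 'I_k -> E} := fun i => projT1 (cid (ch i)).
have vP i : v i \in J /\ `|v i - v0 i| < Num.min d n.+1%:R^-1.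
  by rewrite /v; case: (cid (ch i)).
have vE : tuple_fset v = J.
  apply/fsetP => b; apply/tuple_fsetP/idP => [[i ->]|bJ]; first by case: (vP i).
  have [a /Jv0[i ->] hb] := h2 b bJ; exists i.
  by have [vJ hv] := vP i; apply: (indep_close_inj _ iJ bJ vJ hb hv); rewrite ge_min lexx orbT.
have Wv : W v.
  by apply: dW => i; have [_] := vP i; rewrite lt_min => /andP[].
have : (W `&` @indep_tuples R n V k) v by split => //; rewrite /indep_tuples /= vE.
by rewrite WU => -[/=]; rewrite vE.
Qed.

(* For J, J' independent and d < 1/(n+1), close_sets d J J' forces a bijection
   between J and J', so that these conditions describe the topology of I_k(V). *)
Definition metric_kernel V k (K : E -> E -> {fset E} -> R) : Prop :=
  forall x y J, V x -> V y -> indep V k J -> forall e : R, 0 < e ->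
  exists2 d : R, 0 < d & forall x' y' J', V x' -> V y' -> indep V k J' ->
    `|x' - x| < d -> `|y' - y| < d -> close_sets d J J' ->
    `|K x' y' J' - K x y J| < e.

Lemma continuous_kernelP V k K :
  continuous_kernel V k K <-> metric_kernel V (k - 2) K.
Proof.
split.
- move=> /subspace_continuousP cK x y J Vx Vy iJ e e0.
  have := cK (x, y, J) (And3 Vx Vy iJ).
  move=> /cvgrPdist_lt /(_ e e0); rewrite near_withinE /=.
  case=> -[P Q] /= [P1 Q1] PQ.
  move: P1 => /nbhs_ballP[d1 d10 hd1].
  move: Q1; rewrite nbhsE => -[U [oU UJ] UQ].
  have [d2 d20 hd2] := open_indep_close iJ oU UJ.
  exists (Num.min d1 d2); first by rewrite lt_min d10.
  move=> x' y' J' Vx' Vy' iJ'; rewrite !lt_min => /andP[xx' _] /andP[yy' _] JJ'.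
  rewrite distrC; apply: (PQ (x', y', J')) => /=; last by split.
  split => /=.
    by apply: hd1; split; rewrite -ball_normE /= distrC.
  apply: UQ; apply: hd2 => //; apply: close_setsW JJ'.
  by rewrite ge_min lexx orbT.
- move=> cK; apply/subspace_continuousP => -[[x y] J] [/= Vx Vy iJ].
  apply/cvgrPdist_lt => e e0; rewrite near_withinE /=.
  have [d d0 hd] := cK x y J Vx Vy iJ e e0.
  exists (ball (x, y) d, [set J' | close_sets d J J']).
    split => /=; first exact: nbhsx_ballx.
    apply: open_nbhs_nbhs; split; first exact: open_close_sets.
    exact: close_sets_refl.
  move=> [[x' y'] J'] [[/= b1 b2] JJ'] [/= Vx' Vy' iJ'].
  rewrite distrC; apply: hd => //.
    by move: b1; rewrite -ball_normE /= distrC.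
  by move: b2; rewrite -ball_normE /= distrC.
Qed.

(** Adjacency is the open condition 0 < |x - y| < 2, so the independent tuples form a closed subset
    of the compact power of V. Coinciding entries are harmless. *)
Lemma compact_indep_tuples V k : compact V -> compact (@indep_tuples R n V k).
Proof.
move=> cV; have clV : closed V by apply: compact_closed => //; exact: norm_hausdorff.
apply: (@subclosed_compact _ _ [set v : {ptws 'I_k -> E} | forall i, V (v i)]); last 1 first.
- by move=> v [h _ _] i; apply: h => /=; apply/tuple_fsetP; exists i.
- have -> : @indep_tuples R n V k =
     (\bigcap_i [set v : {ptws 'I_k -> E} | V (v i)]) `&`
     ~` [set v : {ptws 'I_k -> E} | exists i j, edge (v i) (v j)].
    apply/seteqP; split => v.
      move=> [h1 h2 h3]; split; first by move=> i _; apply: h1; apply/tuple_fsetP; exists i.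
      move=> [i [j]]; apply/negP; by apply: h3; apply/tuple_fsetP; [exists i|exists j].
    move=> [h1 h2]; split.
    - by move=> b /tuple_fsetP[i ->]; exact: h1.
    - rewrite /tuple_fset (leq_trans (leq_imfset_card _ _ _))//.
      rewrite -[leqRHS](size_enum_ord k) uniq_leq_size ?enum_finmem_uniq//.
    - move=> x y /tuple_fsetP[i ->] /tuple_fsetP[j ->].
      by apply/negP => eij; apply: h2; exists i, j.
  apply: closedI.
    apply: closed_bigI => i _; apply: (@preimage_closed _ _ (fun v : {ptws 'I_k -> E} => v i)) => //.
    by move=> v _; exact: (@proj_continuous _ (fun=> E) i v).
  apply: open_closedC.
  rewrite (_ : mkset _ = \bigcup_i \bigcup_j [set v : {ptws 'I_k -> E} | edge (v i) (v j)]);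
    last first.
    by apply/seteqP; split => v; [move=> [i [j h]]; exists i => //; exists j|
      move=> [i _ [j _ h]]; exists i, j].
  apply: bigcup_open => i _; apply: bigcup_open => j _.
  rewrite (_ : mkset _ = (fun v : {ptws 'I_k -> E} => enorm (v i - v j)) @^-1` `]0, 2[%classic);
    last first.
    by apply/seteqP; split => v; rewrite /= in_itv.
  apply: open_comp; last exact: interval_open.
  move=> v _; apply: (@continuous_comp _ _ _ (fun v : {ptws 'I_k -> E} => v i - v j) enorm).
    have c l : (w l : E) @[w --> v] --> (v l : E) := @proj_continuous _ (fun=> E) l v.
    exact: cvgB (c i) (c j).
  exact: continuous_enorm.
- exact: (@tychonoff _ (fun=> E) (fun=> V)).
Qed.

Lemma compact_fun_bounded (T : topologicalType) (A : set T) (f : T -> R) :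
  compact A -> {within A, continuous f} -> exists M, forall x, A x -> `|f x| <= M.
Proof.
move=> cA cf; have := continuous_compact cf cA.
move=> /(@compact_bounded R R^o)[M [_ hM]]; exists (M + 1) => x Ax.
by apply: (hM (M + 1)); [rewrite ltrDl|exists x].
Qed.

(** The nonempty J are images of points of a compact space of tuples. The empty J is no such image
    when k is positive and gets a bound of its own. *)
Lemma metric_kernel_bounded V k K : compact V -> metric_kernel V k K ->
  exists M, forall x y J, V x -> V y -> indep V k J -> `|K x y J| <= M.
Proof.
move=> cV cK.
have [M0 hM0] : exists M, forall p : E * E, (V `*` V) p -> `|K p.1 p.2 fset0| <= M.
  apply: compact_fun_bounded; first exact: compact_setX.
  apply/subspace_continuousP => -[x y] [/= Vx Vy].
  apply/cvgrPdist_lt => e e0; rewrite near_withinE /=.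
  have [d d0 hd] := cK x y fset0 Vx Vy (indep0 V k) e e0.
  apply/nbhs_ballP; exists d => //= -[x' y'] [/= b1 b2] [/= Vx' Vy'].
  rewrite distrC; apply: hd => //.
  - by move: b1; rewrite -ball_normE /= distrC.
  - by move: b2; rewrite -ball_normE /= distrC.
have [M1 hM1] : exists M, forall p : E * E * {ptws 'I_k -> E},
    (V `*` V `*` @indep_tuples R n V k) p -> `|K p.1.1 p.1.2 (tuple_fset p.2)| <= M.
  apply: compact_fun_bounded.
    by apply: compact_setX; [exact: compact_setX|exact: compact_indep_tuples].
  apply/subspace_continuousP => -[[x y] v] [[/= Vx Vy] iv].
  apply/cvgrPdist_lt => e e0; rewrite near_withinE /=.
  have [d d0 hd] := cK x y _ Vx Vy iv e e0.
  have nv : \forall w \near v, forall i, `|w i - v i| < d.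
    by apply: ptws_near_forall => i; apply: ptws_near_ball; rewrite subrr normr0.
  exists (ball (x, y) d, [set w | forall i, `|w i - v i| < d]).
    by split => //=; exact: nbhsx_ballx.
  move=> [[x' y'] w] [[/= b1 b2] hw] [[/= Vx' Vy'] iw].
  rewrite distrC; apply: hd => //.
  - by move: b1; rewrite -ball_normE /= distrC.
  - by move: b2; rewrite -ball_normE /= distrC.
  split => a /tuple_fsetP[i ->]; [exists (w i)|exists (v i)] => //;
    by apply/tuple_fsetP; exists i.
exists (Num.max M0 M1) => x y J Vx Vy iJ; rewrite le_max.
have [J0|/fset0Pn[a0 a0J]] := eqVneq J fset0.
  by rewrite J0 (hM0 (x, y)).
have [_ cJ _] := iJ.
pose v : {ptws 'I_k -> E} := fun i => nth a0 (J : seq E) i.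
have vE : tuple_fset v = J.
  apply/fsetP => a; apply/tuple_fsetP/idP => [[i ->]|aJ].
    rewrite /v; case: (ltnP i (size (J : seq E))) => h; first exact: mem_nth.
    by rewrite nth_default.
  have h : (index a (J : seq E) < k)%N.
    by apply: leq_trans cJ; rewrite index_mem.
  by exists (Ordinal h); rewrite /v /= nth_index.
have := hM1 (x, y, v); rewrite /= vE => -> //; first by rewrite orbT.
by split => //=; rewrite /indep_tuples /= vE.
Qed.

End indep_topology.

(** * Positive definite kernels *)

Section positive_definite_facts.
Context {R : realType} {n : nat}.
Local Notation E := 'rV[R]_n.

Lemma sum_delta (F : {fset E}) a (g : E -> R) : a \in F ->
  \sum_(x <- F) (a == x)%:R * g x = g a.
Proof.
move=> aF; rewrite (bigD1_seq a) ?fset_uniq//= eqxx mul1r big1 ?addr0// => x.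
by rewrite eq_sym => /negbTE ->; rewrite mul0r.
Qed.

(** Points may be repeated in [s]: the weights at equal points add up. Sampled points need this
    freedom. *)
Lemma positive_definite_seq (V : set E) (K : E -> E -> R) (s : seq (R * E)) :
  positive_definite V K -> (forall p, p \in s -> V p.2) ->
  0 <= \sum_(p <- s) \sum_(q <- s) p.1 * q.1 * K p.2 q.2.
Proof.
move=> [_ pK] sV.
pose F : {fset E} := [fset p.2 | p in s]%fset.
pose c x := \sum_(p <- s) (p.2 == x)%:R * p.1.
have sF p : p \in s -> p.2 \in F by move=> ps; apply/imfsetP; exists p.
have FV : [set` F] `<=` V by move=> _ /= /imfsetP[p /= ps ->]; exact: sV.
have := pK F c FV; congr (0 <= _).
have lin (g : E -> R) : \sum_(x <- F) c x * g x = \sum_(p <- s) p.1 * g p.2.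
  under eq_bigr do rewrite /c mulr_suml.
  rewrite exchange_big /=; apply: eq_big_seq => p ps.
  transitivity (\sum_(x <- F) (p.2 == x)%:R * (p.1 * g x)).
    by apply: eq_bigr => x _; rewrite mulrA.
  by rewrite sum_delta// sF.
transitivity (\sum_(x <- F) c x * (\sum_(q <- s) q.1 * K x q.2)).
  apply: eq_bigr => x _; rewrite -lin mulr_sumr.
  by apply: eq_bigr => y _; rewrite mulrA.
rewrite lin; apply: eq_bigr => p _; rewrite mulr_sumr.
by apply: eq_bigr => q _; rewrite mulrA.
Qed.

Lemma positive_definite_diag (V : set E) (K : E -> E -> R) x :
  positive_definite V K -> V x -> 0 <= K x x.
Proof.
move=> pK Vx; have := @positive_definite_seq V K [:: (1, x)] pK.
rewrite !big_seq1 /= !mul1r; apply => p.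
by rewrite inE => /eqP ->.
Qed.

Lemma discriminant_le (a b c : R) : 0 <= a ->
  (forall t, 0 <= t ^+ 2 * a + 2 * t * b + c) -> b ^+ 2 <= a * c.
Proof.
rewrite le_eqVlt => /orP[/eqP <-|a0] h.
- rewrite mul0r; have [->|b0] := eqVneq b 0; first by rewrite expr0n.
  (* This t makes the affine function 2tb + c equal to -1. *)
  have := h (- (c + 1) / (2 * b)); rewrite mulr0 add0r.
  rewrite (_ : _ + c = -1) ?oppr_ge0 ?ler10//.
  by field.
(* The minimizer of the quadratic polynomial. *)
- have := h (- b / a); rewrite (_ : _ + c = c - b ^+ 2 / a).
    by rewrite subr_ge0 ler_pdivrMr// mulrC.
  by field; rewrite gt_eqF.
Qed.

End positive_definite_facts.

(** * Positive definiteness for integrals *)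

Section integral_of_positive_definite.
Context {R : realType} {n : nat}.
Local Notation E := 'rV[R]_n.
Local Notation mu := (lebesgue_rV R n).
Variables (V D : set E) (K : E -> E -> R) (w : E -> R).
Hypotheses (pK : positive_definite V K) (mD : measurable D) (DV : D `<=` V).
Hypotheses (Dfin : (vol D < +oo)%E) (D0 : vol D != 0%E).
Hypothesis w0 : forall x, ~ D x -> w x = 0.
Hypothesis iK : forall x, V x ->
  mu.-integrable setT (EFin \o (fun y => w y * K x y)).
Hypothesis iKK : mu.-integrable setT
  (EFin \o (fun x => w x * \int[mu]_y (w y * K x y))).
Hypothesis iD : mu.-integrable setT (EFin \o (fun x => w x ^+ 2 * K x x)).

Let phi x := \int[mu]_y (w y * K x y).
Let I0 := \int[mu]_x (w x * phi x).
Let L := fine (vol D).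
Let d0 := \int[mu]_x (w x ^+ 2 * K x x).
Let S (s : seq (R * E)) := \sum_(p <- s) \sum_(q <- s) p.1 * q.1 * K p.2 q.2.
Let B (s : seq (R * E)) := \sum_(p <- s) p.1 * phi p.2.

Let L0 : 0 < L.
Proof. by rewrite fine_gt0// Dfin andbT lt0e D0 measure_ge0. Qed.

Let S_cons c x s : V x -> (forall p, p \in s -> V p.2) ->
  S ((c, x) :: s) = c ^+ 2 * K x x + 2 * c * (\sum_(p <- s) p.1 * K p.2 x) + S s.
Proof.
move=> Vx sV; rewrite /S big_cons big_cons /= -expr2.
rewrite [X in _ + X = _](_ : _ = c * (\sum_(p <- s) p.1 * K p.2 x) +
    \sum_(p <- s) \sum_(q <- s) p.1 * q.1 * K p.2 q.2); last first.
  rewrite mulr_sumr -big_split /=; apply: eq_bigr => p _.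
  by rewrite big_cons /=; congr (_ + _); ring.
rewrite (eq_big_seq (fun p => c * (p.1 * K p.2 x))); last first.
  by move=> p ps; rewrite (pK.1 x) ?mulrA//; exact: sV.
by rewrite -mulr_sumr; ring.
Qed.

(* The induction appends to the family a point drawn uniformly from D. *)
Let PD_random (m : nat) (s : seq (R * E)) : (forall p, p \in s -> V p.2) ->
  0 <= S s + 2 * m%:R * B s + m%:R * L * d0 + m%:R * (m%:R - 1) * I0.
Proof.
elim: m s => [|m IH] s sV.
  by rewrite mulr0 !mul0r !addr0; exact: positive_definite_seq pK _.
have i1 : mu.-integrable setT (EFin \o (\1_D : E -> R)).
  apply: (@integrable_bounded _ _ _ _ D _ 1) => //.
    by move=> x; rewrite indicE; case: (x \in D); rewrite ?normr1// normr0 ler01.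
  by move=> x nD; rewrite indicE memNset.
(* On D this is the expression of the induction hypothesis for [s] with [(L * w x, x)] added, and
   off D it vanishes. The factor L in the weight compensates the density 1/L of a uniform point. The
   integral of [g] is L times the claim for m+1. *)
pose g x := L ^+ 2 * (w x ^+ 2 * K x x) +
  (2 * L * (\sum_(p <- s) p.1 * (w x * K p.2 x)) +
  (2 * m%:R * L * (w x * phi x) +
   (S s + 2 * m%:R * B s + m%:R * L * d0 + m%:R * (m%:R - 1) * I0) * \1_D x)).
have isum : mu.-integrable setT (EFin \o (fun x => \sum_(p <- s | p \in s) p.1 * (w x * K p.2 x))).
  by apply: integrable_bigsum => p ps; apply: integrable_scale; apply: iK; exact: sV.
have sumE x : \sum_(p <- s) p.1 * (w x * K p.2 x) = \sum_(p <- s | p \in s) p.1 * (w x * K p.2 x).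
  by rewrite big_seq_cond; apply: eq_bigl => p; rewrite andbT.
have g0 x : 0 <= g x.
  have [Dx|nDx] := pselect (D x); last first.
    rewrite /g w0// indicE memNset// expr0n/= !mul0r !mulr0 add0r addr0 addr0.
    by rewrite big1 ?mulr0// => p _; rewrite mul0r mulr0.
  have := IH ((L * w x, x) :: s).
  rewrite S_cons//; last exact: DV.
  rewrite /B big_cons /= -/(B s) /g indicE mem_set// mulr1.
  have -> : \sum_(p <- s) p.1 * (w x * K p.2 x) = w x * \sum_(p <- s) p.1 * K p.2 x.
    by rewrite mulr_sumr; apply: eq_bigr => p _; ring.
  move=> h; apply: le_trans (h _) _; last by rewrite le_eqVlt; apply/orP; left; apply/eqP; ring.
  by move=> p; rewrite inE => /orP[/eqP ->/=|]; [exact: DV|exact: sV].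
have : 0 <= \int[mu]_x g x by apply: Rintegral_ge0 => x _.
have isum' : mu.-integrable setT (EFin \o (fun x => \sum_(p <- s) p.1 * (w x * K p.2 x))).
  by under [X in EFin \o X]eq_fun do rewrite sumE.
rewrite /g RintegralD//; last 2 first.
- exact: integrable_scale.
- apply: integrable_add; first exact: integrable_scale.
  by apply: integrable_add; [exact: integrable_scale|exact: integrable_scale].
rewrite RintegralZl//.
rewrite RintegralD//; last 2 first.
- exact: integrable_scale.
- by apply: integrable_add; [exact: integrable_scale|exact: integrable_scale].
rewrite RintegralZl// RintegralD//; [|exact: integrable_scale|exact: integrable_scale].
rewrite RintegralZl// RintegralZl// Rintegral_indic// -/L -/d0 -/I0.
have -> : \int[mu]_x (\sum_(p <- s) p.1 * (w x * K p.2 x)) = B s.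
  under eq_Rintegral do rewrite sumE.
  rewrite Rintegral_bigsum; last first.
    by move=> p ps; apply: integrable_scale; apply: iK; exact: sV.
  rewrite /B [RHS]big_seq_cond; apply: eq_big => [p|p ps]; first by rewrite andbT.
  by rewrite RintegralZl//; apply: iK; exact: sV.
rewrite (_ : _ + _ =
    L * (S s + 2 * m.+1%:R * B s + m.+1%:R * L * d0 + m.+1%:R * (m.+1%:R - 1) * I0)).
  by rewrite pmulr_rge0.
rewrite -natr1; ring.
Qed.

(** With m+1 sample points, the weights of [s] scaled by m+1, and everything divided by the square
    of m+1, the expectation is the claimed expression plus (L d0 - I0)/(m+1). This error, due to the
    diagonal terms, tends to 0. *)
Lemma positive_definite_integral (s : seq (R * E)) : (forall p, p \in s -> V p.2) ->
  0 <= \sum_(p <- s) \sum_(q <- s) p.1 * q.1 * K p.2 q.2 +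
    2 * \sum_(p <- s) p.1 * \int[mu]_y (w y * K p.2 y) +
    \int[mu]_x (w x * \int[mu]_y (w y * K x y)).
Proof.
move=> sV; rewrite -/(S s) -/(B s) -/I0.
apply/ler_addgt0Pr => e e0.
have A0 : 0 < `|L * d0 - I0| + 1 by rewrite ltr_wpDl.
have /ltr_add_invr[m] : 0 < e / (`|L * d0 - I0| + 1) by rewrite divr_gt0.
rewrite add0r ltr_pdivlMr// => hm.
have m0 : 0 < m.+1%:R :> R by rewrite ltr0n.
have := @PD_random m.+1 [seq (m.+1%:R * p.1, p.2) | p <- s].
have -> : S [seq (m.+1%:R * p.1, p.2) | p <- s] = m.+1%:R ^+ 2 * S s.
  rewrite /S big_map mulr_sumr; apply: eq_bigr => p _.
  by rewrite big_map mulr_sumr; apply: eq_bigr => q _ /=; ring.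
have -> : B [seq (m.+1%:R * p.1, p.2) | p <- s] = m.+1%:R * B s.
  by rewrite /B big_map mulr_sumr; apply: eq_bigr => p _ /=; ring.
move=> h; have {}h := h _; rewrite -(pmulr_rge0 _ (exprn_gt0 2 m0)).
apply: le_trans (h _) _; first by move=> _ /mapP[p ps ->] /=; exact: sV.
have : (L * d0 - I0) / m.+1%:R <= e.
  apply: le_trans (ltW hm); rewrite mulrC ler_wpM2l ?invr_ge0//.
  by rewrite (le_trans (ler_norm _))// lerDl.
rewrite ler_pdivrMr// => h2.
have := ler_wpM2l (ltW m0) h2 => h3.
nra.
Qed.

(** The form is nonnegative at t [s] + [w] for every real t, so its discriminant in t is not
    positive. *)
Lemma positive_definite_Cauchy_Schwarz (s : seq (R * E)) : (forall p, p \in s -> V p.2) ->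
  (\sum_(p <- s) p.1 * \int[mu]_y (w y * K p.2 y)) ^+ 2 <=
  (\sum_(p <- s) \sum_(q <- s) p.1 * q.1 * K p.2 q.2) *
    \int[mu]_x (w x * \int[mu]_y (w y * K x y)).
Proof.
move=> sV; apply: discriminant_le; first exact: positive_definite_seq pK _.
move=> t; have := @positive_definite_integral [seq (t * p.1, p.2) | p <- s].
have -> : \sum_(p <- [seq (t * p.1, p.2) | p <- s])
    \sum_(q <- [seq (t * p.1, p.2) | p <- s]) p.1 * q.1 * K p.2 q.2 = t ^+ 2 * S s.
  rewrite /S big_map mulr_sumr; apply: eq_bigr => p _.
  by rewrite big_map mulr_sumr; apply: eq_bigr => q _ /=; ring.
have -> : \sum_(p <- [seq (t * p.1, p.2) | p <- s])
    p.1 * \int[mu]_y (w y * K p.2 y) = t * B s.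
  by rewrite /B big_map mulr_sumr; apply: eq_bigr => p _ /=; rewrite mulrA.
rewrite mulrA; apply => _ /mapP[p ps ->] /=; exact: sV.
Qed.

End integral_of_positive_definite.

(** * Translation of finite sets and the operator B_k *)

Section translates.
Context {R : realType} {n : nat}.
Local Notation E := 'rV[R]_n.
Implicit Types (J S : {fset E}) (T : E -> E -> {fset E} -> R).

Lemma translateP z J b : reflect (exists2 a, a \in J & b = a + z) (b \in translate z J).
Proof. by apply: (iffP (imfsetP _ _ _ _)) => -[a aJ ->]; exists a. Qed.

Lemma mem_translate z J a : (a + z \in translate z J) = (a \in J).
Proof.
by apply/translateP/idP => [[b bJ /addIr ->]|aJ] //; exists a.
Qed.

Lemma translateD z w J : translate w (translate z J) = translate (z + w) J.
Proof.
apply/fsetP => b; apply/translateP/translateP => [[_ /translateP[a aJ ->] ->]|[a aJ ->]].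
  by exists a; rewrite ?addrA.
by exists (a + z); rewrite ?addrA// mem_translate.
Qed.

Lemma translate_inj z : injective (@translate R n z).
Proof.
move=> J J' e; apply/fsetP => a.
by rewrite -(mem_translate z J) -(mem_translate z J') e.
Qed.

Lemma translate0 z : translate z fset0 = fset0 :> {fset E}.
Proof. by apply/fsetP => b; rewrite inE; apply/negbTE/translateP => -[]. Qed.

Lemma translate1 z x : translate z [fset x]%fset = [fset (x + z)%R]%fset :> {fset E}.
Proof.
apply/fsetP => b; rewrite inE; apply/translateP/eqP => [[a]|->].
  by rewrite inE => /eqP ->.
by exists x; rewrite ?inE.
Qed.

Lemma translateU z J J' : translate z (J `|` J')%fset = (translate z J `|` translate z J')%fset.
Proof.
apply/fsetP => b; rewrite inE; apply/translateP/orP.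
  by move=> [a]; rewrite inE => /orP[h|h] ->; [left|right]; rewrite mem_translate.
by move=> [|] /translateP[a h ->]; exists a; rewrite // inE h ?orbT.
Qed.

Lemma card_translate z J : #|` translate z J| = #|` J|.
Proof. by rewrite card_imfset//=; exact: addIr. Qed.

Lemma indep_translate (V V' : set E) k z J : indep V k J ->
  (forall a, a \in J -> V' (a + z)) -> indep V' k (translate z J).
Proof.
move=> [h1 h2 h3] JV; split.
- by move=> _ /= /translateP[a aJ ->]; exact: JV.
- by rewrite card_translate.
- move=> _ _ /translateP[a aJ ->] /translateP[b bJ ->].
  by rewrite edge_shift; exact: h3.
Qed.

Lemma indepS (V V' : set E) k J : V `<=` V' -> indep V k J -> indep V' k J.
Proof. by move=> VV' [h1 h2 h3]; split => // x /h1 /VV'. Qed.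

Lemma indep_sub (V : set E) k k' J S : (J `<=` S)%fset -> (#|` J| <= k')%N ->
  indep V k S -> indep V k' J.
Proof.
move=> JS cJ [h1 _ h3]; split => //.
  by move=> x /= xJ; apply: h1 => /=; exact: (fsubsetP JS).
by move=> x y xJ yJ; apply: h3; exact: (fsubsetP JS).
Qed.

Lemma big_translate z S (P : pred E) (F : E -> R) :
  \sum_(x <- translate z S | P x) F x = \sum_(x <- S | P (x + z)) F (x + z).
Proof.
by rewrite eq_big_imfset /= ?big_map//; move=> a b _ _; exact: addIr.
Qed.

Lemma fpowerset_translate z S :
  fpowerset (translate z S) = [fset translate z J | J in fpowerset S]%fset.
Proof.
apply/fsetP => J; rewrite fpowersetE; apply/fsubsetP/imfsetP => [h|[J' /=]].
  exists (translate (- z) J); last first.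
    rewrite translateD addNr; apply/fsetP => b.
    by apply/idP/translateP => [bJ|[a aJ ->]]; [exists b; rewrite ?addr0|rewrite addr0].
  rewrite /= fpowersetE; apply/fsubsetP => _ /translateP[a /h /translateP[b bS ->] ->].
  by rewrite addrK.
rewrite fpowersetE => /fsubsetP h -> _ /translateP[a /h aS ->].
by rewrite mem_translate.
Qed.

Lemma Bop_translate k z T S :
  Bop k T (translate z S) = Bop k (fun x y J => T (x + z) (y + z) (translate z J)) S.
Proof.
rewrite /Bop fpowerset_translate eq_big_imfset /=; last first.
  by move=> a b _ _; exact: translate_inj.
rewrite big_map; apply: eq_big => J; first by rewrite card_translate.
move=> _; rewrite big_translate; apply: eq_bigr => x _.
rewrite big_translate; apply: eq_bigl => y.
rewrite -!translate1 -!translateU.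
by rewrite (inj_eq (@translate_inj z)).
Qed.

Lemma eq_Bop k T T' S :
  (forall x y J, x \in S -> y \in S -> (J `<=` S)%fset -> (#|` J| <= k - 2)%N ->
     T x y J = T' x y J) -> Bop k T S = Bop k T' S.
Proof.
move=> TT'; rewrite /Bop [LHS]big_seq_cond [RHS]big_seq_cond; apply: eq_bigr => J.
rewrite fpowersetE => /andP[JS cJ]; apply: eq_big_seq => x xS.
rewrite [LHS]big_seq_cond [RHS]big_seq_cond; apply: eq_bigr => y /andP[yS _].
exact: TT'.
Qed.

Lemma BopD k T T' S :
  Bop k (fun x y J => T x y J + T' x y J) S = Bop k T S + Bop k T' S.
Proof.
rewrite /Bop -big_split /=; apply: eq_bigr => J _.
rewrite -big_split /=; apply: eq_bigr => x _.
by rewrite -big_split.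
Qed.

Lemma BopZ k c T S : Bop k (fun x y J => c * T x y J) S = c * Bop k T S.
Proof.
rewrite /Bop mulr_sumr; apply: eq_bigr => J _.
rewrite mulr_sumr; apply: eq_bigr => x _.
by rewrite mulr_sumr.
Qed.

(** A term concentrated at the empty J enters only through pairs with {x, y} = S. So a modification
    there is felt at sets of one or two points and at no larger set. *)
Lemma Bop_empty k (g : E -> E -> R) S :
  Bop k (fun x y J => (J == fset0)%:R * g x y) S =
  \sum_(x <- S) \sum_(y <- S | ([fset x; y] == S)%fset) g x y.
Proof.
rewrite /Bop big_mkcond (bigD1_seq fset0)/=; last 2 first.
- by rewrite fpowersetE fsub0set.
- exact: fset_uniq.
rewrite [X in _ + X]big1 ?addr0.
  apply: eq_bigr => x _; apply: eq_big => y; first by rewrite fsetU0.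
  by rewrite mul1r.
move=> J /negbTE J0; case: ifP => // _; rewrite big1// => x _; rewrite big1// => y _.
by rewrite J0 mul0r.
Qed.

Lemma Bop_empty1 k (g : E -> E -> R) x :
  Bop k (fun x y J => (J == fset0)%:R * g x y) [fset x]%fset = g x x.
Proof.
rewrite Bop_empty big_seq_fset1 big_mkcond /= big_seq_fset1.
by rewrite fsetUid eqxx.
Qed.

Lemma Bop_empty2 k (g : E -> E -> R) x y : x != y ->
  Bop k (fun x y J => (J == fset0)%:R * g x y) [fset x; y]%fset = g x y + g y x.
Proof.
move=> xy; rewrite Bop_empty.
have e (F : E -> R) : \sum_(z <- [fset x; y]%fset) F z = F x + F y.
  rewrite big_fsetU1 ?inE//= big_seq_fset1 //.
have e' (P : pred E) (F : E -> R) : \sum_(z <- [fset x; y]%fset | P z) F z =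
    (if P x then F x else 0) + (if P y then F y else 0).
  by rewrite big_mkcond e.
rewrite e !e' !fsetUid eqxx.
have n1 : ([fset x] == [fset x; y])%fset = false.
  by apply/negP => /eqP/fsetP/(_ y); rewrite !inE eqxx orbT eq_sym (negbTE xy).
have n2 : ([fset y] == [fset x; y])%fset = false.
  by apply/negP => /eqP/fsetP/(_ x); rewrite !inE eqxx (negbTE xy).
by rewrite n1 n2 [X in X == _]fsetUC eqxx add0r addr0.
Qed.

Lemma Bop_empty_ge3 k (g : E -> E -> R) S : (3 <= #|` S|)%N ->
  Bop k (fun x y J => (J == fset0)%:R * g x y) S = 0.
Proof.
move=> S3; rewrite Bop_empty big1// => x _; rewrite big1// => y /eqP e.
by move: S3; rewrite -e cardfs2; case: (_ != _).
Qed.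

Lemma Bop1_ge0 k T x : (forall J, (J `<=` [fset x])%fset -> (#|` J| <= k - 2)%N -> 0 <= T x x J) ->
  0 <= Bop k T [fset x]%fset.
Proof.
move=> h; rewrite /Bop big_seq_cond sumr_ge0// => J; rewrite fpowersetE => /andP[JS cJ].
rewrite big_seq_fset1 big_mkcond /= big_seq_fset1; case: ifP => // _; exact: h.
Qed.

End translates.

(** * Continuity of kernels along sequences *)

Section sequential_continuity.
Context {R : realType} {n : nat}.
Local Notation E := 'rV[R]_n.

(** Dominated convergence is a statement on sequences. The rate 1/(m+1) comes from the failure of
    continuity with d = 1/(m+1) for each m. *)
Lemma metric_kernel_seq (V : set E) k (K : E -> E -> {fset E} -> R) :
  (forall x y J (xs ys : nat -> E) (Js : nat -> {fset E}), V x -> V y -> indep V k J ->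
     (forall m, [/\ V (xs m), V (ys m) & indep V k (Js m)]) ->
     (forall m, [/\ `|xs m - x| < m.+1%:R^-1, `|ys m - y| < m.+1%:R^-1 &
        close_sets m.+1%:R^-1 J (Js m)]) ->
     K (xs m) (ys m) (Js m) @[m --> \oo] --> K x y J) ->
  metric_kernel V k K.
Proof.
move=> h x y J Vx Vy iJ e e0; apply: contrapT => nd.
have H (m : nat) : exists t : E * E * {fset E}, [/\ V t.1.1, V t.1.2 & indep V k t.2] /\
   [/\ `|t.1.1 - x| < m.+1%:R^-1, `|t.1.2 - y| < m.+1%:R^-1,
       close_sets m.+1%:R^-1 J t.2 & e <= `|K t.1.1 t.1.2 t.2 - K x y J|].
  apply: contrapT => nt; apply: nd; exists m.+1%:R^-1; first by rewrite invr_gt0.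
  move=> x' y' J' Vx' Vy' iJ' h1 h2 h3; rewrite ltNge; apply/negP => h4.
  by apply: nt; exists (x', y', J').
pose t m := projT1 (cid (H m)).
have tP m : [/\ V (t m).1.1, V (t m).1.2 & indep V k (t m).2] /\
   [/\ `|(t m).1.1 - x| < m.+1%:R^-1, `|(t m).1.2 - y| < m.+1%:R^-1,
       close_sets m.+1%:R^-1 J (t m).2 & e <= `|K (t m).1.1 (t m).1.2 (t m).2 - K x y J|].
  by rewrite /t; case: (cid (H m)).
have := h x y J (fun m => (t m).1.1) (fun m => (t m).1.2) (fun m => (t m).2) Vx Vy iJ.
move=> /(_ (fun m => (tP m).1)) /(_ _)/cvgrPdist_lt/(_ e e0)[].
  by move=> m; have [_ []] := tP m.
move=> m _ /(_ m (leqnn m)) /=; rewrite distrC ltNge.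
by have [_ [_ _ _ ->]] := tP m.
Qed.

Lemma near_inv_lt (d : R) : 0 < d -> \forall m \near \oo, (m.+1%:R^-1 : R) < d.
Proof.
move=> d0; have /ltr_add_invr[m] := d0; rewrite add0r => hm.
exists m => // p /= mp; apply: le_lt_trans hm.
by rewrite lef_pV2 ?posrE ?ltr0n// ler_nat ltnS.
Qed.

Lemma near_shift_open (U : set E) (a z : E) : open U -> U (a + z) ->
  \forall m \near \oo, forall b, `|b - a| < m.+1%:R^-1 -> U (b + z).
Proof.
move=> oU Uaz; have /nbhs_ballP[d d0 dU] : nbhs (a + z) U by exact: open_nbhs_nbhs.
near=> m => b hb; apply: dU; rewrite -ball_normE /= opprD addrACA subrr addr0 distrC.
by apply: lt_trans hb _; near: m; exact: near_inv_lt.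
Unshelve. all: by end_near. Qed.

End sequential_continuity.

(** * Averaging over translates *)

Section averaging.
Context {R : realType} {n : nat}.
Local Notation E := 'rV[R]_n.
Local Notation mu := (lebesgue_rV R n).
Variables (C : set E) (k : nat) (K : E -> E -> {fset E} -> R).
Hypotheses (cC : compact C) (nC : vol (C `\` C°) = 0%E).
Hypothesis cK : metric_kernel C k K.

Definition restrict_kernel (x y : E) (J : {fset E}) : R :=
  if `[< [/\ C x, C y & [set` J] `<=` C] >] then K x y J else 0.

Definition average_kernel (x y : E) (J : {fset E}) : R :=
  \int[mu]_z restrict_kernel (x + z) (y + z) (translate z J).

Let mC : measurable C. Proof. exact: compact_rV_measurable. Qed.
Let clC : closed C. Proof. by apply: compact_closed => //; exact: norm_hausdorff. Qed.

Lemma compact_norm_bound : exists2 B : R, 0 < B & forall x, C x -> `|x| <= B.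
Proof.
have [B [_ hB]] := compact_bounded cC.
exists (`|B| + 1); first by rewrite ltr_wpDl.
by move=> x Cx; apply: hB => //; rewrite (le_lt_trans (ler_norm B))// ltrDl.
Qed.

Lemma compact_vol_lty : (vol C < +oo)%E.
Proof. by have [B _ hB] := compact_norm_bound; exact: vol_bounded_lty hB. Qed.

Lemma restrict_kernel_out x y J : ~ [/\ C x, C y & [set` J] `<=` C] ->
  restrict_kernel x y J = 0.
Proof. by move=> h; rewrite /restrict_kernel; case: asboolP. Qed.

Lemma restrict_kernel_in x y J : C x -> C y -> [set` J] `<=` C ->
  restrict_kernel x y J = K x y J.
Proof. by move=> h1 h2 h3; rewrite /restrict_kernel; case: asboolP => // -[]. Qed.

Let indep_in J z : indep setT k J -> [set` translate z J] `<=` C ->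
  indep C k (translate z J).
Proof.
move=> iJ JC; apply: (indep_translate iJ) => a aJ; apply: JC => /=.
by rewrite mem_translate.
Qed.

Lemma restrict_kernel_bounded : exists2 M : R, 0 <= M & forall x y J z,
  indep setT k J -> `|restrict_kernel x y (translate z J)| <= M.
Proof.
have [M hM] := metric_kernel_bounded cC cK.
exists `|M| => // x y J z iJ.
have [[h1 h2 h3]|h] := pselect [/\ C x, C y & [set` translate z J] `<=` C]; last first.
  by rewrite restrict_kernel_out// normr0.
rewrite restrict_kernel_in//; apply: le_trans (ler_norm M); apply: hM => //.
exact: indep_in.
Qed.

Lemma measurable_restrict_kernel x y J : indep setT k J ->
  measurable_fun [set: E] (fun z => restrict_kernel (x + z) (y + z) (translate z J)).
Proof.
move=> iJ.
have mS (a : E) : measurable [set z : E | C (a + z)].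
  rewrite (_ : mkset _ = (fun z => z + a) @^-1` C).
    by rewrite -[X in measurable X]setTI; apply: measurable_shift.
  by apply/seteqP; split => z /=; rewrite addrC.
pose A : set E := [set z | C (x + z)] `&` [set z | C (y + z)] `&`
   \bigcap_(a in [set` J]) [set z | C (a + z)].
have mA : measurable A.
  apply: measurableI; first exact: measurableI.
  by apply: fin_bigcap_measurable => //; exact: finite_finset.
have AP z : A z <-> [/\ C (x + z), C (y + z) & [set` translate z J] `<=` C].
  split=> [[[h1 h2] h3]|[h1 h2 h3]].
    by split => // _ /= /translateP[a aJ ->]; exact: h3.
  by split => // a aJ /=; apply: h3; rewrite /= mem_translate.
(* The second coordinate is a dummy, as the criterion for measurability is stated for pairs. *)
pose G (p : E * E) := K (x + p.1) (y + p.1) (translate p.1 J).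
have -> : (fun z => restrict_kernel (x + z) (y + z) (translate z J)) =
    (G \_ (A `*` setT)) \o (fun z : E => (z, z)).
  apply/funext => z /=; rewrite patchE.
  have [Az|nA] := pselect (A z).
    rewrite mem_set//; have [h1 h2 h3] := (AP z).1 Az.
    by rewrite restrict_kernel_in.
  rewrite memNset; last by move=> -[].
  by rewrite restrict_kernel_out// => /AP.
apply: measurableT_comp; last exact: measurable_diag.
apply: measurable_fun_continuous_on; first exact: measurableX.
move=> [z z'] [/= /AP[h1 h2 h3] _] e e0.
have [d d0 hd] := cK h1 h2 (indep_in iJ h3) e0.
exists d => // -[w w'] [/= /AP[g1 g2 g3] _] zw _; apply: hd => //.
- exact: indep_in.
- by rewrite opprD addrACA subrr add0r.
- by rewrite opprD addrACA subrr add0r.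
split => _ /translateP[a aJ ->]; [exists (a + w)|exists (a + z)]; rewrite ?mem_translate//;
  by rewrite opprD addrACA subrr add0r.
Qed.

Lemma integrable_restrict_kernel x y J : indep setT k J ->
  mu.-integrable setT (EFin \o (fun z => restrict_kernel (x + z) (y + z) (translate z J))).
Proof.
move=> iJ; have [M M0 hM] := restrict_kernel_bounded.
apply: (@integrable_bounded _ _ _ _ ((fun z => z + x) @^-1` C) _ M).
- by rewrite -[X in measurable X]setTI; apply: measurable_shift.
- by rewrite [ltLHS]vol_shift//; exact: compact_vol_lty.
- exact: measurable_restrict_kernel.
- by move=> z; exact: hM.
- by move=> z nCz; rewrite restrict_kernel_out// => -[]; rewrite addrC => h; case: nCz.
Qed.

Lemma average_kernel_shift x y z J : indep setT k J ->
  average_kernel x y J = average_kernel (x + z) (y + z) (translate z J).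
Proof.
move=> iJ; rewrite /average_kernel.
rewrite -(Rintegral_shift z (integrable_restrict_kernel x y iJ)).
apply: eq_Rintegral => w _.
by rewrite translateD !(addrC w z) !addrA.
Qed.

(** For fixed z the integrand is a nonnegative quadratic form: if J + z lies in C, it is the form of
    K at those points of F + z that lie in C, and otherwise it is 0. *)
Lemma average_kernel_positive_definite J : indep setT k J ->
  (forall J, indep C k J -> positive_definite C (fun x y => K x y J)) ->
  positive_definite setT (fun x y => average_kernel x y J).
Proof.
move=> iJ pK; split.
  move=> x y _ _; apply: eq_Rintegral => z _.
  have [[h1 h2 h3]|h] := pselect [/\ C (x + z), C (y + z) & [set` translate z J] `<=` C].
    rewrite !restrict_kernel_in//; apply: (pK _ _).1 => //; exact: indep_in.
  by rewrite !restrict_kernel_out// => -[h1 h2 h3]; apply: h.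
move=> F c _.
have i1 (x y : E) := integrable_restrict_kernel x y iJ.
pose g z := \sum_(x <- F) \sum_(y <- F)
   (c x * c y) * restrict_kernel (x + z) (y + z) (translate z J).
have -> : \sum_(x <- F) \sum_(y <- F) c x * c y * average_kernel x y J = \int[mu]_z g z.
  rewrite /g Rintegral_bigsum; last first.
    by move=> x _; apply: integrable_bigsum => y _; apply: integrable_scale; exact: i1.
  apply: eq_bigr => x _; rewrite Rintegral_bigsum; last first.
    by move=> y _; apply: integrable_scale; exact: i1.
  by apply: eq_bigr => y _; rewrite RintegralZl//; exact: i1.
apply: Rintegral_ge0 => z _; rewrite /g.
have [JC|nJC] := pselect ([set` translate z J] `<=` C); last first.
  rewrite big1// => x _; rewrite big1// => y _.
  by rewrite restrict_kernel_out ?mulr0// => -[].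
pose s := [seq (c x, x + z) | x <- [seq x <- F | `[< C (x + z) >]]].
have := @positive_definite_seq _ _ C _ s (pK _ (indep_in iJ JC)).
have <- : g z = \sum_(p <- s) \sum_(q <- s) p.1 * q.1 * K p.2 q.2 (translate z J).
  rewrite /g /s big_map big_filter [RHS]big_mkcond; apply: eq_bigr => x _ /=.
  case: asboolP => Cx; last first.
    by rewrite big1// => y _; rewrite restrict_kernel_out ?mulr0// => -[].
  rewrite big_map big_filter [RHS]big_mkcond; apply: eq_bigr => y _ /=.
  case: asboolP => Cy; last by rewrite restrict_kernel_out ?mulr0// => -[].
  by rewrite restrict_kernel_in.
by apply => p /mapP[x]; rewrite mem_filter => /andP[/asboolP Cx _] ->.
Qed.

(** Every term of the sum has {x, y} and J covering S, so if S is not contained in C, each term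
    meets a point outside of C and vanishes. Thus extension by zero commutes with B_k. *)
Lemma Bop_restrict_kernel l S : Bop l restrict_kernel S =
  if `[< [set` S] `<=` C >] then Bop l K S else 0.
Proof.
case: asboolP => SC.
  apply: eq_Bop => x y J xS yS /fsubsetP JS _; rewrite restrict_kernel_in//.
  - exact: SC.
  - exact: SC.
  - by move=> a /JS; exact: SC.
rewrite /Bop big1// => J _; rewrite big1// => x _; rewrite big1// => y /eqP SE.
rewrite restrict_kernel_out// => -[Cx Cy JC]; apply: SC.
move=> a /=; rewrite -SE !inE => /orP[/orP[/eqP ->|/eqP ->]|aJ] //; exact: JC.
Qed.

Lemma Bop_average_kernel l S : (l <= k + 2)%N -> indep setT l S ->
  mu.-integrable setT (EFin \o (fun z => Bop l restrict_kernel (translate z S))) /\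
  Bop l average_kernel S = \int[mu]_z Bop l restrict_kernel (translate z S).
Proof.
move=> lk iS.
have iJ J : (J `<=` S)%fset -> (#|` J| <= l - 2)%N -> indep setT k J.
  move=> JS cJ; apply: (indep_sub JS _ iS); apply: leq_trans cJ _.
  by rewrite leq_subLR addnC.
(* Integrability is known for independent J of bounded size only; the remaining arguments do not
   occur in the sum and are replaced by 0. *)
pose T z x y J := if (J `<=` S)%fset && (#|` J| <= l - 2)%N then
  restrict_kernel (x + z) (y + z) (translate z J) else 0.
have iT x y J : mu.-integrable setT (EFin \o (fun z => T z x y J)).
  rewrite /T; case: (boolP ((J `<=` S)%fset && (#|` J| <= l - 2)%N)) => [/andP[JS cJ]|_].
    exact/integrable_restrict_kernel/iJ.
  exact: integrable0.
have TE : (fun z => Bop l restrict_kernel (translate z S)) = (fun z => Bop l (T z) S).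
  apply/funext => z; rewrite Bop_translate; apply: eq_Bop => x y J _ _ JS cJ.
  by rewrite /T JS cJ.
rewrite TE; split.
  apply: integrable_bigsum => J _; apply: integrable_bigsum => x _.
  by apply: integrable_bigsum => y _.
transitivity (Bop l (fun x y J => \int[mu]_z T z x y J) S).
  apply: eq_Bop => x y J _ _ JS cJ; apply: eq_Rintegral => z _.
  by rewrite /T JS cJ.
rewrite /Bop Rintegral_bigsum; last first.
  move=> J _; apply: integrable_bigsum => x _; by apply: integrable_bigsum => y _.
apply: eq_bigr => J _; rewrite Rintegral_bigsum; last first.
  by move=> x _; apply: integrable_bigsum => y _.
apply: eq_bigr => x _; rewrite Rintegral_bigsum//.
Qed.

(** Discard the null set of z that move some point of {x, y} or J onto the boundary of C. For any
    other z, either all moved points are interior to C, nearby points stay in C and continuity of K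
    applies, or one moved point lies in the open complement of C, and the integrand is 0 in the
    limit and eventually along the sequence. *)
Lemma metric_average_kernel : metric_kernel setT k average_kernel.
Proof.
apply: metric_kernel_seq => x y J xs ys Js _ _ iJ ih hc.
have iJs m : indep setT k (Js m) by have [] := ih m.
have [B B0 hB] := compact_norm_bound.
have [M M0 hM] := restrict_kernel_bounded.
(* A bound for z: [xs m + z] is in C, of norm at most B, and [xs m] is within 1 of x. The last 1
   leaves room for a strict inequality. *)
pose r := B + (`|x| + 1) + 1.
have r0 : 0 < r by rewrite /r; have := normr_ge0 x; lra.
have nS (a : E) : mu.-negligible [set z | (C `\` C°) (a + z)].
  have -> : [set z | (C `\` C°) (a + z)] = (fun z => z + a) @^-1` (C `\` C°).
    by apply/seteqP; split => z /=; rewrite addrC.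
  have mB := measurable_boundary mC.
  apply/negligibleP; last by rewrite [LHS]vol_shift.
  by rewrite -[X in measurable X]setTI; apply: measurable_shift.
apply: (@Rintegral_continuity _ _
  (fun m z => restrict_kernel (xs m + z) (ys m + z) (translate z (Js m)))
  (fun z => restrict_kernel (x + z) (y + z) (translate z J)) [set z | `|z - 0| < r] M
  (\bigcup_(a in [set` (x :: y :: (J : seq E))]) [set z | (C `\` C°) (a + z)])).
- exact: measurable_rV_ball.
- apply: (@vol_bounded_lty _ _ _ r); first exact: measurable_rV_ball.
  by move=> z /=; rewrite subr0 => /ltW.
- by move=> m; exact: measurable_restrict_kernel.
- exact: measurable_restrict_kernel.
- by move=> m z; exact: hM.
- move=> m z nz; rewrite restrict_kernel_out// => -[Cx _ _]; apply: nz => /=.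
  have [hx _ _] := hc m.
  have m1 : m.+1%:R^-1 <= 1 :> R by rewrite invf_le1 ?ltr0n// ler1n.
  have h1 : `|z| <= `|xs m + z| + `|xs m|.
    by rewrite -{1}(addKr (xs m) z) addrC (le_trans (ler_normD _ _))// normrN addrC.
  have h2 : `|xs m| <= `|xs m - x| + `|x|.
    by rewrite -{1}(subrK x (xs m)) ler_normD.
  have h3 := hB _ Cx.
  rewrite subr0; apply: (le_lt_trans h1); rewrite /r -addrA; apply: ler_ltD h3 _.
  apply: (le_lt_trans h2); rewrite [ltLHS]addrC -[ltRHS]addrA ltrD2l.
  by rewrite (lt_trans hx)// (le_lt_trans m1)// ltrDl.
- exact: negligible_bigcup_seq.
move=> z nz.
have bd a : a \in x :: y :: (J : seq E) -> C (a + z) -> C° (a + z).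
  by move=> aJ Ca; apply: contrapT => nCi; apply: nz; exists a.
have [[h1 h2 h3]|h] := pselect [/\ C (x + z), C (y + z) & [set` translate z J] `<=` C].
- have nin a : a \in x :: y :: (J : seq E) -> C (a + z) ->
      \forall m \near \oo, forall b, `|b - a| < m.+1%:R^-1 -> C (b + z).
    move=> aJ Ca; have := near_shift_open (@open_interior _ C) (bd a aJ Ca).
    by apply: filterS => m hm b hb; apply: interior_subset; exact: hm.
  have nJ : \forall m \near \oo, (\bigcap_(a in [set` J])
      [set m | forall b, `|b - a| < (m.+1%:R^-1 : R) -> C (b + z)]) m.
    apply: filter_bigI => a aJ; apply: nin; first by rewrite !inE aJ !orbT.
    by apply: h3; rewrite /= mem_translate.
  apply/cvgrPdist_lt => e e0.
  have [d d0 hd] := cK h1 h2 (indep_in iJ h3) e0.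
  near=> m.
  have md : m.+1%:R^-1 < d by near: m; exact: near_inv_lt.
  have [hx' hy' [hJ1 hJ2]] := hc m.
  have Cx : C (xs m + z).
    have : forall b, `|b - x| < m.+1%:R^-1 -> C (b + z).
      by near: m; apply: nin => //; rewrite inE eqxx.
    exact.
  have Cy : C (ys m + z).
    have : forall b, `|b - y| < m.+1%:R^-1 -> C (b + z).
      by near: m; apply: nin => //; rewrite !inE eqxx orbT.
    exact.
  have CJ : [set` translate z (Js m)] `<=` C.
    have hJ : (\bigcap_(a in [set` J])
      [set m | forall b, `|b - a| < (m.+1%:R^-1 : R) -> C (b + z)]) m by near: m.
    move=> _ /= /translateP[b bJ ->]; have [a aJ ab] := hJ2 b bJ.
    exact: hJ ab.
  rewrite !restrict_kernel_in// distrC; apply: hd => //.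
  + exact: indep_in.
  + by rewrite opprD addrACA subrr addr0; exact: lt_trans md.
  + by rewrite opprD addrACA subrr addr0; exact: lt_trans md.
  + split => _ /translateP[a aJ ->].
      have [b bJ hb] := hJ1 a aJ; exists (b + z); rewrite ?mem_translate//.
      by rewrite opprD addrACA subrr addr0; exact: lt_trans md.
    have [b bJ hb] := hJ2 a aJ; exists (b + z); rewrite ?mem_translate//.
    by rewrite opprD addrACA subrr addr0; exact: lt_trans md.
- rewrite restrict_kernel_out//; apply: cvg_near_cst.
  have out a : ~ C (a + z) -> \forall m \near \oo, forall b, `|b - a| < m.+1%:R^-1 -> ~ C (b + z).
    move=> nCa; exact: (near_shift_open (closed_openC clC)).
  have : exists a, ~ C (a + z) /\ (a = x \/ a = y \/ a \in J).
    apply: contrapT => na; apply: h; split.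
    + by apply: contrapT => nc; apply: na; exists x; split => //; left.
    + by apply: contrapT => nc; apply: na; exists y; split => //; right; left.
    + move=> _ /= /translateP[a aJ ->]; apply: contrapT => nc; apply: na; exists a.
      by split => //; right; right.
  move=> [a [nCa axy]]; have := out a nCa; apply: filterS => m hm.
  have [hx' hy' [hJ1 hJ2]] := hc m.
  apply/esym; rewrite restrict_kernel_out// => -[Cx Cy CJ].
  case: axy => [ax|[ay|aJ]].
  + by apply: (hm (xs m)); rewrite ?ax.
  + by apply: (hm (ys m)); rewrite ?ay.
  + have [b bJ hb] := hJ1 a aJ; apply: (hm b) => //.
    by apply: CJ; rewrite /= mem_translate.
Unshelve. all: by end_near. Qed.

Lemma measurable_restrict_kernel0 :
  measurable_fun [set: E * E] (fun p => restrict_kernel p.1 p.2 fset0).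
Proof.
have -> : (fun p : E * E => restrict_kernel p.1 p.2 fset0) =
    (fun p => K p.1 p.2 fset0) \_ (C `*` C).
  apply/funext => -[x y] /=; rewrite patchE.
  have [[Cx Cy]|nC'] := pselect ((C `*` C) (x, y)).
    by rewrite mem_set// restrict_kernel_in.
  by rewrite memNset// restrict_kernel_out// => -[Cx Cy _]; apply: nC'.
apply: measurable_fun_continuous_on; first exact: measurableX.
move=> [x y] [/= Cx Cy] e e0.
have [d d0 hd] := cK Cx Cy (indep0 C k) e0.
exists d => // -[x' y'] [/= Cx' Cy'] h1 h2; apply: hd => //.
Qed.

Lemma restrict_kernel0_bounded : exists2 M : R, 0 <= M & forall x y,
  `|restrict_kernel x y fset0| <= M.
Proof.
have [M M0 hM] := restrict_kernel_bounded; exists M => // x y.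
by have := hM x y fset0 0 (indep0 setT k); rewrite translate0.
Qed.

(** The integrand is K at (x + z, z). Once the order of integration is exchanged, a shift of x by z
    decouples the two variables. *)
Lemma integral_average_kernel :
  mu.-integrable setT (EFin \o (fun x => average_kernel x 0 fset0)) /\
  \int[mu]_x average_kernel x 0 fset0 =
    \int[mu]_y \int[mu]_x restrict_kernel x y fset0.
Proof.
have [B B0 hB] := compact_norm_bound.
have [M M0 hM] := restrict_kernel0_bounded.
pose F (p : E * E) := restrict_kernel (p.1 + p.2) p.2 fset0.
have mF : measurable_fun [set: E * E] F.
  have m2 : measurable_fun [set: E * E] (fun p : E * E => (p.1 + p.2, p.2)).
    by apply: measurable_fun_pair; [exact: measurable_rV_add|exact: measurable_snd].
  by have := measurableT_comp measurable_restrict_kernel0 m2.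
have AE : average_kernel^~ 0 ^~ fset0 = fun x => \int[mu]_z F (x, z).
  by apply/funext => x; apply: eq_Rintegral => z _; rewrite translate0 add0r.
(* Where the integrand is not zero, x is a difference of two points of C, so its norm is at most
   2B. *)
have mA : measurable [set x : E | `|x - 0| < 2 * B + 1].
  by apply: measurable_rV_ball; rewrite ltr_wpDl// mulr_ge0// ltW.
have [] := @Fubini_bounded _ _ [set x : E | `|x - 0| < 2 * B + 1] C F M mA mC _ compact_vol_lty mF.
- apply: vol_bounded_lty mA _ => x /=; rewrite subr0; exact: ltW.
- by move=> p; exact: hM.
- move=> [x z] /= nxz; rewrite /F /= restrict_kernel_out// => -[h1 h2 _]; apply: nxz.
  split=> //; rewrite subr0 -(addrK z x) (le_lt_trans (ler_normB _ _))//.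
  by have := hB _ h1; have := hB _ h2; lra.
move=> i1 _ E1; rewrite AE; split; first exact: i1.
rewrite E1; apply: eq_Rintegral => z _.
apply: (@Rintegral_shift _ _ z (fun x => restrict_kernel x z fset0)).
apply: (@integrable_bounded _ _ _ _ C _ M).
- exact: mC.
- exact: compact_vol_lty.
- exact: (measurableT_comp measurable_restrict_kernel0 (pair2_measurable z)).
- by move=> x; exact: hM.
- by move=> x nC'; rewrite restrict_kernel_out// => -[].
Qed.

Lemma Fubini_restrict_kernel :
  mu.-integrable setT (EFin \o (fun x => \int[mu]_y restrict_kernel x y fset0)) /\
  mu.-integrable setT (EFin \o (fun y => \int[mu]_x restrict_kernel x y fset0)) /\
  \int[mu]_x \int[mu]_y restrict_kernel x y fset0 =
    \int[mu]_y \int[mu]_x restrict_kernel x y fset0.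
Proof.
have [M M0 hM] := restrict_kernel0_bounded.
have [] := @Fubini_bounded _ _ C C (fun p => restrict_kernel p.1 p.2 fset0) M mC mC
  compact_vol_lty compact_vol_lty measurable_restrict_kernel0.
- by move=> p; exact: hM.
- by move=> [x z] /= nxz; rewrite restrict_kernel_out// => -[h1 h2 _]; apply: nxz.
by move=> h1 h2 h3; split.
Qed.

(** Positive definiteness for integrals, with an empty family of points and the indicator function
    of C as weight. *)
Lemma integral_restrict_kernel_ge0 : vol C != 0%E ->
  positive_definite C (fun x y => K x y fset0) ->
  0 <= \int[mu]_x \int[mu]_y restrict_kernel x y fset0.
Proof.
move=> C0 pK.
have [M M0 hM] := restrict_kernel0_bounded.
have [iF _] := Fubini_restrict_kernel.
have wK x y : C x -> \1_C y * K x y fset0 = restrict_kernel x y fset0.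
  move=> Cx; rewrite indicE; have [Cy|nCy] := pselect (C y).
    by rewrite mem_set// mul1r restrict_kernel_in.
  by rewrite memNset// mul0r restrict_kernel_out// => -[].
have wwK x : \1_C x * \int[mu]_y (\1_C y * K x y fset0) = \int[mu]_y restrict_kernel x y fset0.
  rewrite [\1_C x]indicE; have [Cx|nCx] := pselect (C x).
    by rewrite mem_set// mul1r; apply: eq_Rintegral => y _; exact: wK.
  rewrite memNset// mul0r; transitivity (\int[mu]_(y in [set: E]) (0 : R)).
    by rewrite Rintegral_cst// mul0r.
  by apply: eq_Rintegral => y _; rewrite restrict_kernel_out// => -[].
have := @positive_definite_integral _ _ C C (fun x y => K x y fset0) (\1_C) pK mC (fun x h => h)
  compact_vol_lty C0.
move=> /(_ _ _ _ _ [::]); rewrite !big_nil mulr0 !add0r.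
under eq_Rintegral do rewrite wwK.
apply => //.
- by move=> x nCx; rewrite indicE memNset.
- move=> x Cx; under [X in EFin \o X]eq_fun do rewrite wK//.
  apply: (@integrable_bounded _ _ _ _ C _ M) => //.
  + exact: compact_vol_lty.
  + exact: (measurableT_comp measurable_restrict_kernel0 (pair1_measurable x)).
  + by move=> y nC'; rewrite restrict_kernel_out// => -[].
- by under [X in EFin \o X]eq_fun do rewrite wwK.
- have E1 x : \1_C x ^+ 2 * K x x fset0 = restrict_kernel x x fset0.
    rewrite indicE; have [Cx|nCx] := pselect (C x).
      by rewrite mem_set// expr1n mul1r restrict_kernel_in.
    by rewrite memNset// expr0n mul0r restrict_kernel_out// => -[].
  under [X in EFin \o X]eq_fun do rewrite E1.
  apply: (@integrable_bounded _ _ _ _ C _ M) => //.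
  + exact: compact_vol_lty.
  + exact: (measurableT_comp measurable_restrict_kernel0 measurable_diag).
  + by move=> x nC'; rewrite restrict_kernel_out// => -[].
Qed.

End averaging.

(** * From a kernel on a compact set to a packing kernel *)

Section upper_bound.
Context {R : realType} {n : nat}.
Local Notation E := 'rV[R]_n.
Local Notation mu := (lebesgue_rV R n).

(** The factor [(J == fset0)%:R] is locally constant because the empty set is isolated. *)
Lemma metric_kernel_add_empty (V : set E) k (K : E -> E -> {fset E} -> R) (g : E -> E -> R) :
  metric_kernel V k K -> metric_kernel V k (fun x y J => g x y) ->
  metric_kernel V k (fun x y J => K x y J + (J == fset0)%:R * g x y).
Proof.
move=> cK cg x y J Vx Vy iJ e e0.
have e20 : 0 < e / 2 by rewrite divr_gt0.
have [d1 d10 h1] := cK x y J Vx Vy iJ _ e20.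
have [d2 d20 h2] := cg x y J Vx Vy iJ _ e20.
exists (Num.min d1 d2); first by rewrite lt_min d10.
move=> x' y' J' Vx' Vy' iJ'; rewrite !lt_min => /andP[xx1 xx2] /andP[yy1 yy2] JJ.
have JJ1 : close_sets d1 J J' by apply: close_setsW JJ; rewrite ge_min lexx.
have JJ2 : close_sets d2 J J' by apply: close_setsW JJ; rewrite ge_min lexx orbT.
have a1 := h1 _ _ _ Vx' Vy' iJ' xx1 yy1 JJ1.
have a2 := h2 _ _ _ Vx' Vy' iJ' xx2 yy2 JJ2.
have -> : (J' == fset0) = (J == fset0).
  apply/eqP/eqP => [J0|J0].
    apply/fsetP => a; rewrite inE; apply/negbTE/negP => /(JJ.1 a)[b].
    by rewrite J0 inE.
  by move: JJ; rewrite J0 => /close_sets0.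
rewrite opprD addrACA -mulrBr (le_lt_trans (ler_normD _ _))// (splitr e) ltrD//.
apply: le_lt_trans a2; rewrite normrM ler_piMl//.
by case: (J == fset0); rewrite ?normr1// normr0.
Qed.

Lemma metric_kernel_scale (V : set E) k (K : E -> E -> {fset E} -> R) c :
  metric_kernel V k K -> metric_kernel V k (fun x y J => c * K x y J).
Proof.
move=> cK x y J Vx Vy iJ e e0.
have c0 : 0 < `|c| + 1 by rewrite ltr_wpDl.
have [d d0 h] := cK x y J Vx Vy iJ _ (divr_gt0 e0 c0).
exists d => // x' y' J' Vx' Vy' iJ' h1 h2 h3.
have := h _ _ _ Vx' Vy' iJ' h1 h2 h3; rewrite ltr_pdivlMr// => h4.
rewrite -mulrBr normrM; apply: le_lt_trans h4.
by rewrite mulrC ler_wpM2l// lerDl.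
Qed.

Lemma metric_kernel_cst (V : set E) k c : metric_kernel V k (fun _ _ _ => c : R).
Proof. by move=> x y J _ _ _ e e0; exists 1 => // *; rewrite subrr normr0. Qed.

Lemma positive_definite_scale (V : set E) (K : E -> E -> R) c : 0 <= c ->
  positive_definite V K -> positive_definite V (fun x y => c * K x y).
Proof.
move=> c0 [sK pK]; split; first by move=> x y Vx Vy; rewrite sK.
move=> F w FV; have := mulr_ge0 c0 (pK F w FV); congr (0 <= _).
rewrite mulr_sumr; apply: eq_bigr => x _; rewrite mulr_sumr; apply: eq_bigr => y _.
by rewrite mulrCA.
Qed.

Lemma positive_definite_add (V : set E) (K K' : E -> E -> R) :
  positive_definite V K -> positive_definite V K' ->
  positive_definite V (fun x y => K x y + K' x y).
Proof.
move=> [sK pK] [sK' pK']; split.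
  by move=> x y Vx Vy; rewrite sK// sK'.
move=> F w FV; have := addr_ge0 (pK F w FV) (pK' F w FV); congr (0 <= _).
rewrite -big_split; apply: eq_bigr => x _; rewrite -big_split; apply: eq_bigr => y _ /=.
by rewrite mulrDr.
Qed.

Lemma positive_definite_cst (V : set E) (c : R) : 0 <= c ->
  positive_definite V (fun _ _ => c).
Proof.
move=> c0; split => // F w _.
have -> : \sum_(x <- F) \sum_(y <- F) w x * w y * c = c * (\sum_(x <- F) w x) ^+ 2.
  rewrite expr2 mulr_suml mulr_sumr; apply: eq_bigr => x _.
  rewrite mulr_sumr mulr_sumr; apply: eq_bigr => y _; ring.
by rewrite mulr_ge0// sqr_ge0.
Qed.

Lemma card_fset2_ge2 (S : {fset E}) : (2 <= #|` S|)%N -> (#|` S| <= 2)%N ->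
  exists x y, x != y /\ S = [fset x; y]%fset.
Proof.
move=> S2 S2'.
have [x xS] : exists x, x \in S.
  by apply/fset0Pn; rewrite -cardfs_gt0; apply: leq_trans S2.
have [y] : exists y, y \in (S `\ x)%fset.
  by apply/fset0Pn; rewrite -cardfs_gt0; move: S2; rewrite (cardfsD1 x) xS.
rewrite !inE => /andP[yx yS]; exists x, y; split; first by rewrite eq_sym.
apply/esym/eqP; rewrite eqEfcard; apply/andP; split.
  by apply/fsubsetP => z; rewrite !inE => /orP[/eqP ->|/eqP ->].
by rewrite cardfs2 eq_sym yx.
Qed.

Lemma integrable_indic_compact (C : set E) : compact C ->
  mu.-integrable setT (EFin \o (\1_C : E -> R)).
Proof.
move=> cC; have mC : measurable C by exact: compact_rV_measurable.
have Cfin := compact_vol_lty cC.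
apply: (@integrable_bounded _ _ _ _ C _ 1) => //.
  by move=> x; rewrite indicE; case: (x \in C); rewrite ?normr1// normr0 ler01.
by move=> x nD; rewrite indicE memNset.
Qed.

Lemma integral_restrict_kernel_add1 (C : set E) k (K : E -> E -> {fset E} -> R) :
  compact C -> vol C != 0%E -> metric_kernel C k K ->
  positive_definite C (fun x y => K x y fset0) ->
  fine (vol C) ^+ 2 <= \int[mu]_x \int[mu]_y
    restrict_kernel C (fun x y J => K x y J + (J == fset0)%:R * 1) x y fset0.
Proof.
move=> cC C0 cK pK.
have mC : measurable C by exact: compact_rV_measurable.
have iF := (Fubini_restrict_kernel cC cK).1.
have [M' M'0 hM] := restrict_kernel0_bounded cC cK.
have iC := integrable_indic_compact cC.
have iR x : mu.-integrable setT (EFin \o (fun y => restrict_kernel C K x y fset0)).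
  apply: (@integrable_bounded _ _ _ _ C _ M').
  - exact: mC.
  - exact: (compact_vol_lty cC).
  - exact: (measurableT_comp (measurable_restrict_kernel0 cC cK) (pair1_measurable x)).
  - by move=> y; exact: hM.
  - by move=> y nC'; rewrite restrict_kernel_out// => -[].
have RE x y : restrict_kernel C (fun x y J => K x y J + (J == fset0)%:R * 1) x y fset0 =
    restrict_kernel C K x y fset0 + \1_C x * \1_C y.
  have [[Cx Cy]|nCC] := pselect (C x /\ C y).
    by rewrite !restrict_kernel_in// !indicE !mem_set// eqxx mul1r.
  rewrite !restrict_kernel_out; try by move=> -[Cx Cy _]; apply: nCC.
  have [Cx|nCx] := pselect (C x); last by rewrite [X in X * _]indicE memNset// mul0r addr0.
  have nCy : ~ C y by move=> Cy; apply: nCC.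
  by rewrite [X in _ * X]indicE memNset// mulr0 addr0.
rewrite (_ : Rintegral _ _ _ = \int[mu]_x (\int[mu]_y restrict_kernel C K x y fset0 +
    fine (vol C) * \1_C x)); last first.
  apply: eq_Rintegral => x _.
  transitivity (\int[mu]_y (restrict_kernel C K x y fset0 + \1_C x * \1_C y)).
    by apply: eq_Rintegral => y _; exact: RE.
  rewrite RintegralD//; last exact: integrable_scale.
  by rewrite RintegralZl// Rintegral_indic// [_ * \1_C x]mulrC.
rewrite RintegralD//; last exact: integrable_scale.
rewrite RintegralZl// Rintegral_indic// -expr2 lerDr.
exact: (integral_restrict_kernel_ge0 cC cK).
Qed.

Lemma Delta_packing_le_feasible (k : nat) (C : set E) (K : E -> E -> {fset E} -> R) (M : R) :
  (2 <= k)%N -> compact C -> vol (C `\` C°) = 0%E -> vol C != 0%E ->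
  Delta_feasible k C K M ->
  exists2 f : E -> E -> {fset E} -> R, packing_feasible k f &
    Bop k f [fset (0 : E)]%fset <= M / fine (vol C).
Proof.
move=> k2 cC nC C0 [/continuous_kernelP cK pK K1 K2 K3].
have mC : measurable C by exact: compact_rV_measurable.
have Cfin := compact_vol_lty cC.
have V0 : 0 < fine (vol C) by rewrite fine_gt0// Cfin andbT lt0e C0 measure_ge0.
(* The added term raises B_k by 1 at singletons, by 2 at pairs and by 0 at larger sets, so the
   bounds M - 1, -2 and 0 become M, 0 and 0. *)
pose K' x y J := K x y J + (J == fset0)%:R * (fun _ _ => 1) x y.
have cK' : metric_kernel C (k - 2) K'.
  apply: metric_kernel_add_empty => //; exact: metric_kernel_cst.
have pK' J : indep C (k - 2) J -> positive_definite C (fun x y => K' x y J).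
  move=> iJ; apply: positive_definite_add; first exact: pK.
  apply: (@positive_definite_cst _ ((J == fset0)%:R * 1)).
  by rewrite mulr_ge0.
have BK' S : Bop k K' S = Bop k K S + Bop k (fun x y J => (J == fset0)%:R * (fun _ _ => 1) x y) S.
  exact: BopD.
have K'1 x : C x -> Bop k K' [fset x]%fset <= M.
  by move=> Cx; rewrite BK' Bop_empty1 -lerBrDr; exact: K1.
have K'2 S : indep C k S -> (2 <= #|` S|)%N -> Bop k K' S <= 0.
  move=> iS S2; rewrite BK'; have [S3|S3] := leqP 3 #|` S|.
    by rewrite Bop_empty_ge3// addr0; exact: K3.
  have [x [y [xy SE]]] := card_fset2_ge2 S2 S3.
  have iS2 : indep C 2 S by case: iS => h1 h2 h3; split.
  rewrite SE Bop_empty2// -lerBrDr sub0r (_ : - _ = -2); last by ring.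
  by apply: K2 => //; rewrite -SE.
have kk : (k <= k - 2 + 2)%N by rewrite addnC -leq_subLR.
pose f0 := average_kernel C K'.
have if0 := (integral_average_kernel cC cK').1.
pose I := \int[mu]_x f0 x 0 fset0.
have iC := integrable_indic_compact cC.
have IE : fine (vol C) ^+ 2 <= I.
  rewrite /I (integral_average_kernel cC cK').2 -(Fubini_restrict_kernel cC cK').2.2.
  exact: (integral_restrict_kernel_add1 cC C0 cK (pK _ (indep0 C (k - 2)))).
have I0 : 0 < I by apply: lt_le_trans IE; rewrite exprn_gt0.
(* M bounds a sum of diagonal values of positive definite kernels at a point of C. Its sign is
   needed for the translates that miss C and for the final estimate, where M is multiplied by
   vol(C)/I. *)
have M0 : 0 <= M.
  have [x Cx] : exists x, C x.
    apply: contrapT => nx; move/eqP: C0; apply.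
    rewrite (_ : C = set0); first exact: measure0.
    by rewrite -subset0 => x Cx; apply: nx; exists x.
  apply: le_trans (K'1 x Cx); apply: Bop1_ge0 => J Jx cJ.
  apply: (positive_definite_diag (pK' J _) Cx).
  split => //.
    by move=> y /= /(fsubsetP Jx); rewrite inE => /eqP ->.
  move=> a b /(fsubsetP Jx); rewrite inE => /eqP -> /(fsubsetP Jx); rewrite inE => /eqP ->.
  by rewrite /edge subrr (eqP (_ : enorm 0 == 0)) ?ltxx// enorm_eq0.
have Bf0 S : indep setT k S -> (2 <= #|` S|)%N -> Bop k f0 S <= 0.
  move=> iS S2; have [i1 ->] := Bop_average_kernel cC cK' kk iS.
  rewrite -oppr_ge0.
  have -> : - (\int[mu]_z Bop k (restrict_kernel C K') (translate z S)) =
      \int[mu]_z (- 1 * Bop k (restrict_kernel C K') (translate z S)).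
    by rewrite RintegralZl// mulN1r.
  apply: Rintegral_ge0 => z _; rewrite mulN1r oppr_ge0 Bop_restrict_kernel.
  case: asboolP => // SC; apply: K'2; last by rewrite card_translate.
  by apply: (indep_translate iS) => a aS; apply: SC; rewrite /= mem_translate.
have Bf1 : Bop k f0 [fset (0 : E)]%fset <= M * fine (vol C).
  have i0 : indep setT k ([fset 0]%fset : {fset E}).
    split => //; first by rewrite cardfs1; apply: leq_trans k2.
    move=> a b; rewrite !inE => /eqP -> /eqP ->.
    by rewrite /edge subrr (eqP (_ : enorm 0 == 0)) ?ltxx// enorm_eq0.
  have [i1 ->] := Bop_average_kernel cC cK' kk i0.
  rewrite -(Rintegral_indic mu mC) -RintegralZl//; apply: le_Rintegral => //.
    exact: integrable_scale.
  move=> z _; rewrite Bop_restrict_kernel translate1 add0r indicE.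
  case: asboolP => [zC|nzC].
    have Cz : C z by apply: zC; rewrite /= inE.
    by rewrite mem_set// mulr1; exact: K'1.
  by rewrite mulr_ge0.
(* Division by I normalizes the integral to 1; since I is at least the square of vol(C), the bound M
   vol(C) becomes at most M / vol(C). *)
exists (fun x y J => I^-1 * f0 x y J).
  have I1 : 0 <= I^-1 by rewrite invr_ge0 ltW.
  split.
  - apply/continuous_kernelP; apply: metric_kernel_scale; exact: metric_average_kernel.
  - by move=> x y z J iJ; congr (_ * _); exact: (average_kernel_shift cC cK').
  - move=> J iJ; apply: positive_definite_scale => //.
    exact: (average_kernel_positive_definite cC cK').
  - by move=> S iS S2; rewrite BopZ mulr_ge0_le0//; exact: Bf0.
  - split; first exact: integrable_scale.
    under eq_integral do rewrite EFinM.
    rewrite integralZl// -(fineK (integrable_fin_num measurableT if0)) -EFinM.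
    by rewrite mulVf// gt_eqF.
rewrite BopZ.
apply: (@le_trans _ _ (I^-1 * (M * fine (vol C)))).
  by rewrite ler_wpM2l// invr_ge0 ltW.
rewrite mulrC -mulrA ler_wpM2l// ler_pdivrMr// mulrC ler_pdivlMr//.
Qed.

End upper_bound.

(** * Convolution estimates *)

Section convolution.
Context {R : realType} {n : nat}.
Local Notation E := 'rV[R]_n.
Local Notation mu := (lebesgue_rV R n).

Variables (phi : E -> R) (B : R).
Hypotheses (mphi : measurable_fun setT phi) (phiB : forall x, `|phi x| <= B).
Hypothesis phi_even : forall x, phi (- x) = phi x.
Hypothesis iphi : mu.-integrable setT (EFin \o phi).

Let phi_sub x y : phi (x - y) = phi (y - x).
Proof. by rewrite -phi_even opprB. Qed.

Let B0 : 0 <= B. Proof. exact: le_trans (normr_ge0 _) (phiB 0). Qed.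

Lemma measurable_conv_kernel : measurable_fun [set: E * E] (fun p => phi (p.1 - p.2)).
Proof. by have := measurableT_comp mphi measurable_rV_sub. Qed.

Lemma integrable_translate x : mu.-integrable setT (EFin \o (fun y => phi (x - y))).
Proof.
under [X in EFin \o X]eq_fun do rewrite phi_sub.
exact: integrable_shift.
Qed.

Lemma Rintegral_translate x : \int[mu]_y phi (x - y) = \int[mu]_y phi y.
Proof. by under eq_Rintegral do rewrite phi_sub; exact: Rintegral_shift. Qed.

Section weight.
Variables (w : E -> R) (D : set E) (M : R).
Hypotheses (mw : measurable_fun setT w) (wM : forall x, `|w x| <= M).
Hypotheses (mD : measurable D) (Dfin : (vol D < +oo)%E).
Hypothesis w0 : forall x, ~ D x -> w x = 0.

Let M0 : 0 <= M. Proof. exact: le_trans (normr_ge0 _) (wM 0). Qed.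

Lemma integrable_conv x : mu.-integrable setT (EFin \o (fun y => w y * phi (x - y))).
Proof.
apply: (@integrable_bounded _ _ _ _ D _ (M * B)) => //.
- apply: measurable_funM => //.
  by have := measurableT_comp measurable_conv_kernel (pair1_measurable x).
- by move=> y; rewrite normrM ler_pM.
- by move=> y /w0 ->; rewrite mul0r.
Qed.

Lemma integrable_weighted_conv (v : E -> R) (D' : set E) (M' : R) :
  measurable_fun setT v -> (forall x, `|v x| <= M') -> measurable D' ->
  (vol D' < +oo)%E -> (forall x, ~ D' x -> v x = 0) ->
  mu.-integrable setT (EFin \o (fun x => v x * \int[mu]_y (w y * phi (x - y)))).
Proof.
move=> mv vM mD' D'fin v0.
have [] := @Fubini_bounded _ _ D' D
  (fun p => v p.1 * (w p.2 * phi (p.1 - p.2))) (M' * (M * B)) mD' mD D'fin Dfin.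
- apply: measurable_funM; first exact: (measurableT_comp mv measurable_fst).
  apply: measurable_funM; first exact: (measurableT_comp mw measurable_snd).
  exact: measurable_conv_kernel.
- move=> p; rewrite !normrM ler_pM ?mulr_ge0//.
  by rewrite ler_pM.
- move=> [x y] /= nxy; have [D'x|/v0 ->] := pselect (D' x); last by rewrite mul0r.
  by rewrite w0 ?mul0r ?mulr0// => Dy; apply: nxy.
move=> i1 _ _; move: i1; congr (mu.-integrable setT _); apply/funext => x /=.
by congr EFin; rewrite RintegralZl//; exact: integrable_conv.
Qed.

Lemma conv_Cauchy_Schwarz (s : seq (R * E)) : vol D != 0%E ->
  positive_definite setT (fun x y => phi (x - y)) ->
  (\sum_(p <- s) p.1 * \int[mu]_y (w y * phi (p.2 - y))) ^+ 2 <=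
  (\sum_(p <- s) \sum_(q <- s) p.1 * q.1 * phi (p.2 - q.2)) *
    \int[mu]_x (w x * \int[mu]_y (w y * phi (x - y))).
Proof.
move=> D0 pphi.
apply: (@positive_definite_Cauchy_Schwarz _ _ setT D (fun x y => phi (x - y)) w) => //.
- by move=> x _; exact: integrable_conv.
- exact: (integrable_weighted_conv mw wM mD Dfin w0).
- apply: (@integrable_bounded _ _ _ _ D _ (M ^+ 2 * B)) => //.
  + apply: measurable_funM; first exact: measurable_funX.
    rewrite (_ : (fun x => phi (x - x)) = cst (phi 0))//.
    by apply/funext => x; rewrite subrr.
  + move=> x; rewrite normrM normrX ler_pM ?sqr_ge0//.
    by rewrite ler_sqr ?nnegrE.
  + by move=> x /w0 ->; rewrite expr0n mul0r.
Qed.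

(** Young's inequality for a bounded and an integrable function. *)
Lemma conv_le x : `|\int[mu]_y (w y * phi (x - y))| <= M * \int[mu]_y `|phi y|.
Proof.
have ia : mu.-integrable setT (EFin \o (fun y => `|phi y|)).
  by have := integrable_norm iphi.
apply: le_trans (le_normr_Rintegral measurableT (integrable_conv x)) _.
rewrite -(Rintegral_shift (- x) ia) -RintegralZl//; last exact: (integrable_shift (- x) ia).
apply: le_Rintegral => //.
- by have := integrable_norm (integrable_conv x).
- by apply: integrable_scale; exact: (integrable_shift (- x) ia).
move=> y _; rewrite normrM phi_sub ler_wpM2r//.
Qed.

End weight.

(* The mass that phi puts far from x is all that a weight equal to 1 near x can miss. *)
Lemma conv_near1 (w : E -> R) (D : set E) (T : R) x :
  measurable_fun setT w -> (forall y, 0 <= w y <= 1) -> measurable D ->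
  (vol D < +oo)%E -> (forall y, ~ D y -> w y = 0) ->
  (forall y, `|y - x| <= T -> w y = 1) ->
  `|\int[mu]_y phi y - \int[mu]_y (w y * phi (x - y))| <=
  \int[mu]_y (`|phi y| * \1_[set y | T < `|y|] y).
Proof.
move=> mw w01 mD Dfin w0 w1.
have wM y : `|w y| <= 1 by have /andP[h1 h2] := w01 y; rewrite ger0_norm.
have mT : measurable [set y : E | T < `|y|].
  apply: open_rV_measurable; rewrite (_ : mkset _ = Num.norm @^-1` `]T, +oo[%classic).
    by apply: open_comp; [move=> z _; exact: norm_continuous|exact: interval_open].
  by apply/seteqP; split => z /=; rewrite in_itv/= andbT.
have it : mu.-integrable setT (EFin \o (fun y => `|phi y| * \1_[set y | T < `|y|] y)).
  apply: (le_integrable measurableT _ _ (integrable_norm iphi)).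
    apply/measurable_EFinP; apply: measurable_funM; last exact: measurable_indic.
    exact: measurableT_comp.
  move=> y _; rewrite /= lee_fin normrM normr_id ler_piMr// indicE.
  by case: (_ \in _); rewrite ?normr1// normr0.
rewrite -(Rintegral_translate x) -RintegralB//; last 2 first.
- exact: integrable_translate.
- exact: (integrable_conv mw wM mD Dfin w0).
have i2 : mu.-integrable setT (EFin \o (fun y => phi (x - y) - w y * phi (x - y))).
  by apply: integrable_sub; [exact: integrable_translate|exact: (integrable_conv mw wM mD Dfin w0)].
apply: le_trans (le_normr_Rintegral measurableT i2) _.
rewrite -(Rintegral_shift (- x) it); apply: le_Rintegral => //.
- by have := integrable_norm i2.
- exact: (integrable_shift (- x) it).
move=> y _; rewrite -{1}(mul1r (phi _)) -mulrBl normrM mulrC phi_sub ler_wpM2l//.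
rewrite indicE; have [Ty|Ty] := ltP T `|y - x|.
  rewrite mem_set//; have /andP[h1 h2] := w01 y.
  by rewrite ger0_norm ?subr_ge0// lerBlDr lerDl.
by rewrite w1// subrr normr0.
Qed.

End convolution.

(** * The constant 1 dominated by two stationary kernels *)

Section two_kernels.
Context {R : realType} {n : nat}.
Local Notation E := 'rV[R]_n.
Local Notation mu := (lebesgue_rV R n).

Variables (phi gam : E -> R) (B G : R).
Hypotheses (mphi : measurable_fun setT phi) (phiB : forall x, `|phi x| <= B).
Hypothesis phi_even : forall x, phi (- x) = phi x.
Hypothesis iphi : mu.-integrable setT (EFin \o phi).
Hypothesis phi1 : \int[mu]_x phi x = 1.
Hypothesis pphi : positive_definite setT (fun x y => phi (x - y)).
Hypotheses (mgam : measurable_fun setT gam) (gamG : forall x, `|gam x| <= G).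
Hypothesis gam_even : forall x, gam (- x) = gam x.
Hypothesis igam : mu.-integrable setT (EFin \o gam).
Hypothesis gam1 : \int[mu]_x gam x = 1.
Hypothesis pgam : positive_definite setT (fun x y => gam (x - y)).
Hypothesis gam_ge0 : forall x, 0 <= gam x.

Variables (A : nat -> set E) (T eps : R).
Hypotheses (mA : forall i, measurable (A i)) (Afin : forall i, (vol (A i) < +oo)%E).
Hypothesis A0 : vol (A 0%N) != 0%E.
Hypothesis AS : forall i x y, A i x -> `|y - x| <= T -> A i.+1 y.
Hypothesis gamT : forall x, T < `|x| -> gam x = 0.
Hypothesis T0 : 0 <= T.
Hypothesis tail : \int[mu]_y (`|phi y| * \1_[set y | T < `|y|] y) <= eps.

(* chi = gam * \1_(A 2) is 1 on A 1 and 0 outside of A 3, and p = 1 - \1_(A 2) * phi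
   on A 1; as h = gam * (\1_(A 2) * phi), it follows that h + u = gam * 1 = 1 on A 0. *)
Let th (y : E) : R := \1_(A 2%N) y.
Let chi (y : E) : R := \int[mu]_t (gam t * th (y + t)).
Let ball_T : set E := [set t | `|t| <= T].
Let h (x : E) : R := \int[mu]_y (chi y * phi (x - y)).
Let p (y : E) : R := \1_(A 1%N) y - \1_(A 1%N) y * \int[mu]_z (th z * phi (y - z)).
Let u (x : E) : R := \int[mu]_y (p y * gam (x - y)).

Let A_sub i : A i `<=` A i.+1.
Proof. by move=> x Ax; apply: (AS Ax); rewrite subrr normr0. Qed.

Let vol_A_neq0 i : vol (A i) != 0%E.
Proof.
elim: i => // i; apply: contra_neq => AS0; apply/eqP; rewrite eq_le measure_ge0 andbT.
by rewrite -AS0 le_measure ?inE.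
Qed.

Let th01 y : 0 <= th y <= 1.
Proof. by rewrite /th indicE; case: (_ \in _); rewrite ?lexx ?ler01. Qed.

Let mth : measurable_fun setT th.
Proof. exact: measurable_indic. Qed.

Let th_out y : ~ A 2%N y -> th y = 0.
Proof. by move=> nA; rewrite /th indicE memNset. Qed.

Let th_in y : A 2%N y -> th y = 1.
Proof. by move=> nA; rewrite /th indicE mem_set. Qed.

Let mball : measurable ball_T.
Proof.
apply: closed_rV_measurable.
rewrite (_ : ball_T = Num.norm @^-1` `]-oo, T]%classic).
  by apply: preimage_closed; [move=> z _; exact: norm_continuous|exact: interval_closed].
by apply/seteqP; split => z /=; rewrite in_itv.
Qed.

Let ballfin : (vol ball_T < +oo)%E.
Proof. exact: (vol_bounded_lty mball (fun _ h => h)). Qed.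

Let gam_out t : ~ ball_T t -> gam t = 0.
Proof. by move=> nb; apply: gamT; rewrite ltNge; apply/negP. Qed.

Let igt y : mu.-integrable setT (EFin \o (fun t => gam t * th (y + t))).
Proof.
apply: (le_integrable measurableT _ _ igam).
  apply/measurable_EFinP; apply: measurable_funM => //.
  rewrite (_ : (fun t => th (y + t)) = th \o (fun t => t + y)).
    exact: (measurableT_comp mth (measurable_shift y)).
  by apply/funext => t /=; rewrite addrC.
move=> t _; rewrite /= lee_fin normrM ler_piMr//.
by have /andP[h1 h2] := th01 (y + t); rewrite ger0_norm.
Qed.

Let chi01 y : 0 <= chi y <= 1.
Proof.
apply/andP; split.
  by apply: Rintegral_ge0 => t _; rewrite mulr_ge0//; have /andP[] := th01 (y + t).
rewrite -gam1; apply: le_Rintegral => // t _.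
by rewrite ler_piMr//; have /andP[] := th01 (y + t).
Qed.

Let chi_out y : ~ A 3%N y -> chi y = 0.
Proof.
move=> nA; transitivity (\int[mu]_(y in [set: E]) (0 : R)); last by rewrite Rintegral_cst// mul0r.
apply: eq_Rintegral => t _; have [bt|/gam_out ->] := pselect (ball_T t); last by rewrite mul0r.
rewrite th_out ?mulr0// => A2; apply: nA; apply: (AS A2).
by rewrite opprD addNKr normrN.
Qed.

Let chi_in y : A 1%N y -> chi y = 1.
Proof.
move=> A1; rewrite -gam1; apply: eq_Rintegral => t _.
have [bt|/gam_out ->] := pselect (ball_T t); last by rewrite mul0r.
by rewrite th_in ?mulr1//; apply: (AS A1); rewrite addrAC subrr add0r.
Qed.

Let mgt : measurable_fun [set: E * E] (fun p : E * E => gam p.2 * th (p.1 + p.2)).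
Proof.
apply: measurable_funM; first exact: (measurableT_comp mgam measurable_snd).
by have := measurableT_comp mth measurable_rV_add.
Qed.

Let gt_out (q : E * E) : ~ (A 3%N q.1 /\ ball_T q.2) -> gam q.2 * th (q.1 + q.2) = 0.
Proof.
move=> nq; have [bt|/gam_out ->] := pselect (ball_T q.2); last by rewrite mul0r.
rewrite th_out ?mulr0// => A2; apply: nq; split => //; apply: (AS A2).
by rewrite opprD addNKr normrN.
Qed.

Let G0 : 0 <= G. Proof. exact: le_trans (normr_ge0 _) (gamG 0). Qed.

Let gt_bound (q : E * E) : `|gam q.2 * th (q.1 + q.2)| <= G.
Proof.
rewrite normrM -[leRHS]mulr1 ler_pM//.
by have /andP[h1 h2] := th01 (q.1 + q.2); rewrite ger0_norm.
Qed.

Let mchi : measurable_fun setT chi.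
Proof.
have [i1 _ _] := Fubini_bounded (mA 3%N) mball (Afin 3%N) ballfin mgt gt_bound gt_out.
by have /measurable_int/measurable_EFinP := i1.
Qed.

Let chiM y : `|chi y| <= 1.
Proof. by have /andP[h1 h2] := chi01 y; rewrite ger0_norm. Qed.

Let q (y : E) : R := \int[mu]_z (th z * phi (y - z)).

Let thM y : `|th y| <= 1.
Proof. by have /andP[h1 h2] := th01 y; rewrite ger0_norm. Qed.

Let ind1M y : `|\1_(A 1%N) y| <= 1 :> R.
Proof. by rewrite indicE; case: (_ \in _); rewrite ?normr1// normr0. Qed.

Let ind1_out y : ~ A 1%N y -> \1_(A 1%N) y = 0 :> R.
Proof. by move=> nA; rewrite indicE memNset. Qed.

Let mp : measurable_fun setT p.
Proof.
apply: measurable_funB; first exact: measurable_indic.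
have i1 := integrable_weighted_conv mphi phiB mth thM (mA 2%N) (Afin 2%N) th_out
  (measurable_indic (mA 1%N)) ind1M (mA 1%N) (Afin 1%N) ind1_out.
by have /measurable_int/measurable_EFinP := i1.
Qed.

Let eps0 : 0 <= eps.
Proof.
apply: le_trans tail; apply: Rintegral_ge0 => y _; rewrite mulr_ge0// indicE ler0n.
Qed.

Let p_out y : ~ A 1%N y -> p y = 0.
Proof. by move=> nA; rewrite /p ind1_out// mul0r subr0. Qed.

Let p_in y : A 1%N y -> p y = 1 - q y.
Proof. by move=> Ay; rewrite /p indicE mem_set// mul1r. Qed.

Let p_bound y : `|p y| <= eps.
Proof.
have [Ay|nAy] := pselect (A 1%N y); last by rewrite p_out// normr0 eps0.
rewrite p_in// -phi1; apply: le_trans tail.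
apply: (conv_near1 mphi phiB phi_even iphi mth th01 (mA 2%N) (Afin 2%N) th_out).
by move=> z zy; apply: th_in; exact: (AS Ay).
Qed.

Let L := \int[mu]_y `|phi y|.
Let v i := fine (vol (A i)).

Let iA i : mu.-integrable setT (EFin \o (\1_(A i) : E -> R)).
Proof.
apply: (@integrable_bounded _ _ _ _ (A i) _ 1).
- exact: mA.
- exact: Afin.
- exact: measurable_indic.
- by move=> x; rewrite indicE; case: (_ \in _); rewrite ?normr1// normr0.
- by move=> x nA; rewrite indicE memNset.
Qed.

(** On [A 0] the weight is 1 and h is within eps of 1. On the rest of [A 3] only the crude bound L
    for |h| is available, but it is paid on a collar of small relative volume. *)
Let chi_energy : \int[mu]_x (chi x * h x) <= (1 + eps) * v 0%N + L * (v 3%N - v 0%N).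
Proof.
have L0 : 0 <= L by apply: Rintegral_ge0.
have -> : (1 + eps) * v 0%N + L * (v 3%N - v 0%N) =
   \int[mu]_x ((1 + eps) * \1_(A 0%N) x + L * (\1_(A 3%N) x - \1_(A 0%N) x)).
  rewrite RintegralD//;
    [|exact: integrable_scale|by apply: integrable_scale; exact: integrable_sub].
  rewrite !RintegralZl//; last exact: integrable_sub.
  by rewrite RintegralB// !Rintegral_indic.
apply: le_Rintegral => //.
- exact: (integrable_weighted_conv mphi phiB mchi chiM (mA 3%N) (Afin 3%N) chi_out
    mchi chiM (mA 3%N) (Afin 3%N) chi_out).
- apply: integrable_add; first exact: integrable_scale.
  by apply: integrable_scale; exact: integrable_sub.
move=> x _; rewrite !indicE.
have [Ax|nA0] := pselect (A 0%N x).
  have A1x : A 1%N x by exact: A_sub.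
  have A3x : A 3%N x by do 2 apply: A_sub.
  rewrite chi_in// !mem_set// subrr mulr0 addr0 mulr1 mul1r.
  have := conv_near1 mphi phiB phi_even iphi mchi chi01 (mA 3%N) (Afin 3%N) chi_out.
  move=> /(_ T x); rewrite -/(h x) phi1 => hx.
  have : `|1 - h x| <= eps.
    by apply: le_trans tail; apply: hx => y yx; apply: chi_in; exact: (AS Ax).
  by rewrite distrC ler_distl => /andP[].
rewrite (memNset nA0) mulr0 add0r subr0.
have [A3x|nA3] := pselect (A 3%N x); last by rewrite chi_out// mul0r memNset// mulr0.
rewrite mem_set// mulr1 (le_trans (ler_norm _))// normrM -[leRHS]mul1r ler_pM//.
have := conv_le mphi phiB phi_even iphi mchi chiM (mA 3%N) (Afin 3%N) chi_out x.
by rewrite mul1r.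
Qed.

(** Convolution with a nonnegative function of integral 1 does not increase the supremum norm. *)
Let u_bound x : `|u x| <= eps.
Proof.
have := conv_le mgam gamG gam_even igam mp p_bound (mA 1%N) (Afin 1%N) p_out x.
move=> /le_trans; apply; rewrite ler_piMr// -gam1 le_eqVlt; apply/orP; left; apply/eqP.
by apply: eq_Rintegral => y _; rewrite ger0_norm.
Qed.

(** Both factors are at most eps, and this quadratic smallness will absorb the factor 1 + 1/d when d
    is of the order of eps. *)
Let p_energy : \int[mu]_x (p x * u x) <= eps ^+ 2 * v 1%N.
Proof.
have -> : eps ^+ 2 * v 1%N = \int[mu]_x (eps ^+ 2 * \1_(A 1%N) x).
  by rewrite RintegralZl// Rintegral_indic.
apply: le_Rintegral => //.
- exact: (integrable_weighted_conv mgam gamG mp p_bound (mA 1%N) (Afin 1%N) p_out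
    mp p_bound (mA 1%N) (Afin 1%N) p_out).
- exact: integrable_scale.
move=> x _; rewrite indicE; have [Ax|nAx] := pselect (A 1%N x); last first.
  by rewrite p_out// mul0r memNset// mulr0.
by rewrite mem_set// mulr1 (le_trans (ler_norm _))// normrM expr2 ler_pM.
Qed.

(** Associativity of convolution. The shift of y by t rewrites [phi (x - y)] as
    [phi ((x + t) - (y + t))], after which the integral over y is [q (x + t)]. *)
Let h_eq x : mu.-integrable setT (EFin \o (fun t => gam t * q (x + t))) /\
  h x = \int[mu]_t (gam t * q (x + t)).
Proof.
pose F (r : E * E) := phi (x - r.1) * (gam r.2 * th (r.1 + r.2)).
have mF : measurable_fun [set: E * E] F.
  apply: measurable_funM mgt.
  have m1 : measurable_fun [set: E] (fun y => phi (x - y)).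
    by have := measurableT_comp (measurable_conv_kernel mphi) (pair1_measurable x).
  have m2 : measurable_fun [set: E * E] (fst : E * E -> E) := measurable_fst.
  by have := measurableT_comp m1 m2.
have FB r : `|F r| <= B * G by rewrite /F normrM ler_pM.
have F0 r : ~ (A 3%N r.1 /\ ball_T r.2) -> F r = 0.
  by move=> nr; rewrite /F gt_out// mulr0.
have [_ i2 E1] := Fubini_bounded (mA 3%N) mball (Afin 3%N) ballfin mF FB F0.
have E2 t : \int[mu]_y F (y, t) = gam t * q (x + t).
  clear E1.
  transitivity (\int[mu]_y (gam t * (th (y + t) * phi ((x + t) - (y + t))))).
    apply: eq_Rintegral => y _; rewrite /F /= opprD addrACA subrr addr0.
    by rewrite mulrC mulrA.
  have iq := integrable_conv mphi phiB mth thM (mA 2%N) (Afin 2%N) th_out (x + t).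
  rewrite RintegralZl//; last exact: (integrable_shift t iq).
  by rewrite (Rintegral_shift t iq).
split; first by move: i2; congr (mu.-integrable setT _); apply/funext => t /=; rewrite E2.
transitivity (\int[mu]_y \int[mu]_t F (y, t)).
  clear E1 E2; apply: eq_Rintegral => y _; rewrite /F /= RintegralZl//.
  by rewrite mulrC.
by rewrite E1; apply: eq_Rintegral => t _; exact: E2.
Qed.

Let h_add_u x : A 0%N x -> h x + u x = 1.
Proof.
move=> Ax.
have ux : u x = \int[mu]_t (gam t - gam t * q (x + t)).
  transitivity (\int[mu]_t (p (t + x) * gam (x - (t + x)))).
    by rewrite (@Rintegral_shift _ _ x (fun y => p y * gam (x - y)))//;
      exact: (integrable_conv mgam gamG mp p_bound (mA 1%N) (Afin 1%N) p_out x).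
  apply: eq_Rintegral => t _.
  have [bt|nb] := pselect (ball_T t); last first.
    by rewrite opprD addrCA subrr addr0 gam_even gam_out// mulr0 mul0r subrr.
  rewrite opprD addrCA subrr addr0 gam_even p_in; last first.
    by apply: (AS Ax); rewrite addrK.
  by rewrite mulrBl mul1r mulrC [t + x]addrC.
have [igq ->] := h_eq x.
rewrite ux RintegralB// addrC subrK.
exact: gam1.
Qed.

(** As 1 = h + u on [A 0], the sum of the weights splits as a + b. Cauchy-Schwarz bounds the square
    of a by the form of phi times the energy of chi, and the square of b by the form of gam times
    the energy of p. The parameter d distributes the mixed term 2ab. *)
Lemma one_le_two_kernels (d : R) (s : seq (R * E)) : 0 < d ->
  (forall r, r \in s -> A 0%N r.2) ->
  (\sum_(r <- s) r.1) ^+ 2 <=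
  (1 + d) * ((1 + eps) * v 0%N + L * (v 3%N - v 0%N)) *
     (\sum_(r <- s) \sum_(r' <- s) r.1 * r'.1 * phi (r.2 - r'.2)) +
  (1 + d^-1) * (eps ^+ 2 * v 1%N) *
     (\sum_(r <- s) \sum_(r' <- s) r.1 * r'.1 * gam (r.2 - r'.2)).
Proof.
move=> d0 sA.
have c1 := conv_Cauchy_Schwarz mphi phiB mchi chiM (mA 3%N) (Afin 3%N) chi_out s
  (vol_A_neq0 3%N) pphi.
have c2 := conv_Cauchy_Schwarz mgam gamG mp p_bound (mA 1%N) (Afin 1%N) p_out s
  (vol_A_neq0 1%N) pgam.
have -> : \sum_(r <- s) r.1 = \sum_(r <- s) r.1 * h r.2 + \sum_(r <- s) r.1 * u r.2.
  rewrite -big_split; apply: eq_big_seq => r rs /=.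
  by rewrite -mulrDr h_add_u ?mulr1//; exact: sA.
move: c1 c2; rewrite -/(h _) -/(u _).
set a := \sum_(r <- s) r.1 * h r.2; set b := \sum_(r <- s) r.1 * u r.2.
set Sp := (X in _ <= X * _ -> _); set Sg := (X in _ -> _ <= X * _ -> _) => c1 c2.
have Sp0 : 0 <= Sp by exact: (positive_definite_seq pphi (fun _ _ => I)).
have Sg0 : 0 <= Sg by exact: (positive_definite_seq pgam (fun _ _ => I)).
have a2 : a ^+ 2 <= ((1 + eps) * v 0%N + L * (v 3%N - v 0%N)) * Sp.
  by rewrite mulrC; apply: le_trans c1 _; rewrite ler_wpM2l//; exact: chi_energy.
have b2 : b ^+ 2 <= (eps ^+ 2 * v 1%N) * Sg.
  by rewrite mulrC; apply: le_trans c2 _; rewrite ler_wpM2l//; exact: p_energy.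
have ab : (a + b) ^+ 2 <= (1 + d) * a ^+ 2 + (1 + d^-1) * b ^+ 2.
  rewrite -subr_ge0.
  have -> : (1 + d) * a ^+ 2 + (1 + d^-1) * b ^+ 2 - (a + b) ^+ 2 = d^-1 * (d * a - b) ^+ 2.
    by field; rewrite gt_eqF.
  by rewrite mulr_ge0 ?sqr_ge0// invr_ge0 ltW.
apply: le_trans ab _; apply: lerD; rewrite -[leRHS]mulrA; apply: ler_wpM2l => //.
  by rewrite addr_ge0// ltW.
by rewrite addr_ge0// invr_ge0 ltW.
Qed.

End two_kernels.

(** * Stationary positive definite kernels *)

Section stationary_kernels.
Context {R : realType} {n : nat}.
Local Notation E := 'rV[R]_n.
Local Notation mu := (lebesgue_rV R n).
Variable F : E -> E -> R.
Hypothesis F_shift : forall x y z, F x y = F (x + z) (y + z).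
Hypothesis pF : positive_definite setT F.
Hypothesis cF : metric_kernel setT 0 (fun x y _ => F x y).

Lemma stationaryE x y : F x y = F (x - y) 0.
Proof. by rewrite (F_shift x y (- y)) subrr. Qed.

Lemma stationary_even x : F (- x) 0 = F x 0.
Proof. by rewrite (F_shift (- x) 0 x) addNr add0r pF.1. Qed.

Lemma stationary_positive_definite : positive_definite setT (fun x y => F (x - y) 0).
Proof.
rewrite (_ : (fun x y => F (x - y) 0) = F)//.
by apply/funext => x; apply/funext => y; rewrite -stationaryE.
Qed.

(** The form at the points x and 0 with weights 1 and c, for c = 1 and c = -1. *)
Lemma stationary_bounded x : `|F x 0| <= F 0 0.
Proof.
have h (c : R) : c ^+ 2 = 1 -> 0 <= F 0 0 + c * F x 0.
  move=> c1; have := @positive_definite_seq _ _ setT F [:: (1, x); (c, 0)] pF (fun _ _ => Logic.I).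
  rewrite !big_cons !big_nil /= !mul1r !mulr1 !addr0.
  rewrite -expr2 c1 mul1r (pF.1 0 x)// (stationaryE x x) subrr.
  by move=> h; rewrite -(pmulr_rge0 _ (ltr0n R 2)); apply: le_trans h _;
    rewrite le_eqVlt; apply/orP; left; apply/eqP; ring.
rewrite ler_norml; apply/andP; split.
  by rewrite -subr_ge0 opprK addrC -(mul1r (F x 0)); apply: h; rewrite expr1n.
by rewrite -subr_ge0 -(mulN1r (F x 0)); apply: h; rewrite sqrrN expr1n.
Qed.

Lemma stationary_measurable : measurable_fun setT (fun x => F x 0).
Proof.
have c : continuous_on_pairs [set: E * E] (fun p => F p.1 0).
  move=> [x y] _ e e0.
  have [d d0 hd] := cF (I : setT x) (I : setT 0) (indep0 setT 0) e0.
  exists d => // -[x' y'] _ h1 _; apply: (hd x' 0 fset0) => //.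
  by rewrite subrr normr0.
have := measurable_fun_continuous_on measurableT c.
by rewrite patch_setT => /measurableT_comp /(_ measurable_diag).
Qed.

End stationary_kernels.

(** * A positive definite kernel of short range *)

Section bump.
Context {R : realType} {n : nat}.
Local Notation E := 'rV[R]_n.
Local Notation mu := (lebesgue_rV R n).

Definition small_cube : set E := box (0, const_mx n.+1%:R^-1).

Lemma small_cube_norm x y : small_cube x -> small_cube y -> `|x - y| <= n.+1%:R^-1.
Proof.
move=> hx hy; apply/ler_addgt0Pr => e e0; apply/ltW/rV_normP.
  by rewrite ltr_wpDl.
move=> i; rewrite (@le_lt_trans _ _ n.+1%:R^-1)// ?ltrDl//.
have := hx i; have := hy i; rewrite !mxE => /andP[h1 h2] /andP[h3 h4].
rewrite ler_norml; apply/andP; split.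
  by rewrite lerNl opprB lerBlDr (le_trans h2)// lerDl.
by rewrite lerBlDr (le_trans h4)// lerDl.
Qed.

Lemma small_cube0 : small_cube 0.
Proof. by move=> i; rewrite !mxE lexx /= invr_ge0. Qed.

Lemma small_cube_compact : compact small_cube.
Proof.
apply: bounded_closed_compact; last exact: closed_box.
exists n.+1%:R^-1; split; first exact: num_real.
move=> M hM x Qx; apply: ltW; apply: le_lt_trans hM.
by have := small_cube_norm Qx small_cube0; rewrite subr0.
Qed.

Lemma small_cube_vol : vol small_cube != 0%E.
Proof.
rewrite vol_box eqe; apply/prodf_neq0 => i _.
by rewrite !mxE subr0 max_r ?invr_ge0// invr_neq0// pnatr_eq0.
Qed.

Lemma small_cube_boundary : vol (small_cube `\` small_cube°) = 0%E.
Proof.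
apply/negligibleP; last exact: box_boundary_negligible.
by apply: measurable_boundary; exact: measurable_box.
Qed.

(** The normalized autocorrelation of the indicator function of a cube, obtained by averaging the
    constant kernel 1, so that continuity, invariance and positive definiteness are already known.
    The side 1/(n+1) is below the scale 2/(n+1), hence distinct points at which g does not vanish
    are adjacent. *)
Lemma bump_kernel : exists g : E -> E -> R,
  [/\ forall k, metric_kernel setT k (fun x y _ => g x y),
      forall x y z, g x y = g (x + z) (y + z),
      positive_definite setT g,
      forall x y, 0 <= g x y &
      forall x y, n.+1%:R^-1 < `|x - y| -> g x y = 0] /\
  mu.-integrable setT (EFin \o (fun x => g x 0)) /\ \int[mu]_x g x 0 = 1.
Proof.
pose Q := small_cube; pose K0 (x y : E) (J : {fset E}) : R := 1.
have cQ := small_cube_compact; have nQ := small_cube_boundary.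
have cK : metric_kernel Q 0 K0 by exact: metric_kernel_cst.
pose g0 x y := average_kernel Q K0 x y fset0.
pose c := \int[mu]_x g0 x 0.
have g0_ge0 x y : 0 <= g0 x y.
  by apply: Rintegral_ge0 => z _; rewrite /restrict_kernel; case: asboolP => //; rewrite ler01.
have c0 : 0 < c.
  apply: (@lt_le_trans _ _ (fine (vol Q) ^+ 2)).
    rewrite exprn_gt0// fine_gt0// (compact_vol_lty cQ) andbT lt0e small_cube_vol.
    exact: measure_ge0.
  rewrite /c (integral_average_kernel cQ cK).2 -(Fubini_restrict_kernel cQ cK).2.2.
  (* With the zero kernel plus 1, the lower bound by the squared volume applies to the constant
     kernel. *)
  have h := @integral_restrict_kernel_add1 R n Q 0 (fun _ _ _ => 0) cQ small_cube_vol
    (@metric_kernel_cst R n Q 0 0) (@positive_definite_cst R n Q 0 (lexx 0)).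
  apply: le_trans h _; rewrite le_eqVlt; apply/orP; left; apply/eqP.
  apply: eq_Rintegral => x _; apply: eq_Rintegral => y _.
  by rewrite /restrict_kernel eqxx add0r mul1r.
have ic : 0 <= c^-1 by rewrite invr_ge0 ltW.
exists (fun x y => c^-1 * g0 x y); split; [split|split].
- move=> k; apply: metric_kernel_scale.
  move=> x y J _ _ _ e e0.
  have [d d0 hd] := metric_average_kernel cQ nQ cK (I : setT x) (I : setT y) (indep0 setT 0) e0.
  by exists d => // x' y' J' _ _ _ h1 h2 _; apply: hd.
- move=> x y z; congr (_ * _).
  by rewrite /g0 (average_kernel_shift cQ cK x y z (indep0 setT 0)) translate0.
- apply: positive_definite_scale => //.
  apply: (average_kernel_positive_definite cQ cK (indep0 setT 0)) => J _.
  by apply: positive_definite_cst; exact: ler01.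
- by move=> x y; rewrite mulr_ge0.
- move=> x y xy; rewrite (_ : g0 x y = 0) ?mulr0//.
  transitivity (\int[mu]_(z in [set: E]) (0 : R)); last by rewrite Rintegral_cst// mul0r.
  apply: eq_Rintegral => z _; rewrite restrict_kernel_out// => -[Qx Qy _].
  have := small_cube_norm Qx Qy; rewrite opprD addrACA subrr addr0.
  by rewrite leNgt xy.
- apply: integrable_scale; exact: (integral_average_kernel cQ cK).1.
- rewrite RintegralZl//; last exact: (integral_average_kernel cQ cK).1.
  by rewrite -/c mulVf// gt_eqF.
Qed.

End bump.

(** * Neighborhoods of compact sets and tails of integrals *)

Section neighborhoods.
Context {R : realType} {n : nat}.
Local Notation E := 'rV[R]_n.
Local Notation mu := (lebesgue_rV R n).

Definition nbhd_set (s : R) (C : set E) : set E := [set x | exists2 c, C c & `|x - c| < s].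

Lemma measurable_nbhd_set s C : measurable (nbhd_set s C).
Proof.
apply: open_rV_measurable; rewrite openE => x [c Cc xc].
apply/nbhs_ballP; exists (s - `|x - c|); first by rewrite /= subr_gt0.
move=> y; rewrite -ball_normE /= => xy; exists c => //.
rewrite -(subrKA x) (le_lt_trans (ler_normD _ _))//.
by rewrite -ltrBrDr distrC.
Qed.

Lemma nbhd_set_le s s' C : s <= s' -> nbhd_set s C `<=` nbhd_set s' C.
Proof. by move=> ss x [c Cc xc]; exists c => //; exact: lt_le_trans ss. Qed.

Lemma nbhd_set_vol_lty s C : compact C -> (vol (nbhd_set s C) < +oo)%E.
Proof.
move=> cC; have [B B0 hB] := compact_norm_bound cC.
apply: (@vol_bounded_lty _ _ _ (s + B)); first exact: measurable_nbhd_set.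
move=> x [c Cc xc]; rewrite -(subrK c x) (le_trans (ler_normD _ _))//.
by rewrite lerD ?hB// ltW.
Qed.

(** A collar of fixed width s around rC is the dilate of a collar of width s/r around C, so its
    relative volume vanishes as r grows. *)
Lemma nbhd_set_dilate s r C : 0 < r -> nbhd_set s (dilate r C) = dilate r (nbhd_set (s / r) C).
Proof.
move=> r0; apply/seteqP; split => [x [_ [c Cc <-] xc]|_ [x [c Cc xc] <-]].
  exists (r^-1 *: x); last by rewrite scalerA divff ?gt_eqF// scale1r.
  exists c => //; rewrite -(scale1r c) -(mulVf (lt0r_neq0 r0)) -scalerA -scalerBr normrZ.
  by rewrite gtr0_norm ?invr_gt0// mulrC ltr_pM2r ?invr_gt0.
exists (r *: c); first by exists c.
by rewrite -scalerBr normrZ gtr0_norm// mulrC -ltr_pdivlMr.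
Qed.

(** The neighborhoods of radius 1/(m+1) decrease to C, which is closed; continuity from above of the
    measure concludes. *)
Lemma nbhd_set_shrink C e : compact C -> 0 < e ->
  exists2 s : R, 0 < s & fine (vol (nbhd_set s C)) <= fine (vol C) + e.
Proof.
move=> cC e0; have mC : measurable C by exact: compact_rV_measurable.
have clC : closed C by apply: compact_closed => //; exact: norm_hausdorff.
pose N m := nbhd_set m.+1%:R^-1 C.
have IN : \bigcap_m N m = C.
  apply/seteqP; split => x; last first.
    by move=> Cx m _; exists x => //; rewrite subrr normr0 invr_gt0.
  move=> Nx; apply: contrapT => nCx.
  have /nbhs_ballP[d d0 hd] : nbhs x (~` C).
    by apply: open_nbhs_nbhs; split => //; exact: closed_openC.
  have /ltr_add_invr[m] := d0; rewrite add0r => hm.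
  have [c Cc xc] := Nx m Logic.I.
  by apply: (hd c) => //; rewrite -ball_normE /=; exact: lt_trans hm.
have cv : mu \o N @ \oo --> vol C.
  rewrite -IN; apply: nonincreasing_cvg_mu.
  - exact: nbhd_set_vol_lty.
  - by move=> m; exact: measurable_nbhd_set.
  - by rewrite IN.
  - move=> m m' mm; apply/subsetPset; apply: nbhd_set_le.
    by rewrite lef_pV2 ?posrE ?ltr0n// ler_nat ltnS.
have Cfin := compact_vol_lty cC.
have fC : vol C \is a fin_num by rewrite ge0_fin_numE// measure_ge0.
have cv' : mu (N m) @[m --> \oo] --> (fine (vol C))%:E by rewrite fineK.
have cv2 : fine (mu (N m)) @[m --> \oo] --> fine (vol C) by exact: fine_cvg cv'.
have /cvgrPdist_le /(_ e e0)[m _ /(_ m (leqnn m)) /= h] := cv2.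
exists m.+1%:R^-1; first by rewrite invr_gt0.
by move: h; rewrite distrC ler_distl => /andP[].
Qed.

(** Dominated convergence, with |phi| as majorant. The bound 1 <= T lets the same T serve as a range
    for the bump kernel. *)
Lemma integrable_tail (phi : E -> R) e : mu.-integrable setT (EFin \o phi) -> 0 < e ->
  exists2 T : R, 1 <= T & \int[mu]_y (`|phi y| * \1_[set y | T < `|y|] y) <= e.
Proof.
move=> iphi e0; have mphi : measurable_fun setT phi.
  by have /measurable_int/measurable_EFinP := iphi.
have mT (T : R) : measurable [set y : E | T < `|y|].
  apply: open_rV_measurable; rewrite (_ : mkset _ = Num.norm @^-1` `]T, +oo[%classic).
    by apply: open_comp; [move=> z _; exact: norm_continuous|exact: interval_open].
  by apply/seteqP; split => z /=; rewrite in_itv/= andbT.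
pose f m y := `|phi y| * \1_[set y | (m.+1%:R : R) < `|y|] y.
have [] := @dominated_convergence _ _ _ mu setT measurableT
  (fun m => EFin \o f m) (EFin \o cst 0) (fun y => `|(phi y)%:E|%E).
- move=> m; apply/measurable_EFinP; apply: measurable_funM; last exact: measurable_indic.
  exact: measurableT_comp.
- by apply/measurable_EFinP; exact: measurable_cst.
- apply: aeW => y _; apply: cvg_EFin; first exact: nearW.
  apply: cvg_near_cst.
  exists (Num.bound `|y|) => // m /= hm; rewrite /f indicE memNset ?mulr0//= => h.
  have := archi_boundP (normr_ge0 y) => h2.
  have : m.+1%:R < (Num.bound `|y|)%:R :> R by exact: lt_trans h2.
  by rewrite ltr_nat ltnNge => /negP; apply; exact: leqW.
- exact: integrable_abse.
- apply: aeW => y m _; rewrite /= lee_fin normrM normr_id ler_piMr// indicE.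
  by case: (_ \in _); rewrite ?normr1// normr0.
move=> _ _ cv.
have : \int[mu]_y f m y @[m --> \oo] --> 0.
  have : (\int[mu]_y (EFin \o cst (0 : R)%R) y)%E = 0%E by rewrite integral0_eq.
  by move=> h0; move: cv; rewrite h0 => cv; apply: fine_cvg.
move=> /cvgrPdist_le /(_ e e0)[m _ /(_ m (leqnn m))] /= h.
exists m.+1%:R; first by rewrite ler1n.
by move: h; rewrite sub0r normrN => /(le_trans (ler_norm _)).
Qed.

End neighborhoods.

Section dilation.
Context {R : realType} {n : nat}.
Local Notation E := 'rV[R]_n.
Implicit Type C : set E.

Lemma compact_dilate r C : compact C -> compact (dilate r C).
Proof.
move=> cC; apply: continuous_compact => //.
by apply: continuous_subspaceT => x; exact: scaler_continuous.
Qed.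

Lemma dilate_boundary_null r C : 0 < r -> compact C -> vol (C `\` C°) = 0%E ->
  vol (dilate r C `\` (dilate r C)°) = 0%E.
Proof.
move=> r0 cC nC; have mC := compact_rV_measurable cC.
have mB : measurable (C `\` C°).
  by apply: measurableD => //; apply: open_rV_measurable; exact: open_interior.
have sub : dilate r C `\` (dilate r C)° `<=` dilate r (C `\` C°).
  move=> _ [[x Cx <-] nx]; exists x => //; split => // Cox; apply: nx.
  have : nbhs (r *: x) (dilate r C°).
    rewrite dilateE//; apply: open_nbhs_nbhs; split; last first.
      by rewrite /= addr0 scalerA mulVf ?gt_eqF// scale1r.
    apply: open_comp; last exact: open_interior.
    by move=> y _; apply: continuousD; [exact: scaler_continuous|exact: cst_continuous].
  apply: filterS => _ [y Cy <-]; exists y => //; exact: interior_subset.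
apply: (@subset_measure0 _ _ _ (lebesgue_rV R n) _ _ _ _ sub).
- apply: measurableD; first by exact: measurable_dilate.
  by apply: open_rV_measurable; exact: open_interior.
- exact: measurable_dilate.
- by rewrite -[LHS]/(vol _) vol_dilate// nC mule0.
Qed.

Lemma fine_vol_dilate r (A : set E) : 0 < r -> measurable A -> (vol A < +oo)%E ->
  fine (vol (dilate r A)) = r ^+ n * fine (vol A).
Proof.
move=> r0 mA Afin; rewrite vol_dilate// fineM// ge0_fin_numE//.
Qed.

Lemma vol_dilate_neq0 r (A : set E) : 0 < r -> measurable A -> vol A != 0%E ->
  vol (dilate r A) != 0%E.
Proof.
by move=> r0 mA A0; rewrite vol_dilate// mule_neq0// eqe expf_neq0// gt_eqF.
Qed.

End dilation.

(** * From a packing kernel to a kernel on a large dilate *)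

Section lower_bound.
Context {R : realType} {n : nat}.
Local Notation E := 'rV[R]_n.
Local Notation mu := (lebesgue_rV R n).

Lemma metric_kernelS (V V' : set E) k (K : E -> E -> {fset E} -> R) : V `<=` V' ->
  metric_kernel V' k K -> metric_kernel V k K.
Proof.
move=> VV cK x y J Vx Vy iJ e e0.
have [d d0 h] := cK x y J (VV _ Vx) (VV _ Vy) (indepS VV iJ) e e0.
exists d => // x' y' J' Vx' Vy' iJ'; apply: h; [exact: VV|exact: VV|exact: indepS iJ'].
Qed.

Lemma positive_definiteS (V V' : set E) (K : E -> E -> R) : V `<=` V' ->
  positive_definite V' K -> positive_definite V K.
Proof.
move=> VV [sK pK]; split=> [x y Vx Vy|G c GV]; first by apply: sK; exact: VV.
by apply: pK; exact: subset_trans VV.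
Qed.

Lemma indep1 (V : set E) k x : (1 <= k)%N -> V x -> indep V k [fset x]%fset.
Proof.
move=> k1 Vx; split.
- by move=> y /=; rewrite inE => /eqP ->.
- by rewrite cardfs1.
move=> a b; rewrite !inE => /eqP -> /eqP ->.
by rewrite /edge subrr (eqP (_ : enorm 0 == 0)) ?ltxx// enorm_eq0.
Qed.

Lemma Bop1_shift k (f : E -> E -> {fset E} -> R) x : (2 <= k)%N ->
  (forall x y z J, indep setT (k - 2) J -> f x y J = f (x + z) (y + z) (translate z J)) ->
  Bop k f [fset x]%fset = Bop k f [fset (0 : E)]%fset.
Proof.
move=> k2 f_shift; rewrite -[in LHS](add0r x) -translate1 Bop_translate.
apply: eq_Bop => a b J _ _ J0 cJ; rewrite -f_shift//.
by apply: indep_sub J0 cJ (@indep1 setT k 0 _ I); exact: leq_trans k2.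
Qed.

Lemma Bop1_feasible_ge0 k (f : E -> E -> {fset E} -> R) x : (2 <= k)%N ->
  packing_feasible k f -> 0 <= Bop k f [fset x]%fset.
Proof.
move=> k2 [_ _ pf _ _]; apply: Bop1_ge0 => J Jx cJ.
apply: (positive_definite_diag (pf J _) (x := x)) => //.
by apply: indep_sub Jx cJ (@indep1 setT k x _ I); exact: leq_trans k2.
Qed.

Lemma packing_to_Delta k (f : E -> E -> {fset E} -> R) (C : set E) eta : (2 <= k)%N ->
  packing_feasible k f -> compact C -> vol C != 0%E -> 0 < eta ->
  exists2 r0 : R, 0 < r0 & forall r, r0 <= r -> exists K M,
    Delta_feasible k (dilate r C) K M /\
    M <= fine (vol (dilate r C)) * (Bop k f [fset (0 : E)]%fset + eta).
Proof.
move=> k2 ff cC C0 eta0; have b0 := Bop1_feasible_ge0 0 k2 ff.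
have [/continuous_kernelP cf f_shift pf Bf [if1 f1]] := ff.
set b := Bop k f _ in b0 *.
have [g [[cg g_shift pg g_ge0 g_out] [ig g1]]] := @bump_kernel R n.
have mC := compact_rV_measurable cC; have Cfin := compact_vol_lty cC.
have V0 : 0 < fine (vol C) by rewrite fine_gt0// Cfin andbT lt0e C0 measure_ge0.
pose F x y := f x y fset0.
have F_shift x y z : F x y = F (x + z) (y + z).
  by rewrite /F (f_shift x y z) ?translate0//; exact: indep0.
have pF : positive_definite setT F by apply: pf; exact: indep0.
have cF : metric_kernel setT 0 (fun x y _ => F x y).
  move=> x y J _ _ _ e e0.
  have [d d0 h] := cf x y fset0 Logic.I Logic.I (indep0 _ _) e e0.
  exists d => // x' y' J' _ _ _ xx yy _; apply: h => //; exact: indep0.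
pose phi x := F x 0; pose gam x := g x 0.
pose L := \int[mu]_y `|phi y|.
have L0 : 0 <= L by apply: Rintegral_ge0 => y _; exact: normr_ge0.
have phi1 : \int[mu]_x phi x = 1 by rewrite /Rintegral f1.
(* The coefficients of e in the estimates [l1_le] and [l2_le] below, multiplied by b and g(0, 0);
   the last 1 makes D positive. *)
pose D := (3 + 2 * L) * b + 4 * g 0 0 + 1.
have D0 : 0 < D by rewrite ltr_pwDr// addr_ge0// mulr_ge0// addr_ge0// mulr_ge0.
pose e := Num.min 1 (eta / D).
have e0 : 0 < e by rewrite lt_min ltr01 divr_gt0.
have e1 : e <= 1 by rewrite ge_min lexx.
have eD : e * D <= eta by rewrite -ler_pdivlMr// ge_min lexx orbT.
have [T T1 tail] := integrable_tail if1 e0.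
have T0 : 0 < T by exact: lt_le_trans T1.
have [s0 s00 hs] := nbhd_set_shrink cC (mulr_gt0 e0 V0).
(* [A 3] below is the collar of width 6T around rC, that is, of width 6T/r at the scale of C; this
   is at most s0. *)
exists (6 * T / s0) => [|r hr]; first by rewrite divr_gt0// mulr_gt0.
have r0 : 0 < r by apply: lt_le_trans hr; rewrite divr_gt0// mulr_gt0.
have cD := compact_dilate (r := r) cC.
(* The open neighborhood of radius 0 is empty, so rC itself starts the chain. Steps of 2T instead of
   T absorb the difference between the closed condition on [y - x] and the open neighborhoods. *)
pose A i := if i is 0%N then dilate r C else nbhd_set ((2 * i)%:R * T) (dilate r C).
have mD : measurable (dilate r C) by exact: compact_rV_measurable.
have mA i : measurable (A i).
  by case: i => //= i; exact: measurable_nbhd_set.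
have Afin i : (vol (A i) < +oo)%E.
  by case: i => [|i]; [exact: compact_vol_lty|exact: nbhd_set_vol_lty].
have A0 : vol (A 0%N) != 0%E by exact: vol_dilate_neq0.
have AS i x y : A i x -> `|y - x| <= T -> A i.+1 y.
  case: i => [Dx yx|i [c Dc xc] yx].
    by exists x => //; apply: le_lt_trans yx _; rewrite ltr_pMl// ltr1n.
  exists c => //; rewrite -(subrKA x); apply: (le_lt_trans (ler_normD _ _)).
  apply: lt_le_trans (ler_ltD yx xc) _.
  have -> : (2 * i.+2)%:R = 2 + (2 * i.+1)%:R :> R by rewrite -natrD -mulnS.
  by rewrite mulrDl lerD2r ler_peMl ?ler1n// ltW.
have gamT x : T < `|x| -> gam x = 0.
  move=> Tx; apply: g_out; rewrite subr0; apply: le_lt_trans Tx.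
  by apply: le_trans T1; rewrite invf_le1 ?ltr0n// ler1n.
pose v i := fine (vol (A i)).
pose W := v 0%N.
have WE : W = r ^+ n * fine (vol C) by rewrite /W /v fine_vol_dilate.
have W0 : 0 < W by rewrite WE mulr_gt0// exprn_gt0.
have v_le i j : A i `<=` A j -> v i <= v j.
  move=> ij; apply: fine_le; last by apply: le_measure => //; rewrite inE; exact: mA.
  - by rewrite ge0_fin_numE// measure_ge0.
  - by rewrite ge0_fin_numE// measure_ge0.
have A03 : A 0%N `<=` A 3%N.
  by move=> x Dx; exists x => //; rewrite subrr normr0 mulr_gt0.
have A13 : A 1%N `<=` A 3%N.
  by apply: nbhd_set_le; rewrite ler_pM2r// ler_nat.
have v3 : v 3%N <= (1 + e) * W.
  rewrite /v /A nbhd_set_dilate// fine_vol_dilate ?nbhd_set_vol_lty//; last first.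
    exact: measurable_nbhd_set.
  rewrite WE mulrCA ler_wpM2l ?exprn_ge0 ?(ltW r0)//.
  have -> : (1 + e) * fine (vol C) = fine (vol C) + e * fine (vol C) by rewrite mulrDl mul1r.
  apply: le_trans hs; apply: fine_le.
  - by rewrite ge0_fin_numE ?nbhd_set_vol_lty// measure_ge0.
  - by rewrite ge0_fin_numE ?nbhd_set_vol_lty// measure_ge0.
  apply: le_measure; rewrite ?inE; [exact: measurable_nbhd_set|exact: measurable_nbhd_set|].
  apply: nbhd_set_le; rewrite ler_pdivrMr// -ler_pdivrMl// mulrC.
  exact: hr.
have v03 := v_le _ _ A03; have v13 := v_le _ _ A13.
have v1_ge0 : 0 <= v 1%N by rewrite fine_ge0// measure_ge0.
(* The coefficients in [one_le_two_kernels] with both [d] and [eps] equal to e. *)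
pose l1 := (1 + e) * ((1 + e) * W + L * (v 3%N - W)).
pose l2 := (1 + e^-1) * (e ^+ 2 * v 1%N).
have l1_ge0 : 0 <= l1.
  rewrite mulr_ge0 ?addr_ge0 ?(ltW e0)// mulr_ge0 ?subr_ge0//.
    by rewrite addr_ge0// ltW.
  exact: ltW.
have l2_ge0 : 0 <= l2.
  by rewrite mulr_ge0 ?addr_ge0 ?invr_ge0 ?(ltW e0)// mulr_ge0// sqr_ge0.
pose h x y : R := l2 * g x y - 1.
pose K x y J := l1 * f x y J + (J == fset0)%:R * h x y.
have gg x : g x x = g 0 0 by rewrite -{1 2}(add0r x) -g_shift.
have key := one_le_two_kernels (stationary_measurable cF)
  (stationary_bounded F_shift pF) (stationary_even F_shift pF) if1 phi1
  (stationary_positive_definite F_shift pF) (stationary_measurable (cg 0%N))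
  (stationary_bounded g_shift pg) (stationary_even g_shift pg) ig g1
  (stationary_positive_definite g_shift pg) (fun x => g_ge0 x 0) mA Afin A0 AS gamT
  (ltW T0) tail e0.
(* By invariance of f and g, B_k K takes the same value at all singletons; M is that value plus
   1. *)
exists K; exists (l1 * b + l2 * g 0 0); split.
  split.
  - apply/continuous_kernelP; apply: (metric_kernelS (@subsetT _ _)).
    have -> : K = fun x y J => l1 * f x y J + (J == fset0)%:R * (fun x y => l2 * g x y) x y +
        (J == fset0)%:R * (fun _ _ => - 1) x y.
      by apply/funext => x; apply/funext => y; apply/funext => J; rewrite /K mulrDr addrA.
    apply: metric_kernel_add_empty; last exact: metric_kernel_cst.
    by apply: metric_kernel_add_empty; apply: metric_kernel_scale => //; exact: cg.
  - move=> J iJ; rewrite /K; have [->|J0] := eqVneq J fset0; last first.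
      have -> : (fun x y => l1 * f x y J + false%:R * h x y) = fun x y => l1 * f x y J.
        by apply/funext => x; apply/funext => y; rewrite mul0r addr0.
      apply: positive_definite_scale => //; apply: (positive_definiteS (@subsetT _ _)).
      by apply: pf; exact: indepS iJ.
    split=> [x y _ _|G c GD]; first by rewrite /h pg.1// -![f _ _ fset0]/(F _ _) pF.1.
    pose s := [seq (c x, x) | x <- G].
    have sE (q : E -> E -> R) (q' : E -> R) : (forall x y, q x y = q' (x - y)) ->
        \sum_(r <- s) \sum_(r' <- s) r.1 * r'.1 * q' (r.2 - r'.2) =
        \sum_(x <- G) \sum_(y <- G) c x * c y * q x y.
      move=> qE; rewrite big_map; apply: eq_bigr => x _; rewrite big_map.
      by apply: eq_bigr => y _; rewrite qE.
    have sA a : a \in s -> A 0%N a.2 by move=> /mapP[x xG ->]; exact: GD.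
    have := key s sA; rewrite (sE _ (F^~ 0) (stationaryE F_shift)).
    rewrite (sE _ (g^~ 0) (stationaryE g_shift)) big_map /= -/L -!/(v _) -/W -/l1 -/l2 -subr_ge0.
    rewrite expr2 big_distrlr /= !mulr_sumr -big_split -sumrB /=.
    congr (_ <= _); apply: eq_bigr => x _; rewrite !mulr_sumr -big_split -sumrB /=.
    by apply: eq_bigr => y _; rewrite /h /F; ring.
  - move=> x Dx; rewrite BopD BopZ Bop_empty1 /h gg (Bop1_shift _ k2 f_shift) -/b.
    by rewrite addrA.
  - move=> x y xy [Vxy _ nexy].
    have ixy : indep setT k [fset x; y]%fset.
      by split => //; rewrite cardfs2 xy.
    have := Bf _ ixy; rewrite cardfs2 xy => /(_ isT) Bfxy.
    have gxy : g x y = 0.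
      apply: g_out; rewrite ltNge; apply/negP => xyn.
      have /negP := nexy x y (fset21 _ _) (fset22 _ _); apply; apply: edgeP => //.
      by apply: le_lt_trans xyn _; rewrite ltr_pMl ?invr_gt0// ltr1n.
    rewrite BopD BopZ Bop_empty2// /h (pg.1 y x)// gxy mulr0 sub0r.
    rewrite -[leRHS]add0r; apply: lerD; last by rewrite -opprD.
    by rewrite mulr_ge0_le0.
  - move=> S iS S3; rewrite BopD BopZ Bop_empty_ge3// addr0 mulr_ge0_le0//.
    by apply: Bf; [exact: indepS iS|exact: leq_trans S3].
have vW : v 3%N - W <= e * W by rewrite lerBlDr addrC -[X in X + _]mul1r -mulrDl.
have eW : 0 <= e * W by rewrite mulr_ge0// ltW.
(* Since e is at most 1, the quadratic terms in e are absorbed by linear ones; this is where 3 + 2L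
   comes from, and 4 in [l2_le]. *)
have l1_le : l1 <= W * (1 + e * (3 + 2 * L)).
  have : l1 <= (1 + e) * ((1 + e) * W + L * (e * W)).
    by rewrite ler_wpM2l ?addr_ge0 ?(ltW e0)// lerD2l ler_wpM2l.
  move=> /le_trans; apply; rewrite -subr_ge0.
  rewrite (_ : _ - _ = (e * W) * ((1 - e) * (1 + L))); last by ring.
  by rewrite mulr_ge0// mulr_ge0 ?subr_ge0// addr_ge0.
have l2_le : l2 <= W * (4 * e).
  have -> : l2 = (1 + e) * e * v 1%N by rewrite /l2; field; rewrite gt_eqF.
  have : (1 + e) * e * v 1%N <= (1 + e) * e * ((1 + e) * W).
    by rewrite ler_wpM2l ?mulr_ge0 ?addr_ge0 ?(ltW e0)//; exact: le_trans v3.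
  move=> /le_trans; apply; rewrite -subr_ge0.
  rewrite (_ : _ - _ = (e * W) * ((1 - e) * (3 + e))); last by ring.
  by rewrite mulr_ge0// mulr_ge0 ?subr_ge0// addr_ge0// ltW.
have : l1 * b + l2 * g 0 0 <= W * (1 + e * (3 + 2 * L)) * b + W * (4 * e) * g 0 0.
  by apply: lerD; rewrite ler_wpM2r.
move=> /le_trans; apply.
rewrite -[fine _]/W.
have -> : W * (1 + e * (3 + 2 * L)) * b + W * (4 * e) * g 0 0 = W * (b + e * (D - 1)).
  by rewrite /D; ring.
rewrite ler_pM2l// lerD2l; apply: le_trans eD; rewrite ler_pM2l//.
by rewrite gerBl.
Qed.

End lower_bound.

(** * The packing bound as a limit *)

Section packing_bound.
Context {R : realType} {n : nat}.
Local Notation E := 'rV[R]_n.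

(** Positivity holds because the ball contains the cube of side 1/(n+1), whose points have Euclidean
    norm at most n/(n+1). *)
Lemma unit_ball_vol : 0 < fine (vol (@unit_ball R n)) /\
  vol (@unit_ball R n) = (fine (vol (@unit_ball R n)))%:E.
Proof.
have mB : measurable (@unit_ball R n).
  apply: closed_rV_measurable.
  rewrite (_ : unit_ball = enorm @^-1` `]-oo, 1]%classic).
    by apply: preimage_closed; [move=> x _; exact: continuous_enorm|exact: interval_closed].
  by apply/seteqP; split => x /=; rewrite in_itv.
have Bfin : (vol (@unit_ball R n) < +oo)%E.
  apply: (@vol_bounded_lty _ _ _ 1) => // x /=.
  exact: le_trans (norm_le_enorm _).
have cube_ball : @small_cube R n `<=` unit_ball.
  move=> x Sx; apply: le_trans (enorm_le_norm x) _.
  rewrite -[x]subr0; apply: le_trans (ler_wpM2l (ler0n _ _) (small_cube_norm Sx small_cube0)) _.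
  by rewrite ler_pdivrMr ?ltr0n// mul1r ler_nat.
have B0 : (0 < vol (@unit_ball R n))%E.
  apply: lt_le_trans (_ : (vol (@small_cube R n) <= _)%E).
    by rewrite lt0e small_cube_vol measure_ge0.
  apply: le_measure => //; rewrite inE//.
  by apply: compact_rV_measurable; exact: small_cube_compact.
by split; [rewrite fine_gt0// B0|rewrite fineK// ge0_fin_numE// ltW].
Qed.

Lemma Delta_packing_ge0 k : (2 <= k)%N -> (0 <= Delta_packing R n k)%E.
Proof.
move=> k2; apply: le_ereal_inf_tmp => _ [f ff <-].
by rewrite unit_ball_vol.2 -EFinM lee_fin mulr_ge0 ?(ltW unit_ball_vol.1)// Bop1_feasible_ge0.
Qed.

Lemma vol_ratio (C : set E) : compact C -> vol C != 0%E ->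
  0 < fine (vol C) /\ (vol (@unit_ball R n) / vol C)%E =
    (fine (vol (@unit_ball R n)) / fine (vol C))%:E.
Proof.
move=> cC C0; have Cfin := compact_vol_lty cC.
have V0 : 0 < fine (vol C) by rewrite fine_gt0// Cfin andbT lt0e C0 measure_ge0.
split => //; rewrite {1}unit_ball_vol.2 -[vol C]fineK ?ge0_fin_numE ?measure_ge0//.
by rewrite inver gt_eqF.
Qed.

Lemma Delta_packing_le k (C : set E) : (2 <= k)%N -> compact C ->
  vol (C `\` C°) = 0%E -> vol C != 0%E ->
  (Delta_packing R n k <= vol (@unit_ball R n) / vol C * Delta k C)%E.
Proof.
move=> k2 cC nC C0; have [V0 ->] := vol_ratio cC C0.
have B0 := unit_ball_vol.1.
rewrite -lee_pdivrMl ?divr_gt0//; apply: le_ereal_inf_tmp => _ [M [K KM] <-].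
rewrite lee_pdivrMl ?divr_gt0//.
have [f ff fM] := Delta_packing_le_feasible k2 cC nC C0 KM.
apply: ge_ereal_inf; eexists; first by exists f.
by rewrite unit_ball_vol.2 -!EFinM lee_fin -mulrA ler_pM2l// mulrC.
Qed.

Lemma Delta_dilate_le k (C : set E) (y : R) : (2 <= k)%N -> compact C -> vol C != 0%E ->
  (Delta_packing R n k < y%:E)%E ->
  \forall r \near +oo%R,
    (vol (@unit_ball R n) / vol (dilate r C) * Delta k (dilate r C) <= y%:E)%E.
Proof.
move=> k2 cC C0 /ereal_inf_lt[_ [f ff <-]] fy.
have [B0 BE] := unit_ball_vol; move: fy; set bf := Bop _ _ _ => fy.
set b := fine _ in B0 BE; have {}fy : b * bf < y by rewrite -lte_fin EFinM -BE.
(* This slack makes b (bf + eta) equal to y; it is positive because b bf < y. *)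
have [|r0 r00 h] := packing_to_Delta (eta := y / b - bf) k2 ff cC C0.
  by rewrite subr_gt0 ltr_pdivlMr// mulrC.
near=> r.
have rr0 : r0 <= r by near: r; apply: nbhs_pinfty_ge; rewrite num_real.
have r_gt0 : 0 < r by exact: lt_le_trans rr0.
have [K [M [KM MW]]] := h r rr0.
have cD := compact_dilate (r := r) cC.
have [W0 ->] := vol_ratio cD (vol_dilate_neq0 r_gt0 (compact_rV_measurable cC) C0); rewrite -/b.
apply: (@le_trans _ _ ((b / fine (vol (dilate r C)))%:E * M%:E)%E).
  rewrite lee_pmul2l ?fin_num//=; last by rewrite lte_fin divr_gt0.
  by apply: ereal_inf_lbound; exists M => //; exists K.
rewrite -EFinM lee_fin mulrAC ler_pdivrMr//.
move: MW; rewrite -/bf addrC subrK => MW.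
rewrite mulrC -ler_pdivlMr//; apply: le_trans MW _.
by rewrite mulrA (mulrC y).
Unshelve. all: by end_near. Qed.

(** An infinite limit is allowed: for p = +oo the upper condition is vacuous and the lower one
    forces u to be eventually +oo. The sign of p excludes -oo. *)
Lemma cvg_ge_near_le (u : R -> \bar R) (p : \bar R) : (0 <= p)%E ->
  (\forall r \near +oo%R, (p <= u r)%E) ->
  (forall y : R, (p < y%:E)%E -> \forall r \near +oo%R, (u r <= y%:E)%E) ->
  u @ +oo%R --> p.
Proof.
case: p => [p||] // p0 pu up.
  move=> A [d /= d0 dA].
  have pd : (p%:E < (p + d / 2)%:E)%E by rewrite lte_fin ltrDl divr_gt0.
  suff : \forall r \near +oo%R, A (u r) by [].
  near=> r.
  have h1 : (p%:E <= u r)%E by near: r.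
  have h2 : (u r <= (p + d / 2)%:E)%E by near: r; exact: up.
  move: h1 h2; case: (u r) => [x||] //; rewrite !lee_fin => px xp.
  apply: dA; rewrite /ball /= ltr_norml; apply/andP; split; lra.
apply: cvg_near_cst; near=> r.
by apply/eqP; rewrite -leye_eq; near: r.
Unshelve. all: by end_near. Qed.

End packing_bound.

Local Open Scope ereal_scope.

Theorem theorem2p3 (R : realType) (n k : nat) (n_ge1 : (1 <= n)%N)
    (k_ge2 : (2 <= k)%N) (C : set 'rV[R]_n) (C_compact : compact C)
    (C_Jordan : Jordan_measurable C) (C_vol : vol C != 0) :
  Delta_packing R n k <= vol (@unit_ball R n) / vol C * Delta k C /\
  (fun r : R => vol (@unit_ball R n) / vol (dilate r C) * Delta k (dilate r C))
    @ +oo%R --> Delta_packing R n k.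
Proof.
have C_null := Jordan_boundary_null C_compact C_Jordan.
split; first exact: Delta_packing_le.
(* The first claim, applied to each rC, bounds the limit from below; nearly optimal packing kernels
   bound it from above. *)
apply: (cvg_ge_near_le (Delta_packing_ge0 k_ge2)).
  near=> r; have r_gt0 : (0 < r)%R by near: r; apply: nbhs_pinfty_gt; rewrite num_real.
  apply: Delta_packing_le => //.
  - exact: compact_dilate.
  - exact: dilate_boundary_null.
  - by apply: vol_dilate_neq0 => //; exact: compact_rV_measurable.
by move=> y py; exact: Delta_dilate_le.
Unshelve. all: by end_near. Qed.
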